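(* Let $1<q<\infty$. Let $p\in(1,\infty)$ and $\omega\in A_p$, put $\omega'=\omega^{-1/(p-1)}$ and $\beta_\omega:=1-(1-\alpha_0)^p/[\omega]_{A_p}$, where $\alpha_0$ is the reverse doubling constant of $X$. Let $1<p<t<\min\{r,\ \log_2(\beta_\omega^{-1})\,r/n\}<\infty$, or let $1<p\le t<r=\infty$. Then $\mathcal H_{p',\omega'}^{t',r'}(\ell^{q'})$ and $\mathcal H_{p',\omega'}^{t',r'}$ are Banach spaces.
   Context: Setting: $(X,\rho,\mu)$ is a space of homogeneous type with quasidistance $\rho$ and nonnegative Borel measure $\mu$, $\mu(X)=\infty$. $B(x,r)=\{y:\rho(x,y)<r\}$, $V(x,r)=\mu(B(x,r))$. Doubling: $V(x,2r)\le CV(x,r)$ for all $x\in X$, $r>0$; $n>0$ is a fixed constant such that $V(x,\lambda r)\le C\lambda^nV(x,r)$ for all $\lambda\ge1$, $x\in X$, $r>0$. Dyadic cubes: fix a Christ dyadic system $\mathcal D=\{Q_\tau^k:k\in\mathbb Z,\tau\in I_k\}$ of open subsets of $X$ such that: $\mu(X\setminus\bigcup_{\tau\in I_k}Q_\tau^k)=0$ for all $k$; if $i\ge k$ then either $Q_\tau^i\subset Q_\beta^k$ or $Q_\tau^i\cap Q_\beta^k=\emptyset$; for each $(k,\tau)$ and $i<k$ there is a unique $\tau'$ with $Q_\tau^k\subset Q_{\tau'}^i$; $\operatorname{diam}Q_\tau^k\le\kappa_0\gamma^k$; each $Q_\tau^k$ contains a ball $B(x_{Q_\tau^k},a_0\gamma^k)$.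 Here $\kappa_0\in(0,\infty)$ and $\gamma=a_0=1/2$ (normalized). The parent of $Q_\tau^k$ is the cube $Q_{\tau'}^{k-1}$ containing it. Reverse doubling: there is $\alpha_0\in(0,1)$ (the reverse doubling constant) with $\mu(Q)\le\alpha_0\mu(R)$ whenever $Q$ is a dyadic cube and $R$ is its parent. Weights: a weight is a locally integrable function on $X$ with values in $(0,\infty)$ a.e.; $\omega(E)=\int_E\omega\,d\mu$. For $1<p<\infty$, $\omega\in A_p$ iff $[\omega]_{A_p}:=\sup_B\big(\frac1{\mu(B)}\int_B\omega\,d\mu\big)\big(\frac1{\mu(B)}\int_B\omega^{-1/(p-1)}d\mu\big)^{p-1}<\infty$, supremum over all balls $B$. Primes on exponents denote conjugates ($1/p+1/p'=1$), while $\omega'=\omega^{-1/(p-1)}$. Block spaces: a function $b$ is a $(p',t',\omega')$-block supported in a dyadic cube $Q$ if $\operatorname{supp}b\subset Q$ and $\big(\int_Q|b(x)|^{p'}\omega(x)^{-1/(p-1)}d\mu(x)\big)^{1/p'}\le\omega(Q)^{1/t-1/p}$. A sequence-valued function $\vec b=\{b^j\}_{j\in\mathbb Z}$ is a $(p',t',\omega',\ell^{q'})$-block supported in $Q$ if the same holds with $|b(x)|$ replaced by $\|\vec b(x)\|_{\ell^{q'}}$. The space $\mathcal H_{p',\omega'}^{t',r'}$ (resp. $\mathcal H_{p',\omega'}^{t',r'}(\ell^{q'})$) is the set of all measurable functions (resp. sequence-valued functions) $f$ on $X$ that can be written $f=\sum_{k\in\mathbb Z}\sum_{\tau\in I_k}\lambda_{k,\tau}b_{k,\tau}$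 $\mu$-a.e., with $\{\lambda_{k,\tau}\}\in\ell^{r'}$ and each $b_{k,\tau}$ a $(p',t',\omega')$-block (resp. $(p',t',\omega',\ell^{q'})$-block) supported in $Q_\tau^k$; the norm is the infimum of $\|\{\lambda_{k,\tau}\}\|_{\ell^{r'}}$ over all such decompositions. *)

(* Defs.v *)
From HB Require Import structures.
From mathcomp Require Import all_boot all_order all_algebra complex.
From mathcomp Require Import all_classical all_reals all_analysis.

Set Implicit Arguments.
Unset Strict Implicit.
Unset Printing Implicit Defensive.
Import Order.TTheory GRing.Theory Num.Theory.
Import numFieldNormedType.Exports.
Local Open Scope classical_set_scope.
Local Open Scope ring_scope.

Section homogeneous.
Context {R : realType} {d : measure_display} {X : measurableType d}.
Variables (rho : X -> X -> R) (mu : {measure set X -> \bar R}).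

Definition quasidistance : Prop :=
  [/\ forall x y, 0 <= rho x y,
      forall x y, rho x y = 0 <-> x = y,
      forall x y, rho x y = rho y x &
      exists2 A : R, 1 <= A &
        forall x y z, rho x z <= A * (rho x y + rho y z)].

Definition qball (x : X) (r : R) : set X := [set y | rho x y < r].

(* Open sets of the topology induced by [rho]; the balls themselves need not be
   open. *)
Definition qopen (U : set X) : Prop :=
  forall x, U x -> exists2 r : R, 0 < r & qball x r `<=` U.

Definition qdiam (E : set X) : \bar R :=
  ereal_sup [set z | exists x y, [/\ E x, E y & z = (rho x y)%:E]].

Definition doubling : Prop :=
  exists2 C : R, 0 < C & forall x (r : R), 0 < r ->
    (mu (qball x (2 * r)) <= C%:E * mu (qball x r))%E.

Definition upper_dimension (n : R) : Prop :=
  exists2 C : R, 0 < C & forall x (r lambda : R), 0 < r -> 1 <= lambda ->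
    (mu (qball x (lambda * r)) <= (C * lambda `^ n)%:E * mu (qball x r))%E.

Record homogeneous_type (n : R) : Prop := HomogeneousType {
  homogeneous_quasidistance : quasidistance ;
  homogeneous_borel : @measurable d X = <<s qopen >> ;
  homogeneous_measurable_ball : forall x (r : R), measurable (qball x r) ;
  homogeneous_ball_pos : forall x (r : R), 0 < r -> (0 < mu (qball x r))%E ;
  homogeneous_ball_fin : forall x (r : R), 0 < r -> (mu (qball x r) < +oo)%E ;
  homogeneous_doubling : doubling ;
  homogeneous_dimension_gt0 : 0 < n ;
  homogeneous_dimension : upper_dimension n
}.

Variables (I : int -> choiceType) (Q : forall k : int, I k -> set X).

(* Christ's construction with both constants gamma and a_0 normalized to 1/2. *)
Record dyadic_system (kappa0 : R) : Prop := DyadicSystem {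
  dyadic_kappa0_gt0 : 0 < kappa0 ;
  dyadic_open : forall k tau, qopen (@Q k tau) ;
  dyadic_cover : forall k, mu (~` \bigcup_(tau : I k) Q tau) = 0%E ;
  dyadic_nested : forall (i k : int) (tau : I i) (beta : I k), k <= i ->
    Q tau `<=` Q beta \/ Q tau `&` Q beta = set0 ;
  dyadic_ancestor : forall (i k : int) (tau : I k), i < k ->
    exists! tau' : I i, Q tau `<=` Q tau' ;
  dyadic_diam : forall (k : int) (tau : I k),
    (qdiam (Q tau) <= (kappa0 * 2^-1 ^ k)%:E)%E ;
  dyadic_inner_ball : forall (k : int) (tau : I k),
    exists x, qball x (2^-1 * 2^-1 ^ k) `<=` Q tau
}.

Definition reverse_doubling (alpha0 : R) : Prop :=
  0 < alpha0 < 1 /\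
  forall (k : int) (tau : I k) (tau' : I (k - 1)), Q tau `<=` Q tau' ->
    (mu (Q tau) <= alpha0%:E * mu (Q tau'))%E.

Definition weight (w : X -> R) : Prop :=
  [/\ measurable_fun setT w,
      {ae mu, forall x, 0 < w x} &
      forall x (r : R), 0 < r -> mu.-integrable (qball x r) (EFin \o w)].

Definition average (E : set X) (f : X -> R) : \bar R :=
  ((\int[mu]_(x in E) (f x)%:E) / mu E)%E.

Definition dual_weight (p : R) (w : X -> R) (x : X) : R :=
  w x `^ (- (p - 1)^-1).

Definition Ap_const (p : R) (w : X -> R) : \bar R :=
  ereal_sup [set a | exists x (r : R), 0 < r /\
    a = (average (qball x r) w *
         average (qball x r) (dual_weight p w) `^ (p - 1))%E].

Definition Ap_weight (p : R) (w : X -> R) : Prop :=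
  weight w /\ (Ap_const p w < +oo)%E.

Definition beta_const (alpha0 p : R) (w : X -> R) : R :=
  1 - (1 - alpha0) `^ p / fine (Ap_const p w).

End homogeneous.

Variant scalar_kind := RealScalars | ComplexScalars.

Definition scalar_field (R : realType) (s : scalar_kind) : numFieldType :=
  match s with RealScalars => R | ComplexScalars => R[i] end.

Section values.
Context {R : realType} {s : scalar_kind}.

Definition sRe : scalar_field R s -> R :=
  match s with RealScalars => id | ComplexScalars => @complex.Re R end.

Definition sIm : scalar_field R s -> R :=
  match s with RealScalars => fun=> 0 | ComplexScalars => @complex.Im R end.

(* The norm of a numFieldType takes its values in the field itself. *)
Definition modulus (z : scalar_field R s) : R := sRe `|z|.

Definition ell_norm (T : choiceType) (p : R) (v : T -> scalar_field R s) : \bar R :=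
  ((\esum_(i in [set: T]) (modulus (v i) `^ p)%:E) `^ p^-1)%E.

(* The sum of an absolutely convergent series, as the difference of the sums of
   the positive and negative parts. *)
Definition real_sums_to (T : choiceType) (c : T -> R) (a : R) : Prop :=
  summable [set: T] (EFin \o c) /\
  (a%:E = \esum_(i in [set: T]) (Num.max (c i) 0)%:E
          - \esum_(i in [set: T]) (Num.max (- c i) 0)%:E)%E.

Definition sums_to (T : choiceType) (c : T -> scalar_field R s) (a : scalar_field R s) :=
  real_sums_to (sRe \o c) (sRe a) /\ real_sums_to (sIm \o c) (sIm a).

(* Codomain of the functions: the scalars, or the sequences indexed by int with
   the l^q norm, which is +oo on the sequences that are not in l^q. *)
Record value_space := ValueSpace {
  value : lmodType (scalar_field R s) ;
  value_index : Type ;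
  coord : value_index -> value -> scalar_field R s ;
  value_norm : value -> \bar R
}.

Definition scalar_values : value_space :=
  @ValueSpace ((scalar_field R s)^o : lmodType (scalar_field R s)) unit
    (fun=> id) (fun v => (modulus v)%:E).

Definition ell_values (q : R) : value_space :=
  @ValueSpace ((int -> (scalar_field R s)^o) : lmodType (scalar_field R s)) int
    (fun j v => v j) (fun v => ell_norm q v).

End values.
Arguments value_space : clear implicits.
Arguments scalar_values : clear implicits.
Arguments ell_values : clear implicits.

Definition conjugate {R : realType} (p : \bar R) : R :=
  fine (hoelder_conjugate p).

Section blocks.
Context {R : realType} {s : scalar_kind} {d : measure_display}.
Context {X : measurableType d}.
Variable (mu : {measure set X -> \bar R}).
Variables (I : int -> choiceType) (Q : forall k : int, I k -> set X).
Variables (V : value_space R s) (w : X -> R) (p t : R) (r : \bar R).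
Implicit Types f : X -> value V.

Definition value_measurable f : Prop := forall j : value_index V,
  measurable_fun setT (fun x => sRe (coord j (f x))) /\
  measurable_fun setT (fun x => sIm (coord j (f x))).

Definition block (E : set X) (b : X -> value V) : Prop :=
  [/\ value_measurable b,
      forall x, ~ E x -> b x = 0 &
      ((\int[mu]_(x in E)
          (value_norm (b x) `^ conjugate p%:E * (dual_weight p w x)%:E))
         `^ (conjugate p%:E)^-1
       <= (\int[mu]_(x in E) (w x)%:E) `^ (t^-1 - p^-1))%E].

Definition block_decomposition f (lambda : {k : int & I k} -> scalar_field R s)
    : Prop :=
  exists2 b : {k : int & I k} -> X -> value V,
    forall i, block (Q (tagged i)) (b i) &
    {ae mu, forall x, forall j : value_index V,
      sums_to (fun i => lambda i * coord j (b i x)) (coord j (f x))}.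

Definition block_space : set (X -> value V) :=
  [set f | value_measurable f /\
    exists2 lambda, block_decomposition f lambda &
                    (ell_norm (conjugate r) lambda < +oo)%E].

Definition block_norm f : \bar R :=
  ereal_inf [set ell_norm (conjugate r) lambda |
             lambda in block_decomposition f].

(* The elements of the space are classes of functions modulo equality almost
   everywhere: [cls] realizes the quotient as a complete normed module. *)
Definition banach_space_mod_ae (H : set (X -> value V))
    (N : (X -> value V) -> \bar R) : Prop :=
  exists (B : completeNormedModType (scalar_field R s)) (cls : (X -> value V) -> B),
    [/\ forall (a : scalar_field R s) f g, H f -> H g ->
          H (fun x => a *: f x + g x) /\
          cls (fun x => a *: f x + g x) = a *: cls f + cls g,
        forall f g, H f -> H g ->
          (cls f = cls g <-> {ae mu, forall x, f x = g x}),
        forall b : B, exists2 f, H f & cls f = b &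
        forall f, H f -> (sRe `|cls f|)%:E = N f].

End blocks.

(* Main.v *)
(** The heart of the matter is that a block decomposition converges absolutely in
    [L^1] of every dyadic cube [P], with a bound [C_P] times the [l^{r'}] norm of
    its coefficients. A block supported in [Q] has integral over [P] at most
    [2 w(Q inter P)^{1/p} w(Q)^{1/t-1/p}], and these numbers form an [l^r] family: by the
    [A_p] condition and reverse doubling the weights of nested cubes grow
    geometrically, so that with [p < t < r] both the cubes inside [P] and the
    ancestors of [P] contribute convergent series. Hence an element of norm [0]
    vanishes almost everywhere. A series of decompositions with summable norms
    can then be added cube by cube: in each cube the sum of the multiples of
    blocks is a multiple of a countable convex combination of blocks, which is
    again a block by Jensen's inequality, and the new coefficients are controlled
    by Minkowski's inequality in [l^{r'}]. This gives the triangle inequality and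
    the convergence of absolutely convergent series, that is, completeness. *)

Require Import Defs.
From HB Require Import structures.
From mathcomp Require Import all_boot all_order all_algebra complex.
From mathcomp Require Import all_classical all_reals all_analysis.
From mathcomp Require Import measurable_realfun measurable_fun_approximation ring lra.
Set Implicit Arguments.
Unset Strict Implicit.
Unset Printing Implicit Defensive.
Import Order.TTheory GRing.Theory Num.Theory.
Import numFieldNormedType.Exports.
Local Open Scope classical_set_scope.
Local Open Scope ring_scope.
(* [coord] is otherwise the coordinate function of [vector]. *)
Local Notation coord := Defs.coord.

(** * Countable sums and convexity *)

(** The index types of the cubes are arbitrary and carry no enumeration, while every exchange of sum
    and integral rests on monotone convergence; an injection of the cubes into [nat] is therefore
    extracted from the measure itself. The ranges of the exponents come from two positive numbers.
    In the r-th power of the bound for a block, a cube j generations inside P gains a factor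
    beta^{j(r/t-1)}, and an ancestor j generations above P a factor beta^{jr(1/p-1/t)}: t < r makes
    the first decay, p < t the second. The number of cubes of one generation inside P is not
    controlled, but their intersections with P are disjoint; one factor w(Q inter P) is kept in
    every estimate to pay for the sum over a generation. The constant 2 in the integral of a block
    is the price of replacing Hoelder's inequality by a pointwise alternative, which also yields the
    A_p lower bound. *)

Section esum_facts.
Local Open Scope ereal_scope.
Context {R : realType}.
Implicit Types (T U : choiceType).

Lemma esum_ge_term T (a : T -> \bar R) i : (forall i, 0 <= a i) ->
  a i <= \esum_(i in [set: T]) a i.
Proof.
move=> a0; apply: esum_ge; exists [set i]; last by rewrite fsbig_set1.
by split=> //; exact: finite_set1.
Qed.

Lemma esumZl T (c : R) (a : T -> \bar R) : (0 <= c)%R -> (forall i, 0 <= a i) ->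
  \esum_(i in [set: T]) (c%:E * a i) = c%:E * \esum_(i in [set: T]) a i.
Proof.
move=> c0 a0.
(* One inequality for every factor suffices: the converse is this one for [c^-1] and the family
   [c%:E * a i]. *)
have le (k : R) (b : T -> \bar R) : (0 <= k)%R -> (forall i, 0 <= b i) ->
    \esum_(i in [set: T]) (k%:E * b i) <= k%:E * \esum_(i in [set: T]) b i.
  move=> k0 b0; apply: ge_ereal_sup => _ [X [finX _] <-].
  rewrite -ge0_mule_fsumr// lee_wpmul2l// ?lee_fin// esum_ge//.
  by exists X.
apply/eqP; rewrite eq_le le//=.
have [->|cn0] := eqVneq c 0%R.
  by rewrite mul0e esum_ge0// => i _; rewrite mul0e.
have cp : (0 < c)%R by rewrite lt_neqAle eq_sym cn0.
have ca0 i : 0 <= c%:E * a i by rewrite mule_ge0 ?lee_fin.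
have ci0 : (0 <= c^-1)%R by rewrite invr_ge0.
have := le _ _ ci0 ca0.
under eq_esum do rewrite muleA -EFinM mulVf// mul1e.
by rewrite lee_pdivlMl.
Qed.

Lemma esum_delta T (i0 : T) (c : \bar R) : 0 <= c ->
  \esum_(i in [set: T]) (if i == i0 then c else 0) = c.
Proof.
move=> c0; rewrite -[RHS](@esum_set1 _ _ i0 (fun=> c))// [RHS]esum_mkcond.
by apply: eq_esum => i _; case: eqP => [->|ne]; [rewrite mem_set|rewrite memNset].
Qed.

Lemma esum_exchange T U (a : T -> U -> \bar R) : (forall i j, 0 <= a i j) ->
  \esum_(i in [set: T]) \esum_(j in [set: U]) a i j =
  \esum_(j in [set: U]) \esum_(i in [set: T]) a i j.
Proof.
move=> a0; rewrite !esum_esum//.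
rewrite (reindex_esum ([set: U] `*`` fun=> [set: T]) _ (fun x => (x.2, x.1)))//.
split=> //=.
by move=> [i1 i2] [j1 j2] /= _ _ [] -> ->.
by move=> [i1 i2] _ /=; exists (i2, i1).
Qed.

(* The reduction to series gives access to monotone convergence. *)
Lemma esum_series T (e : T -> nat) (a : T -> \bar R) : injective e ->
  (forall i, 0 <= a i) ->
  \esum_(i in [set: T]) a i =
  \sum_(n <oo) \esum_(i in [set: T]) (if e i == n then a i else 0).
Proof.
move=> ie a0; rewrite nneseries_esumT; last first.
  by move=> n; apply: esum_ge0 => i _; case: ifP.
rewrite esum_exchange; last by move=> n i; case: ifP.
apply: eq_esum => i _.
by rewrite -[LHS](esum_delta (e i))//; apply: eq_esum => n _; rewrite eq_sym.
Qed.

(** By injectivity at most one index is sent to [n]. The alternative is uniform in [b], so that for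
    a family of functions the index does not depend on the point and the fibre sum is one of the
    functions, or zero. *)
Lemma esum_delta_inj T (e : T -> nat) n : injective e ->
  (exists i, forall b : T -> \bar R, (forall i, 0 <= b i) ->
     \esum_(i in [set: T]) (if e i == n then b i else 0) = b i) \/
  (forall b : T -> \bar R,
     \esum_(i in [set: T]) (if e i == n then b i else 0) = 0).
Proof.
move=> ie; case: (pselect (exists i, e i = n)) => [[i ei]|nei].
  left; exists i => b b0; rewrite -[RHS](esum_delta i)//.
  by apply: eq_esum => j _; rewrite -ei (inj_eq ie); case: eqP => // ->.
right=> b; rewrite esum1// => i _; case: eqP => // ei; exfalso; apply: nei.
by exists i.
Qed.

End esum_facts.

(** * Measurability and integration of countable sums of functions *)

Section esum_measure.
Local Open Scope ereal_scope.
Context {R : realType} {d : measure_display} {X : measurableType d}.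
Context {mu : {measure set X -> \bar R}} {T : choiceType}.
Variables (D : set X) (e : T -> nat) (f : T -> X -> \bar R).
Hypotheses (mD : measurable D) (ie : injective e).
Hypotheses (f0 : forall i x, 0 <= f i x) (mf : forall i, measurable_fun D (f i)).

Let g (n : nat) (x : X) : \bar R := \esum_(i in [set: T]) (if e i == n then f i x else 0).

Let mg n : measurable_fun D (g n).
Proof.
have [[i hi]|h0] := @esum_delta_inj R T e n ie.
  apply: (eq_measurable_fun (f i)) => // x _; rewrite /g hi//.
by apply: (eq_measurable_fun (fun=> 0)) => // x _; rewrite /g h0.
Qed.

Let gE x : \esum_(i in [set: T]) f i x = \sum_(n <oo) g n x.
Proof. exact: esum_series. Qed.

Let g0 n x : 0 <= g n x.
Proof. by apply: esum_ge0 => i _; case: ifP. Qed.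

Lemma measurable_esum :
  measurable_fun D (fun x => \esum_(i in [set: T]) f i x).
Proof.
apply: (eq_measurable_fun (fun x => \sum_(n <oo) g n x)) => [x _|].
  by rewrite gE.
exact: ge0_emeasurable_sum.
Qed.

Lemma integral_esum :
  \int[mu]_(x in D) (\esum_(i in [set: T]) f i x) =
  \esum_(i in [set: T]) (\int[mu]_(x in D) f i x).
Proof.
under eq_integral do rewrite gE.
rewrite integral_nneseries// [RHS](esum_series ie); last first.
  by move=> i; exact: integral_ge0.
apply: eq_eseriesr => n _.
have [[i hi]|h0] := @esum_delta_inj R T e n ie.
  rewrite hi; last by move=> j; exact: integral_ge0.
  by apply: eq_integral => x _; rewrite /g hi.
by rewrite h0 integral0_eq// => x _; rewrite /g h0.
Qed.

End esum_measure.

(** * Jensen's and Minkowski's inequalities for countable sums *)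

Section convexity.
Local Open Scope ereal_scope.
Context {R : realType}.
Implicit Types (T U : choiceType).

Lemma le_poweR (a : R) (x y : \bar R) : (0 <= a)%R -> 0 <= x -> x <= y ->
  x `^ a <= y `^ a.
Proof.
move=> a0 x0 xy; apply: gt0_ler_poweR => //; rewrite in_itv/= leey andbT//.
exact: le_trans xy.
Qed.

(** Young's inequality for x and y^(a-1) with exponents a and a/(a-1), multiplied by a.
    Geometrically, the graph of the a-th power lies above its tangent at y. *)
Lemma powR_tangent (a x y : R) : (1 <= a -> 0 <= x -> 0 <= y ->
  a * y `^ (a - 1) * x <= x `^ a + (a - 1) * y `^ a)%R.
Proof.
rewrite le_eqVlt => /predU1P[<- x0 y0|a1 x0 y0].
  by rewrite subrr powRr0 mul0r addr0 powRr1// !mul1r.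
have a0 : (0 < a)%R by rewrite (lt_trans _ a1).
have a10 : (a - 1 != 0)%R by rewrite subr_eq0 gt_eqF.
have := @conjugate_powR R x (y `^ (a - 1))%R a (a / (a - 1))%R x0 (powR_ge0 _ _) a0.
have -> : (0 < a / (a - 1))%R by rewrite divr_gt0// subr_gt0.
have -> : (a^-1 + (a / (a - 1))^-1 = 1)%R by field; rewrite a10 gt_eqF.
move=> /(_ isT erefl); rewrite -powRrM mulrC.
rewrite (_ : (a - 1) * _ = a)%R; last by field.
move=> h; rewrite -mulrA -ler_pdivlMl// (le_trans h)//.
rewrite le_eqVlt; apply/orP; left; apply/eqP; field.
by rewrite a10 gt_eqF.
Qed.

Lemma poweR_tangent (a y : R) (x : \bar R) : (1 <= a)%R -> 0 <= x -> (0 <= y)%R ->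
  (a * y `^ (a - 1))%:E * x <= x `^ a + ((a - 1) * y `^ a)%:E.
Proof.
move=> a1; case: x => [x||//] x0 y0.
  by rewrite lee_fin; exact: powR_tangent.
by rewrite /= gt_eqF ?(lt_le_trans _ a1)//= leey.
Qed.

(* The tangent inequality at [y := sum_i th_i x_i], averaged over [i]. *)
Lemma jensen_esum T (a : R) (th : T -> R) (x : T -> \bar R) :
  (1 <= a)%R -> (forall i, 0 <= th i)%R -> (forall i, 0 <= x i) ->
  \esum_(i in [set: T]) (th i)%:E <= 1 ->
  (\esum_(i in [set: T]) ((th i)%:E * x i)) `^ a <=
  \esum_(i in [set: T]) ((th i)%:E * x i `^ a).
Proof.
move=> a1 th0 x0 th1; have a0 : (0 < a)%R by rewrite (lt_le_trans _ a1).
set S := \esum_(i in _) _; set P := \esum_(i in _) _.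
have S0 : 0 <= S by apply: esum_ge0 => i _; rewrite mule_ge0 ?lee_fin.
have tx0 i : 0 <= (th i)%:E * x i `^ a by rewrite mule_ge0 ?lee_fin ?poweR_ge0.
have key (y : R) : (0 <= y)%R ->
    (a * y `^ (a - 1))%:E * S <= P + ((a - 1) * y `^ a)%:E.
  move=> y0; have k0 : (0 <= a * y `^ (a - 1))%R.
    by rewrite mulr_ge0 ?powR_ge0// ltW.
  have k1 : (0 <= (a - 1) * y `^ a)%R by rewrite mulr_ge0 ?powR_ge0 ?subr_ge0.
  rewrite -esumZl//; last by move=> i; rewrite mule_ge0 ?lee_fin.
  apply: (@le_trans _ _ (\esum_(i in [set: T]) ((th i)%:E * x i `^ a +
      ((a - 1) * y `^ a)%:E * (th i)%:E))).
    apply: le_esum => i _; rewrite muleCA [X in _ <= _ + X]muleC -ge0_muleDr.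
    - by rewrite lee_wpmul2l ?lee_fin// poweR_tangent.
    - exact: poweR_ge0.
    - by rewrite lee_fin.
  rewrite esumD//; last by move=> i _; rewrite mule_ge0 ?lee_fin.
  by rewrite leeD2l// esumZl// -[leRHS]mule1 lee_wpmul2l ?lee_fin.
(* An infinite [S] cannot serve as a point of tangency; the tangent at 1 then already forces
   [P = +oo]. *)
have [Sy|Sfin] := eqVneq S +oo.
  have := key 1%R ler01; rewrite Sy !powR1 !mulr1.
  rewrite gt0_muley ?lte_fin// => h.
  have -> : P = +oo; last by rewrite leey.
  by case: (P) h.
have Sf : S \is a fin_num by rewrite ge0_fin_numE// ltey.
have [s sE] : exists s, S = s%:E by exists (fine S); rewrite fineK.
have s0 : (0 <= s)%R by rewrite -lee_fin -sE.
have := key s s0; rewrite sE poweR_EFin -EFinM -mulrA.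
have [->|sn0] := eqVneq s 0%R.
  by move=> _; rewrite powR0 ?gt_eqF//; apply: esum_ge0.
have -> : (s `^ (a - 1) * s = s `^ a)%R.
  by rewrite -{2}(powRr1 s0) -powRD ?sn0 ?implybT// subrK.
rewrite -leeBlDr// -EFinB => h; apply: le_trans h.
by rewrite lee_fin -mulrBl opprB addrC subrK mul1r.
Qed.

Definition lp_norm T (a : R) (u : T -> \bar R) : \bar R :=
  (\esum_(i in [set: T]) u i `^ a) `^ a^-1.

Lemma lp_norm_ge0 T (a : R) (u : T -> \bar R) : 0 <= lp_norm a u.
Proof. exact: poweR_ge0. Qed.

Lemma lp_normP T (a : R) (u : T -> \bar R) (C : \bar R) : (0 < a)%R -> 0 <= C ->
  (lp_norm a u <= C <-> \esum_(i in [set: T]) u i `^ a <= C `^ a).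
Proof.
move=> a0 C0; have S0 : 0 <= \esum_(i in [set: T]) u i `^ a.
  by apply: esum_ge0 => i _; exact: poweR_ge0.
split=> h.
  have := le_poweR (ltW a0) (lp_norm_ge0 a u) h.
  by rewrite /lp_norm -poweRrM mulVf ?gt_eqF// poweRe1.
have ai0 : (0 <= a^-1)%R by rewrite invr_ge0 ltW.
by have := le_poweR ai0 S0 h; rewrite -poweRrM mulfV ?gt_eqF// poweRe1.
Qed.

Lemma lp_norm_ge_term T (a : R) (u : T -> \bar R) i : (0 < a)%R ->
  (forall i, 0 <= u i) -> u i <= lp_norm a u.
Proof.
move=> a0 u0.
have /lp_normP : lp_norm a u <= lp_norm a u by [].
move=> /(_ a0 (lp_norm_ge0 _ _)) h1.
have : u i `^ a <= lp_norm a u `^ a.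
  apply: le_trans h1; apply: (@esum_ge_term _ _ (fun i => u i `^ a)) => j.
  exact: poweR_ge0.
have ai0 : (0 <= a^-1)%R by rewrite invr_ge0 ltW.
move=> /(le_poweR ai0 (poweR_ge0 _ _)).
have E (x : \bar R) : 0 <= x -> (x `^ a) `^ a^-1 = x.
  by move=> x0; rewrite -poweRrM mulfV ?gt_eqF// poweRe1.
by rewrite !E ?lp_norm_ge0.
Qed.

Lemma le_lp_norm T (a : R) (u v : T -> \bar R) : (0 < a)%R ->
  (forall i, 0 <= u i) -> (forall i, u i <= v i) -> lp_norm a u <= lp_norm a v.
Proof.
move=> a0 u0 uv; apply: le_poweR; first by rewrite invr_ge0 ltW.
  by apply: esum_ge0 => i _; exact: poweR_ge0.
by apply: le_esum => i _; apply: le_poweR => //; exact: ltW.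
Qed.

Lemma lp_normZ T (a c : R) (u : T -> \bar R) : (0 < a)%R -> (0 <= c)%R ->
  (forall i, 0 <= u i) -> lp_norm a (fun i => c%:E * u i) = c%:E * lp_norm a u.
Proof.
move=> a0 c0 u0; rewrite /lp_norm.
under eq_esum do rewrite poweRM ?lee_fin// poweR_EFin.
rewrite esumZl ?powR_ge0//; last by move=> i; exact: poweR_ge0.
rewrite poweRM ?lee_fin ?powR_ge0//.
  by rewrite poweR_EFin -powRrM mulfV ?gt_eqF// powRr1.
by apply: esum_ge0 => i _; exact: poweR_ge0.
Qed.

(** With [N m] the norms and [S] their sum, the family to be bounded is [S] times a combination,
    with weights [N m / S], of the normalized families [u m / N m]. Jensen's inequality at each
    index, followed by an exchange of sums, shows that this combination has norm at most one. *)
Lemma minkowski_esum T U (a : R) (u : U -> T -> \bar R) : (1 <= a)%R ->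
  (forall m i, 0 <= u m i) ->
  lp_norm a (fun i => \esum_(m in [set: U]) u m i) <=
  \esum_(m in [set: U]) lp_norm a (u m).
Proof.
move=> a1 u0; have a0 : (0 < a)%R by rewrite (lt_le_trans _ a1).
pose N m := lp_norm a (u m).
set S := \esum_(m in _) _.
have N0 m : 0 <= N m by exact: lp_norm_ge0.
have S0 : 0 <= S by apply: esum_ge0 => m _; exact: N0.
have [->|Sfin] := eqVneq S +oo; first by rewrite leey.
have Sf : S \is a fin_num by rewrite ge0_fin_numE// ltey.
have NS m : N m <= S by exact: esum_ge_term.
have Nf m : N m \is a fin_num.
  by rewrite ge0_fin_numE// (le_lt_trans (NS m))// ltey.
have uN m i : u m i <= N m by exact: lp_norm_ge_term.
have [S00|Sn0] := eqVneq S 0.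
  have uz m i : u m i = 0.
    by apply/eqP; rewrite eq_le u0 andbT -S00 (le_trans (uN m i)).
  rewrite S00 /lp_norm esum1 ?poweR0r ?invr_eq0 ?gt_eqF// => i _.
  by rewrite esum1 ?poweR0r ?gt_eqF.
pose s := fine S; have s0 : (0 < s)%R.
  by rewrite fine_gt0// lt_neqAle eq_sym Sn0 S0/= ltey.
have sE : S = s%:E by rewrite fineK.
pose n m := fine (N m); have n0 m : (0 <= n m)%R by rewrite fine_ge0.
have nE m : N m = (n m)%:E by rewrite fineK.
pose x m i := ((n m)^-1)%:E * u m i.
have x0 m i : 0 <= x m i by rewrite mule_ge0 ?lee_fin ?invr_ge0.
(* When [n m = 0] the convention for the inverse of zero makes [x m i] vanish, and the identity
   survives because [u m i <= N m = 0]. *)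
have ux m i : u m i = s%:E * ((n m / s)%:E * x m i).
  rewrite /x !muleA -!EFinM; have [nz|nz] := eqVneq (n m) 0%R.
    rewrite nz mul0r mulr0 mul0r mul0e.
    by apply/eqP; rewrite eq_le u0 andbT (le_trans (uN m i))// nE nz.
  by rewrite (_ : _ * _ = 1)%R ?mul1e//; field; rewrite nz gt_eqF.
apply/lp_normP => //.
under eq_esum => i _.
  under eq_esum => m _ do rewrite ux.
  rewrite esumZl ?ltW//; last first.
    by move=> m; rewrite mule_ge0// lee_fin divr_ge0// ltW.
  rewrite poweRM; last 2 first.
  - by rewrite lee_fin ltW.
  - by apply: esum_ge0 => m _; rewrite mule_ge0// lee_fin divr_ge0// ltW.
  rewrite poweR_EFin.
  over.
rewrite esumZl ?powR_ge0//; last by move=> i; exact: poweR_ge0.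
rewrite sE poweR_EFin -[leRHS]mule1 lee_wpmul2l ?lee_fin ?powR_ge0//.
have th0 m : (0 <= n m / s)%R by rewrite divr_ge0// ltW.
have th1 : \esum_(m in [set: U]) (n m / s)%:E <= 1.
  under eq_esum => m _ do rewrite mulrC EFinM -nE.
  have si0 : (0 <= s^-1)%R by rewrite invr_ge0 ltW.
  by rewrite esumZl// -/S sE -EFinM mulVf// gt_eqF.
apply: (@le_trans _ _ (\esum_(i in [set: T])
    \esum_(m in [set: U]) ((n m / s)%:E * x m i `^ a))).
  by apply: le_esum => i _; exact: jensen_esum.
rewrite esum_exchange; last first.
  by move=> i m; rewrite mule_ge0 ?lee_fin ?poweR_ge0.
apply: le_trans th1; apply: le_esum => m _.
rewrite esumZl//; last by move=> i; exact: poweR_ge0.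
rewrite -[leRHS]mule1 lee_wpmul2l ?lee_fin//.
have [nz|nz] := eqVneq (n m) 0%R.
  rewrite esum1// => i _; rewrite /x nz invr0 mul0e poweR0r// gt_eqF//.
under eq_esum do rewrite /x poweRM ?lee_fin ?invr_ge0// poweR_EFin.
rewrite esumZl ?powR_ge0//; last by move=> i; exact: poweR_ge0.
have /lp_normP : lp_norm a (u m) <= N m by [].
rewrite nE => /(_ a0); rewrite lee_fin => /(_ (n0 m)) h.
apply: le_trans (lee_wpmul2l _ h) _; first by rewrite lee_fin powR_ge0.
by rewrite poweR_EFin -EFinM -powRM ?invr_ge0// mulVf// powR1.
Qed.

End convexity.

(** * Absolutely convergent sums of scalars *)

Section scalars.
Context {R : realType} {s : scalar_kind}.
Local Notation K := (scalar_field R s).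

(** For real scalars [y] is dropped, so [sIm] returns the second argument only if that argument is
    itself an imaginary part; this is the form of [sIm_of]. *)
Definition scalar_of (x y : R) : K :=
  match s return scalar_field R s with
  | RealScalars => x | ComplexScalars => Complex x y end.

Definition scalar_emb (x : R) : K := scalar_of x 0.

Lemma sReD (a b : K) : sRe (a + b) = sRe a + sRe b.
Proof. by move: a b; rewrite /sRe; case: s => //= -[? ?] [? ?]. Qed.

Lemma sImD (a b : K) : sIm (a + b) = sIm a + sIm b.
Proof.
by move: a b; rewrite /sIm; case: s => //= [? ?|[? ?] [? ?]//]; rewrite addr0.
Qed.

Lemma sReM (a b : K) : sRe (a * b) = sRe a * sRe b - sIm a * sIm b.
Proof.
move: a b; rewrite /sIm /sRe; case: s => //= [a b|[? ?] [? ?]//].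
by rewrite mul0r subr0.
Qed.

Lemma sImM (a b : K) : sIm (a * b) = sRe a * sIm b + sIm a * sRe b.
Proof.
move: a b; rewrite /sIm /sRe; case: s => //= [a b|[? ?] [? ?]//].
by rewrite mulr0 mul0r addr0.
Qed.

Lemma sRe0 : sRe (0 : K) = 0.
Proof. by rewrite /sRe; case: s. Qed.

Lemma sIm0 : sIm (0 : K) = 0.
Proof. by rewrite /sIm; case: s. Qed.

Lemma scalar_eq (a b : K) : sRe a = sRe b -> sIm a = sIm b -> a = b.
Proof. by move: a b; rewrite /sRe /sIm; case: s => //= -[? ?] [? ?] /= -> ->. Qed.

Lemma sImN (a : K) : sIm (- a) = - sIm a.
Proof. by apply/eqP; rewrite -addr_eq0 -sImD addNr sIm0. Qed.

Lemma sRe_of x y : sRe (scalar_of x y) = x.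
Proof. by rewrite /sRe /scalar_of; case: s. Qed.

Lemma sIm_of x (a : K) : sIm (scalar_of x (sIm a)) = sIm a.
Proof. by move: a; rewrite /sIm /scalar_of; case: s. Qed.

Lemma sRe_emb x : sRe (scalar_emb x) = x.
Proof. exact: sRe_of. Qed.

Lemma sIm_emb x : sIm (scalar_emb x) = 0.
Proof. by rewrite /scalar_emb /sIm /scalar_of; case: s. Qed.

Lemma scalar_embD x y : scalar_emb (x + y) = scalar_emb x + scalar_emb y.
Proof.
by apply: scalar_eq; rewrite ?sReD ?sImD ?sRe_emb ?sIm_emb ?addr0.
Qed.

Lemma scalar_embM x y : scalar_emb (x * y) = scalar_emb x * scalar_emb y.
Proof.
by apply: scalar_eq;
  rewrite ?sReM ?sImM ?sRe_emb ?sIm_emb ?mulr0 ?mul0r ?addr0 ?subr0.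
Qed.

Lemma scalar_emb1 : scalar_emb 1 = 1.
Proof. by rewrite /scalar_emb /scalar_of; case: s. Qed.

Lemma scalar_emb0 : scalar_emb 0 = 0.
Proof. by rewrite /scalar_emb /scalar_of; case: s. Qed.

Lemma scalar_embX x n : scalar_emb (x ^+ n) = scalar_emb x ^+ n.
Proof. by elim: n => [|n IH]; rewrite ?scalar_emb1// !exprS scalar_embM IH. Qed.

Lemma scalar_embn n : scalar_emb n%:R = n%:R.
Proof.
by elim: n => [|n IH]; rewrite ?scalar_emb0// !mulrS scalar_embD IH scalar_emb1.
Qed.

Lemma scalar_embV x : scalar_emb x^-1 = (scalar_emb x)^-1.
Proof.
have [->|x0] := eqVneq x 0; first by rewrite scalar_emb0 !invr0 scalar_emb0.
have h : scalar_emb x * scalar_emb x^-1 = 1.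
  by rewrite -scalar_embM mulfV// scalar_emb1.
have e0 : scalar_emb x != 0.
  by apply/eqP => e; move: h; rewrite e mul0r => /esym/eqP; rewrite oner_eq0.
by rewrite -[RHS]mulr1 -h mulKf.
Qed.

Lemma ler_emb x y : (scalar_emb x <= scalar_emb y) = (x <= y).
Proof.
by rewrite /scalar_emb /scalar_of; case: s => //=; rewrite lecE/= eqxx.
Qed.

Lemma scalar_gt0 (e : K) : 0 < e -> exists2 x, 0 < x & e = scalar_emb x.
Proof.
move: e; rewrite /scalar_emb /scalar_of; case: s => /= [e e0|[x y]].
  by exists e.
by rewrite ltcE/= => /andP[/eqP -> x0]; exists x.
Qed.

Lemma norm_modulus (z : K) : `|z| = scalar_emb (modulus z).
Proof.
rewrite /modulus /sRe /scalar_emb /scalar_of; move: z; case: s => //= z.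
Qed.

Lemma modulusE (z : K) : modulus z = Num.sqrt (sRe z ^+ 2 + sIm z ^+ 2).
Proof.
rewrite /modulus /sRe /sIm; move: z; case: s => z; last by rewrite normc_def.
by rewrite /= expr0n addr0 sqrtr_sqr.
Qed.

Lemma modulus_ge0 (z : K) : 0 <= modulus z.
Proof. by rewrite modulusE sqrtr_ge0. Qed.

Lemma scalar_emb_inj : injective scalar_emb.
Proof. by move=> x y /(congr1 sRe); rewrite !sRe_emb. Qed.

Lemma modulusM (a b : K) : modulus (a * b) = modulus a * modulus b.
Proof. by apply: scalar_emb_inj; rewrite scalar_embM -!norm_modulus normrM. Qed.

Lemma modulusV (a : K) : modulus a^-1 = (modulus a)^-1.
Proof. by apply: scalar_emb_inj; rewrite scalar_embV -!norm_modulus normfV. Qed.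

Lemma modulus0 : modulus (0 : K) = 0.
Proof. by apply: scalar_emb_inj; rewrite -norm_modulus normr0 scalar_emb0. Qed.

Lemma modulus0_eq0 (a : K) : modulus a = 0 -> a = 0.
Proof. by move=> a0; apply/normr0_eq0; rewrite norm_modulus a0 scalar_emb0. Qed.

Lemma modulus_emb x : modulus (scalar_emb x) = `|x|.
Proof. by rewrite modulusE sRe_emb sIm_emb expr0n addr0 sqrtr_sqr. Qed.

Lemma le_sRe_modulus (a : K) : `|sRe a| <= modulus a.
Proof.
by rewrite modulusE -(sqrtr_sqr (sRe a)) ler_wsqrtr// lerDl sqr_ge0.
Qed.

Lemma le_sIm_modulus (a : K) : `|sIm a| <= modulus a.
Proof.
by rewrite modulusE -(sqrtr_sqr (sIm a)) ler_wsqrtr// lerDr sqr_ge0.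
Qed.

(** The multiplier is the conjugate of [a] divided by its modulus. It reduces the estimate of a
    modulus to that of a real part. *)
Lemma modulus_phase (a : K) : exists u : K, modulus u <= 1 /\ sRe (u * a) = modulus a.
Proof.
have [->|a0] := eqVneq a 0.
  by exists 0; rewrite mul0r modulus0 sRe0.
have m0 : modulus a != 0 by apply: contra_neq a0; exact: modulus0_eq0.
exists (scalar_emb (modulus a)^-1 * scalar_of (sRe a) (sIm (- a))).
have hN : sIm (scalar_of (sRe a) (sIm (- a))) = - sIm a by rewrite sIm_of sImN.
have hm : modulus (scalar_of (sRe a) (sIm (- a))) = modulus a.
  by rewrite [LHS]modulusE sRe_of hN sqrrN -modulusE.
split.
  by rewrite modulusM hm modulus_emb ger0_norm ?invr_ge0 ?modulus_ge0// mulVf.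
rewrite -mulrA sReM sIm_emb mul0r subr0 sRe_emb sReM hN sRe_of mulNr opprK.
rewrite -!expr2 {1}modulusE -[X in _ * X = _]sqr_sqrtr.
  by rewrite -modulusE expr2 mulKf.
by rewrite addr_ge0 ?sqr_ge0.
Qed.

Lemma measurable_modulus {d : measure_display} {X : measurableType d}
    (D : set X) (f : X -> K) :
  measurable_fun D (fun x => sRe (f x)) -> measurable_fun D (fun x => sIm (f x)) ->
  measurable_fun D (fun x => modulus (f x)).
Proof.
move=> mR mI; under eq_fun do rewrite modulusE.
apply: measurableT_comp; last by apply: measurable_funD; exact: measurable_funX.
by apply: continuous_measurable_fun; exact: sqrt_continuous.
Qed.

End scalars.

(** * Absolutely convergent real series *)

Section sums.
Context {R : realType}.
Implicit Types T U : choiceType.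
Local Open Scope ereal_scope.

Lemma max0_split (z : R) : (z = Num.max z 0 - Num.max (- z) 0)%R.
Proof.
have /orP[z0|z0] := le_total 0%R z.
  by rewrite max_l// max_r ?subr0// oppr_le0.
by rewrite max_r// max_l ?oppr_ge0// add0r opprK.
Qed.

Lemma dominated_esum_fin T (c g : T -> R) : summable [set: T] (EFin \o c) ->
  (forall i, 0 <= g i <= `|c i|)%R ->
  exists x, \esum_(i in [set: T]) (g i)%:E = x%:E.
Proof.
move=> sc gc; exists (fine (\esum_(i in [set: T]) (g i)%:E)); rewrite fineK//.
rewrite ge0_fin_numE.
  apply: le_lt_trans sc; apply: le_esum => i _ /=.
  by rewrite lee_fin; have /andP[] := gc i.
by apply: esum_ge0 => i _; rewrite lee_fin; have /andP[] := gc i.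
Qed.

(** The canonical positive and negative parts can be replaced by any nonnegative families with
    finite sums: P - N = P' - N' gives P + N' = P' + N, and nonnegative sums add. This form is
    stable under addition, whereas the positive part of a sum is not the sum of the positive
    parts. *)
Lemma real_sums_toP T (c : T -> R) (a : R) : real_sums_to c a <->
  exists P N : T -> R, exists p n : R, [/\ forall i, (0 <= P i)%R,
    forall i, (0 <= N i)%R, forall i, (c i = P i - N i)%R,
    \esum_(i in [set: T]) (P i)%:E = p%:E /\
    \esum_(i in [set: T]) (N i)%:E = n%:E & (a = p - n)%R].
Proof.
split.
  move=> [sc aE].
  have fin := dominated_esum_fin sc.
  have [p hp] : exists x, \esum_(i in [set: T]) (Num.max (c i) 0)%:E = x%:E.
    by apply: fin => i; rewrite le_max lexx orbT/= ge_max ler_norm normr_ge0.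
  have [n hn] : exists x, \esum_(i in [set: T]) (Num.max (- c i) 0)%:E = x%:E.
    apply: fin => i; rewrite le_max lexx orbT/= ge_max normr_ge0 andbT.
    by rewrite -normrN ler_norm.
  exists (fun i => Num.max (c i) 0)%R, (fun i => Num.max (- c i) 0)%R, p, n.
  split => //.
  - by move=> i; rewrite le_max lexx orbT.
  - by move=> i; rewrite le_max lexx orbT.
  - by move=> i; exact: max0_split.
  - by move: aE; rewrite hp hn -EFinB => -[].
move=> [P [N [p [n [P0 N0 cE [hp hn] ->]]]]].
have sc : summable [set: T] (EFin \o c).
  apply: (@le_lt_trans _ _ (p%:E + n%:E)); last by rewrite -EFinD ltry.
  rewrite -hp -hn -esumD; [|by move=> i _; rewrite lee_fin..].
  apply: le_esum => i _ /=; rewrite cE lee_fin.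
  by rewrite (le_trans (ler_normB _ _))// !ger0_norm.
split => //.
have fin := dominated_esum_fin sc.
have [p' hp'] : exists x, \esum_(i in [set: T]) (Num.max (c i) 0)%:E = x%:E.
  by apply: fin => i; rewrite le_max lexx orbT/= ge_max ler_norm normr_ge0.
have [n' hn'] : exists x, \esum_(i in [set: T]) (Num.max (- c i) 0)%:E = x%:E.
  apply: fin => i; rewrite le_max lexx orbT/= ge_max normr_ge0 andbT.
  by rewrite -normrN ler_norm.
rewrite hp' hn' -EFinB; congr EFin.
have : p%:E + n'%:E = p'%:E + n%:E.
  rewrite -hp -hn -hp' -hn' -!esumD//; try by move=> i _; rewrite lee_fin.
  - apply: eq_esum => i _; rewrite -!EFinD; congr EFin.
    by have := max0_split (c i); have := cE i; lra.
  - by move=> i _; rewrite lee_fin le_max lexx orbT.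
  - by move=> i _; rewrite lee_fin le_max lexx orbT.
by rewrite -!EFinD => -[]; lra.
Qed.

Lemma real_sums_to_unique T (c : T -> R) (a b : R) :
  real_sums_to c a -> real_sums_to c b -> a = b.
Proof. by move=> [_ aE] [_ bE]; move: aE; rewrite -bE => -[]. Qed.

Lemma real_sums_toD T (c c' : T -> R) (a a' : R) :
  real_sums_to c a -> real_sums_to c' a' ->
  real_sums_to (fun i => c i + c' i)%R (a + a')%R.
Proof.
move=> /real_sums_toP[P [N [p [n [P0 N0 cE [hp hn] ->]]]]].
move=> /real_sums_toP[P' [N' [p' [n' [P0' N0' cE' [hp' hn'] ->]]]]].
apply/real_sums_toP; exists (fun i => P i + P' i)%R, (fun i => N i + N' i)%R.
exists (p + p')%R, (n + n')%R; split.
- by move=> i; rewrite addr_ge0.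
- by move=> i; rewrite addr_ge0.
- by move=> i; rewrite cE cE'; lra.
- rewrite !EFinD -hp -hp' -hn -hn'.
  by rewrite -!esumD// => i _; rewrite lee_fin.
- by lra.
Qed.

Lemma real_sums_toN T (c : T -> R) (a : R) :
  real_sums_to c a -> real_sums_to (fun i => - c i)%R (- a)%R.
Proof.
move=> /real_sums_toP[P [N [p [n [P0 N0 cE [hp hn] ->]]]]].
apply/real_sums_toP; exists N, P, n, p; split => //; last by rewrite opprB.
by move=> i; rewrite cE opprB.
Qed.

Lemma real_sums_toZ T (k : R) (c : T -> R) (a : R) :
  real_sums_to c a -> real_sums_to (fun i => k * c i)%R (k * a)%R.
Proof.
wlog k0 : k / (0 <= k)%R => [hw ca|].
  have [k0|k0] := leP 0%R k; first exact: hw.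
  have := real_sums_toN (hw (- k)%R _ ca).
  rewrite oppr_ge0 (ltW k0) mulNr opprK => /(_ isT); congr real_sums_to.
  by apply/funext => i; rewrite mulNr opprK.
move=> /real_sums_toP[P [N [p [n [P0 N0 cE [hp hn] ->]]]]].
apply/real_sums_toP; exists (fun i => k * P i)%R, (fun i => k * N i)%R.
exists (k * p)%R, (k * n)%R; split.
- by move=> i; rewrite mulr_ge0.
- by move=> i; rewrite mulr_ge0.
- by move=> i; rewrite cE mulrBr.
- by rewrite !EFinM -hp -hn -!esumZl.
- by rewrite mulrBr.
Qed.

(** A total function, equal to the sum only for summable families. Totality gives functions of a
    point that are measurable everywhere, without removing the points of divergence. *)
Definition real_sum T (c : T -> R) : R :=
  (fine (\esum_(i in [set: T]) (Num.max (c i) 0)%:E) -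
   fine (\esum_(i in [set: T]) (Num.max (- c i) 0)%:E))%R.

Lemma real_sumP T (c : T -> R) :
  \esum_(i in [set: T]) `|c i|%:E < +oo -> real_sums_to c (real_sum c).
Proof.
move=> sc; split => //; rewrite EFinB !fineK// ge0_fin_numE.
- apply: le_lt_trans sc; apply: le_esum => i _; rewrite lee_fin.
  by rewrite ge_max normr_ge0 andbT -normrN ler_norm.
- by apply: esum_ge0 => i _; rewrite lee_fin le_max lexx orbT.
- apply: le_lt_trans sc; apply: le_esum => i _; rewrite lee_fin.
  by rewrite ge_max normr_ge0 andbT ler_norm.
- by apply: esum_ge0 => i _; rewrite lee_fin le_max lexx orbT.
Qed.

Lemma real_sums_to_le T (c : T -> R) (a : R) : real_sums_to c a ->
  a%:E <= \esum_(i in [set: T]) `|c i|%:E.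
Proof.
move=> [_ ->]; apply: (@le_trans _ _ (\esum_(i in [set: T]) (Num.max (c i) 0)%:E)).
  rewrite -[leRHS]sube0 leeB//; apply: esum_ge0 => i _.
  by rewrite lee_fin le_max lexx orbT.
apply: le_esum => i _; rewrite lee_fin.
by rewrite ge_max normr_ge0 andbT ler_norm.
Qed.

Lemma real_sums_to_delta T (i0 : T) (z : R) :
  real_sums_to (fun i => if i == i0 then z else 0%R) z.
Proof.
apply/real_sums_toP.
exists (fun i => if i == i0 then Num.max z 0 else 0)%R.
exists (fun i => if i == i0 then Num.max (- z) 0 else 0)%R.
have z0 : (0 <= Num.max z 0)%R by rewrite le_max lexx orbT.
have z0' : (0 <= Num.max (- z) 0)%R by rewrite le_max lexx orbT.
exists (Num.max z 0)%R, (Num.max (- z) 0)%R; split => //.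
- by move=> i; case: ifP.
- by move=> i; case: ifP.
- by move=> i; case: ifP; rewrite ?subr0// => _; exact: max0_split.
- by split; rewrite -[RHS](esum_delta i0) ?lee_fin//; apply: eq_esum => i _; case: ifP.
- exact: max0_split.
Qed.

(** Tonelli's theorem for the positive and the negative parts separately: either order of summation
    yields the same two finite totals. *)
Lemma real_sums_to_fubini T U (c : T -> U -> R) (sT : T -> R) (sU : U -> R) (S : R) :
  \esum_(i in [set: T]) \esum_(j in [set: U]) `|c i j|%:E < +oo ->
  (forall i, real_sums_to (c i) (sT i)) ->
  (forall j, real_sums_to (c^~ j) (sU j)) ->
  real_sums_to sT S -> real_sums_to sU S.
Proof.
move=> cfin hT hU hS.
pose P i j := Num.max (c i j) 0%R; pose N i j := Num.max (- c i j)%R 0%R.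
have P0 i j : (0 <= P i j)%R by rewrite le_max lexx orbT.
have N0 i j : (0 <= N i j)%R by rewrite le_max lexx orbT.
have Pc i j : (P i j <= `|c i j|)%R by rewrite ge_max normr_ge0 andbT ler_norm.
have Nc i j : (N i j <= `|c i j|)%R.
  by rewrite ge_max normr_ge0 andbT -normrN ler_norm.
(* General in the index types because it serves both orders of summation. *)
have fin (V W : choiceType) (g h : V -> W -> R) :
    \esum_(i in [set: V]) \esum_(j in [set: W]) (h i j)%:E < +oo ->
    (forall i j, 0 <= g i j)%R -> (forall i j, g i j <= h i j)%R ->
    exists (s : V -> R) (x : R), [/\ forall i, (0 <= s i)%R,
      forall i, \esum_(j in [set: W]) (g i j)%:E = (s i)%:E &
      \esum_(i in [set: V]) (s i)%:E = x%:E].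
  move=> hfin g0 gh; have s0 i : 0 <= \esum_(j in [set: W]) (g i j)%:E.
    by apply: esum_ge0 => j _; rewrite lee_fin.
  have S0 : \esum_(i in [set: V]) \esum_(j in [set: W]) (g i j)%:E \is a fin_num.
    rewrite ge0_fin_numE; last by apply: esum_ge0 => i _.
    apply: le_lt_trans hfin; apply: le_esum => i _; apply: le_esum => j _.
    by rewrite lee_fin.
  have sf i : \esum_(j in [set: W]) (g i j)%:E \is a fin_num.
    rewrite ge0_fin_numE//; apply: le_lt_trans (esum_ge_term i s0) _.
    by rewrite -ge0_fin_numE//; apply: esum_ge0 => i' _.
  exists (fun i => fine (\esum_(j in [set: W]) (g i j)%:E)).
  exists (fine (\esum_(i in [set: V]) \esum_(j in [set: W]) (g i j)%:E)).
  split=> [i|i|]; [exact: fine_ge0|by rewrite fineK|].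
  by rewrite fineK//; apply: eq_esum => i _; rewrite fineK.
have cfin' : \esum_(j in [set: U]) \esum_(i in [set: T]) `|c i j|%:E < +oo.
  by rewrite -esum_exchange// => i j; rewrite lee_fin.
have [pT [p [pT0 pTE pE]]] := fin _ _ _ _ cfin P0 Pc.
have [nT [n [nT0 nTE nE]]] := fin _ _ _ _ cfin N0 Nc.
have [pU [p' [pU0 pUE pE']]] := fin _ _ (fun j i => P i j) _ cfin'
  (fun j i => P0 i j) (fun j i => Pc i j).
have [nU [n' [nU0 nUE nE']]] := fin _ _ (fun j i => N i j) _ cfin'
  (fun j i => N0 i j) (fun j i => Nc i j).
have pp : p' = p.
  apply: EFin_inj; rewrite -pE -pE'.
  under eq_esum do rewrite -pUE; under [RHS]eq_esum do rewrite -pTE.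
  by rewrite esum_exchange// => i j; rewrite lee_fin.
have nn : n' = n.
  apply: EFin_inj; rewrite -nE -nE'.
  under eq_esum do rewrite -nUE; under [RHS]eq_esum do rewrite -nTE.
  by rewrite esum_exchange// => i j; rewrite lee_fin.
have sTE i : sT i = (pT i - nT i)%R.
  by apply: EFin_inj; have [_ ->] := hT i; rewrite EFinB -pTE -nTE.
have sUE j : sU j = (pU j - nU j)%R.
  by apply: EFin_inj; have [_ ->] := hU j; rewrite EFinB -pUE -nUE.
apply/real_sums_toP; exists pU, nU, p, n; split => //.
  by rewrite pE' nE' pp nn.
apply: (real_sums_to_unique hS); apply/real_sums_toP.
by exists pT, nT, p, n; split.
Qed.

Lemma measurable_real_sum {d : measure_display} {X : measurableType d} T
    (e : T -> nat) (D : set X) (c : X -> T -> R) : measurable D -> injective e ->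
  (forall i, measurable_fun D (c^~ i)) ->
  measurable_fun D (fun x => real_sum (c x)).
Proof.
move=> mD ie mc; apply: measurable_funB.
  apply: (measurableT_comp (fine_measurable measurableT)).
  apply: (measurable_esum (e := e)
    (f := fun i x => (Num.max (c x i) 0)%:E) ie) => [i x|i].
    by rewrite lee_fin le_max lexx orbT.
  by apply/measurable_EFinP; apply: measurable_maxr => //; exact: measurable_cst.
apply: (measurableT_comp (fine_measurable measurableT)).
apply: (measurable_esum (e := e)
  (f := fun i x => (Num.max (- c x i) 0)%:E) ie) => [i x|i].
  by rewrite lee_fin le_max lexx orbT.
apply/measurable_EFinP; apply: measurable_maxr => //.
exact: measurableT_comp.
Qed.

End sums.

(** * Absolutely convergent series of real or complex scalars *)

Section scalar_sums.
Context {R : realType} {s : scalar_kind}.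
Local Notation K := (scalar_field R s).
Implicit Types T U : choiceType.

Lemma sums_to_unique T (c : T -> K) (a b : K) :
  sums_to c a -> sums_to c b -> a = b.
Proof.
move=> [aR aI] [bR bI]; apply: scalar_eq.
  exact: real_sums_to_unique aR bR.
exact: real_sums_to_unique aI bI.
Qed.

Lemma eq_sums_to T (c c' : T -> K) (a : K) : c =1 c' -> sums_to c a -> sums_to c' a.
Proof. by move=> /funext ->. Qed.

Lemma sums_toD T (c c' : T -> K) (a a' : K) : sums_to c a -> sums_to c' a' ->
  sums_to (fun i => c i + c' i) (a + a').
Proof.
move=> [aR aI] [bR bI]; split; rewrite ?sReD ?sImD.
  have := real_sums_toD aR bR; congr real_sums_to.
  by apply/funext => i /=; rewrite sReD.
have := real_sums_toD aI bI; congr real_sums_to.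
by apply/funext => i /=; rewrite sImD.
Qed.

Lemma sums_toZ T (k : K) (c : T -> K) (a : K) : sums_to c a ->
  sums_to (fun i => k * c i) (k * a).
Proof.
move=> [aR aI]; split; rewrite ?sReM ?sImM.
  have := real_sums_toD (real_sums_toZ (sRe k) aR)
    (real_sums_toN (real_sums_toZ (sIm k) aI)).
  by congr real_sums_to; apply/funext => i /=; rewrite sReM.
have := real_sums_toD (real_sums_toZ (sRe k) aI) (real_sums_toZ (sIm k) aR).
by congr real_sums_to; apply/funext => i /=; rewrite sImM.
Qed.

Lemma sums_to_delta T (i0 : T) (z : K) :
  sums_to (fun i => if i == i0 then z else 0) z.
Proof.
split; [have := real_sums_to_delta i0 (sRe z)|have := real_sums_to_delta i0 (sIm z)];
  congr real_sums_to; apply/funext => i /=; case: ifP; rewrite ?sRe0 ?sIm0//.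
Qed.

Lemma sums_to_0 T : sums_to (fun _ : T => 0) (0 : K).
Proof.
apply/(_ : real_sums_to _ _ /\ real_sums_to _ _).
have z : real_sums_to (fun _ : T => 0 : R) 0.
  apply/real_sums_toP; exists (fun=> 0), (fun=> 0), 0, 0; split => //.
  - by move=> i; rewrite subr0.
  - by rewrite !esum1.
  - by rewrite subr0.
split; rewrite ?sRe0 ?sIm0; move: z; congr real_sums_to; apply/funext => i /=.
  by rewrite sRe0.
by rewrite sIm0.
Qed.

(** Multiplying the series by the phase of its sum turns the modulus of the sum into a real part,
    and real sums are already controlled. *)
Lemma sums_to_modulus T (c : T -> K) (a : K) : sums_to c a ->
  ((modulus a)%:E <= \esum_(i in [set: T]) (modulus (c i))%:E)%E.
Proof.
move=> ca; have [u [u1 ua]] := modulus_phase a.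
have [/real_sums_to_le + _] := sums_toZ u ca.
rewrite ua => /le_trans; apply; apply: le_esum => i _; rewrite lee_fin.
rewrite (le_trans (le_sRe_modulus _))// modulusM ler_piMl//.
exact: modulus_ge0.
Qed.

Definition scalar_sum T (c : T -> K) : K :=
  scalar_of (real_sum (sRe \o c)) (real_sum (sIm \o c)).

Lemma sIm_real_sum T (c : T -> K) x :
  sIm (@scalar_of R s x (real_sum (sIm \o c))) = real_sum (sIm \o c).
Proof.
move: c; rewrite /sIm /scalar_of; case: s => //= c.
by rewrite /real_sum !esum1 ?subr0// => i _ /=; rewrite ?oppr0 maxxx.
Qed.

Lemma scalar_sumP T (c : T -> K) :
  (\esum_(i in [set: T]) (modulus (c i))%:E < +oo)%E -> sums_to c (scalar_sum c).
Proof.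
move=> cfin; split.
  rewrite sRe_of; apply: real_sumP; apply: le_lt_trans cfin; apply: le_esum => i _.
  by rewrite lee_fin le_sRe_modulus.
rewrite sIm_real_sum; apply: real_sumP; apply: le_lt_trans cfin.
by apply: le_esum => i _; rewrite lee_fin le_sIm_modulus.
Qed.

Lemma modulus_scalar_sum T (c : T -> K) :
  ((modulus (scalar_sum c))%:E <= \esum_(i in [set: T]) (modulus (c i))%:E)%E.
Proof.
set S := (X in (_ <= X)%E).
have [->|Sy] := eqVneq S +oo%E; first by rewrite leey.
by apply: sums_to_modulus; apply: scalar_sumP; rewrite -/S ltey.
Qed.

Lemma sums_to_fubini T U (c : T -> U -> K) (sT : T -> K) (sU : U -> K) (S : K) :
  (\esum_(i in [set: T]) \esum_(j in [set: U]) (modulus (c i j))%:E < +oo)%E ->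
  (forall i, sums_to (c i) (sT i)) -> (forall j, sums_to (c^~ j) (sU j)) ->
  sums_to sT S -> sums_to sU S.
Proof.
move=> cfin hT hU [hR hI]; split.
  apply: (@real_sums_to_fubini _ T U (fun i j => sRe (c i j)) (sRe \o sT)) => //.
  - apply: le_lt_trans cfin; apply: le_esum => i _; apply: le_esum => j _.
    by rewrite lee_fin le_sRe_modulus.
  - by move=> i; have [] := hT i.
  - by move=> i; have [] := hU i.
apply: (@real_sums_to_fubini _ T U (fun i j => sIm (c i j)) (sIm \o sT)) => //.
- apply: le_lt_trans cfin; apply: le_esum => i _; apply: le_esum => j _.
  by rewrite lee_fin le_sIm_modulus.
- by move=> i; have [] := hT i.
- by move=> i; have [] := hU i.
Qed.

Lemma measurable_scalar_sum {d : measure_display} {X : measurableType d} T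
    (e : T -> nat) (c : X -> T -> K) : injective e ->
  (forall i, measurable_fun setT (fun x => sRe (c x i)) /\
             measurable_fun setT (fun x => sIm (c x i))) ->
  measurable_fun setT (fun x => sRe (scalar_sum (c x))) /\
  measurable_fun setT (fun x => sIm (scalar_sum (c x))).
Proof.
move=> ie mc; split.
  under eq_fun do rewrite sRe_of.
  by apply: (measurable_real_sum (e := e)) => // i; have [] := mc i.
under eq_fun do rewrite sIm_real_sum.
by apply: (measurable_real_sum (e := e)) => // i; have [] := mc i.
Qed.

End scalar_sums.

(** * The complete quotient of a seminormed space *)

(** The seminorm is constrained only on [sn_set], since outside it a block norm may be infinite and
    its real value meaningless. It takes values in [K], which need not be Archimedean, hence
    [sn_arch]. Completeness is encoded by [sn_series], for series dominated by a geometric one; the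
    constants 4 and 5 are explained where the tails are estimated. *)
Record seminormed_subspace (K : numFieldType) (E : lmodType K) := {
  sn_set : set E ;
  sn_norm : E -> K ;
  sn_lin : forall a f g, sn_set f -> sn_set g -> sn_set (a *: f + g) ;
  sn_set0 : sn_set 0 ;
  sn_normD : forall f g, sn_set f -> sn_set g ->
    sn_norm (f + g) <= sn_norm f + sn_norm g ;
  sn_normZ : forall a f, sn_set f -> sn_norm (a *: f) = `|a| * sn_norm f ;
  sn_arch : forall e : K, 0 < e -> exists M, 5 * 2^-1 ^+ M < e ;
  sn_series : forall u : nat -> E, (forall m, sn_set (u m)) ->
    (forall m, sn_norm (u m) <= 2^-1 ^+ m) ->
    exists2 f, sn_set f &
      forall M, sn_norm (f - \sum_(m < M) u m) <= 4 * 2^-1 ^+ M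
}.

Section seminorm_quotient.
Context {K : numFieldType} {E : lmodType K} (S : seminormed_subspace E).
Local Notation H := (sn_set S).
Local Notation N := (sn_norm S).

Lemma sn_setD f g : H f -> H g -> H (f + g).
Proof. by move=> Hf Hg; have := sn_lin 1 Hf Hg; rewrite scale1r. Qed.

Lemma sn_setZ a f : H f -> H (a *: f).
Proof. by move=> Hf; have := sn_lin a Hf (sn_set0 S); rewrite addr0. Qed.

Lemma sn_setN f : H f -> H (- f).
Proof. by move=> Hf; rewrite -scaleN1r; exact: sn_setZ. Qed.

Lemma sn_setB f g : H f -> H g -> H (f - g).
Proof. by move=> Hf Hg; apply: sn_setD => //; exact: sn_setN. Qed.

Lemma sn_norm0 : N 0 = 0.
Proof. by rewrite -(scale0r 0) sn_normZ ?normr0 ?mul0r//; exact: sn_set0. Qed.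

Lemma sn_normN f : H f -> N (- f) = N f.
Proof. by move=> Hf; rewrite -scaleN1r sn_normZ// normrN1 mul1r. Qed.

Lemma sn_norm_ge0 f : H f -> 0 <= N f.
Proof.
move=> Hf; have := sn_normD Hf (sn_setN Hf).
by rewrite subrr sn_norm0 sn_normN// -mulr2n pmulrn_lge0.
Qed.

Lemma sn_dist0C f g : H f -> H g -> N (f - g) = 0 -> N (g - f) = 0.
Proof.
by move=> Hf Hg fg; rewrite -opprB sn_normN//; exact: sn_setB.
Qed.

Lemma sn_dist0_trans f g h : H f -> H g -> H h ->
  N (f - g) = 0 -> N (g - h) = 0 -> N (f - h) = 0.
Proof.
move=> Hf Hg Hh fg gh; apply/eqP; rewrite eq_le sn_norm_ge0 ?andbT; last first.
  exact: sn_setB.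
have -> : f - h = (f - g) + (g - h) by rewrite addrA subrK.
have := sn_normD (sn_setB Hf Hg) (sn_setB Hg Hh).
by rewrite fg gh addr0.
Qed.

(* A canonical representative of the class of [f]: the set it is chosen from
   depends only on the class. *)
Definition sn_repr (f : E) : E := xget 0 [set g | H g /\ N (f - g) = 0].

Lemma sn_reprP f : H f -> H (sn_repr f) /\ N (f - sn_repr f) = 0.
Proof.
move=> Hf; rewrite /sn_repr.
case: xgetP => [g _ //|/(_ f)/=]; rewrite subrr sn_norm0.
by move=> nf; exfalso; apply: nf.
Qed.

Lemma sn_repr_eq f g : H f -> H g -> N (f - g) = 0 -> sn_repr f = sn_repr g.
Proof.
move=> Hf Hg fg; rewrite /sn_repr; congr (xget _ _); apply/seteqP.
split=> h /= [Hh hz]; split => //.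
  exact: (sn_dist0_trans Hg Hf Hh (sn_dist0C Hf Hg fg)).
exact: (sn_dist0_trans Hf Hg Hh fg).
Qed.

Definition sn_reduced : pred E := fun f => `[< H f /\ sn_repr f = f >].

(** The quotient is the subtype of canonical representatives, which inherits its choice structure
    from [E]. *)
Definition sn_quot := {f : E | sn_reduced f}.
HB.instance Definition _ := [Choice of sn_quot by <:].

Let sn_repr_reduced f : H f -> sn_reduced (sn_repr f).
Proof.
move=> Hf; have [Hr fr] := sn_reprP Hf; apply/asboolP; split => //.
exact/esym/sn_repr_eq.
Qed.

Definition sn_cls (f : E) : sn_quot :=
  match pselect (H f) with
  | left Hf => exist sn_reduced _ (sn_repr_reduced Hf)
  | right _ => exist sn_reduced _ (sn_repr_reduced (sn_set0 S))
  end.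

Lemma sn_clsE f : H f -> val (sn_cls f) = sn_repr f.
Proof. by rewrite /sn_cls; case: pselect. Qed.

Lemma sn_quot_set (x : sn_quot) : H (val x).
Proof. by case: x => f /= /asboolP[]. Qed.

Lemma sn_clsK (x : sn_quot) : sn_cls (val x) = x.
Proof.
case: x => f fP; have /asboolP[Hf ff] := fP.
by apply/val_inj; rewrite sn_clsE.
Qed.

Lemma sn_cls_eq f g : H f -> H g -> sn_cls f = sn_cls g <-> N (f - g) = 0.
Proof.
move=> Hf Hg; split=> [/(congr1 val)|fg]; last first.
  by apply: val_inj; rewrite !sn_clsE//; exact: sn_repr_eq.
rewrite !sn_clsE// => fg; have [Hrf rf] := sn_reprP Hf.
have [Hrg rg] := sn_reprP Hg.
apply: (sn_dist0_trans Hf Hrf Hg rf); rewrite fg; exact: sn_dist0C.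
Qed.

Lemma sn_cls_ind (P : sn_quot -> Prop) :
  (forall f, H f -> P (sn_cls f)) -> forall x, P x.
Proof. by move=> h x; rewrite -(sn_clsK x); apply: h; exact: sn_quot_set. Qed.

Definition sn_add (x y : sn_quot) := sn_cls (val x + val y).
Definition sn_opp (x : sn_quot) := sn_cls (- val x).
Definition sn_scale (a : K) (x : sn_quot) := sn_cls (a *: val x).
Definition sn_qnorm (x : sn_quot) : K := N (val x).

Lemma sn_addE f g : H f -> H g -> sn_add (sn_cls f) (sn_cls g) = sn_cls (f + g).
Proof.
move=> Hf Hg; have [Hrf rf] := sn_reprP Hf; have [Hrg rg] := sn_reprP Hg.
apply/sn_cls_eq; rewrite ?sn_clsE//; do ?exact: sn_setD.
rewrite opprD addrACA.
apply/eqP; rewrite eq_le sn_norm_ge0 ?andbT; last by apply: sn_setD; exact: sn_setB.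
rewrite (le_trans (sn_normD _ _))//; do ?exact: sn_setB.
by rewrite (sn_dist0C Hf)// (sn_dist0C Hg)// addr0.
Qed.

Lemma sn_scaleE a f : H f -> sn_scale a (sn_cls f) = sn_cls (a *: f).
Proof.
move=> Hf; have [Hrf rf] := sn_reprP Hf.
apply/sn_cls_eq; rewrite ?sn_clsE//; do ?exact: sn_setZ.
rewrite -scalerBr sn_normZ; last exact: sn_setB.
by rewrite (sn_dist0C Hf)// mulr0.
Qed.

Lemma sn_oppE f : H f -> sn_opp (sn_cls f) = sn_cls (- f).
Proof.
move=> Hf; rewrite -scaleN1r -sn_scaleE//.
by rewrite /sn_opp /sn_scale scaleN1r.
Qed.

Lemma sn_qnormE f : H f -> sn_qnorm (sn_cls f) = N f.
Proof.
move=> Hf; have [Hrf rf] := sn_reprP Hf; rewrite /sn_qnorm sn_clsE//.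
apply/eqP; rewrite eq_le; apply/andP; split.
  have -> : sn_repr f = f + (sn_repr f - f) by rewrite addrC subrK.
  rewrite (le_trans (sn_normD _ _))//; first exact: sn_setB.
  by rewrite (sn_dist0C Hf)// addr0.
have := sn_normD (sn_setB Hf Hrf) Hrf.
by rewrite subrK rf add0r.
Qed.

Let addA : associative sn_add.
Proof.
elim/sn_cls_ind => f Hf; elim/sn_cls_ind => g Hg; elim/sn_cls_ind => h Hh.
by rewrite !sn_addE ?addrA//; exact: sn_setD.
Qed.

Let addC : commutative sn_add.
Proof. by move=> x y; rewrite /sn_add addrC. Qed.

Let add0 : left_id (sn_cls 0) sn_add.
Proof. by elim/sn_cls_ind => f Hf; rewrite sn_addE ?add0r//; exact: sn_set0. Qed.

Let addN : left_inverse (sn_cls 0) sn_opp sn_add.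
Proof.
by elim/sn_cls_ind => f Hf; rewrite sn_oppE// sn_addE ?addNr//; exact: sn_setN.
Qed.

HB.instance Definition _ := GRing.isZmodule.Build sn_quot addA addC add0 addN.

Let scaleA a b x : sn_scale a (sn_scale b x) = sn_scale (a * b) x.
Proof.
elim/sn_cls_ind: x => f Hf.
by rewrite !sn_scaleE ?scalerA//; exact: sn_setZ.
Qed.

Let scale1 : left_id 1 sn_scale.
Proof. by elim/sn_cls_ind => f Hf; rewrite sn_scaleE// scale1r. Qed.

Let scaleDr : right_distributive sn_scale +%R.
Proof.
move=> a; elim/sn_cls_ind => f Hf; elim/sn_cls_ind => g Hg.
rewrite [sn_cls f + sn_cls g]sn_addE// !sn_scaleE//; last exact: sn_setD.
by rewrite [RHS]sn_addE ?scalerDr//; exact: sn_setZ.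
Qed.

Let scaleDl x : {morph sn_scale^~ x : a b / a + b}.
Proof.
move=> a b; elim/sn_cls_ind: x => f Hf; rewrite !sn_scaleE//.
by rewrite [RHS]sn_addE ?scalerDl//; exact: sn_setZ.
Qed.

HB.instance Definition _ :=
  GRing.Zmodule_isLmodule.Build K sn_quot scaleA scale1 scaleDr scaleDl.

Let qnormD (x y : sn_quot) : sn_qnorm (x + y) <= sn_qnorm x + sn_qnorm y.
Proof.
elim/sn_cls_ind: x => f Hf; elim/sn_cls_ind: y => g Hg.
rewrite [sn_cls f + sn_cls g]sn_addE// !sn_qnormE//; last exact: sn_setD.
exact: sn_normD.
Qed.

Let qnormZ a (x : sn_quot) : sn_qnorm (a *: x) = `|a| * sn_qnorm x.
Proof.
elim/sn_cls_ind: x => f Hf.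
rewrite [a *: _]sn_scaleE// !sn_qnormE//; last exact: sn_setZ.
exact: sn_normZ.
Qed.

Let qnorm0 (x : sn_quot) : sn_qnorm x = 0 -> x = 0.
Proof.
elim/sn_cls_ind: x => f Hf; rewrite sn_qnormE// => f0.
by apply/sn_cls_eq; rewrite ?subr0//; exact: sn_set0.
Qed.

HB.instance Definition _ := Lmodule_isNormed.Build K sn_quot qnormD qnormZ qnorm0.

Lemma sn_norm_cls f : H f -> `|sn_cls f| = N f.
Proof. exact: sn_qnormE. Qed.

Lemma sn_cls_lin a f g : H f -> H g ->
  sn_cls (a *: f + g) = a *: sn_cls f + sn_cls g.
Proof.
move=> Hf Hg; rewrite [a *: sn_cls f]sn_scaleE// [RHS]sn_addE//; exact: sn_setZ.
Qed.

Lemma sn_cls_sum (u : nat -> E) M : (forall m, H (u m)) ->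
  H (\sum_(m < M) u m) /\ sn_cls (\sum_(m < M) u m) = \sum_(m < M) sn_cls (u m).
Proof.
move=> Hu; elim: M => [|M [HM IH]].
  by rewrite !big_ord0; split => //; exact: sn_set0.
rewrite !big_ord_recr/=; split; first exact: sn_setD.
by rewrite -IH; apply: esym; apply: sn_addE.
Qed.

(** The filter is replaced by a sequence: centres [x m] of balls of radius 2^-(m+2) belonging to the
    filter. Their increments form a series to which [sn_series] applies, and [x 0] plus its sum is
    the limit. *)
Let quot_complete (F : set_system sn_quot) : ProperFilter F -> cauchy F -> cvg F.
Proof.
move=> FF /cauchyP Fc.
have e0 m : 0 < 2^-1 ^+ m.+2 :> K by rewrite exprn_gt0// invr_gt0.
pose x m := projT1 (cid (Fc _ (e0 m))).
have Fx m : F (ball (x m) (2^-1 ^+ m.+2)) by rewrite /x; case: cid.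
pose u m := val (x m.+1 - x m).
have Hu m : H (u m) by exact: sn_quot_set.
have uE m : sn_cls (u m) = x m.+1 - x m by rewrite sn_clsK.
(* A common point of two successive balls bounds the increment by 1/4 + 1/8 = 3/8 times 2^-m. *)
have un m : N (u m) <= 2^-1 ^+ m.
  rewrite -sn_norm_cls// uE.
  have [z [zm zm1]] := filter_ex (filterI (Fx m) (Fx m.+1)).
  move: zm zm1; rewrite -!ball_normE/= => zm zm1.
  rewrite distrC (le_trans (ler_distD z _ _))// [`|z - _|]distrC.
  rewrite (le_trans (lerD (ltW zm) (ltW zm1)))//.
  have y0 : 0 <= 2^-1 ^+ m :> K by rewrite exprn_ge0// invr_ge0.
  rewrite (_ : _ + _ = 3 / 8 * 2^-1 ^+ m); last by rewrite !exprS; field.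
  by rewrite ler_piMl// ler_pdivrMr// mul1r ler_nat.
have [f Hf fM] := sn_series Hu un.
have xM M : x M = x 0 + sn_cls (\sum_(m < M) u m).
  have [_ ->] := sn_cls_sum M Hu.
  under eq_bigr do rewrite uE.
  rewrite -(big_mkord xpredT (fun m => x m.+1 - x m)) telescope_sumr//.
  by rewrite addrC subrK.
apply/cvg_ex; exists (x 0 + sn_cls f); apply/cvg_ballP => e eps0.
(* The tail of the series and the radius of the ball around [x M] add up to 4 + 1/4 = 17/4 times
   2^-M, whence the constant 5 in [sn_arch]. *)
have [M Me] := sn_arch S eps0.
apply: filterS (Fx M) => z; rewrite -!ball_normE/= => zM.
rewrite (le_lt_trans _ Me)// (le_trans (ler_distD (x M) _ _))//.
have [HM _] := sn_cls_sum M Hu.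
have -> : x 0 + sn_cls f - x M = sn_cls (f - \sum_(m < M) u m).
  rewrite [f - _]addrC -scaleN1r sn_cls_lin// scaleN1r [RHS]addrC (xM M) opprD.
  by rewrite addrACA subrr add0r.
rewrite sn_norm_cls//; last exact: sn_setB.
rewrite (le_trans (lerD (fM M) (ltW zM)))//.
rewrite (_ : _ + _ = 17 / 4 * 2^-1 ^+ M); last by rewrite !exprS; field.
by rewrite ler_wpM2r ?exprn_ge0 ?invr_ge0// ler_pdivrMr// -natrM ler_nat.
Qed.

HB.instance Definition _ := Uniform_isComplete.Build sn_quot quot_complete.

End seminorm_quotient.

Lemma seminormed_subspace_complete (K : numFieldType) (E : lmodType K)
    (S : seminormed_subspace E) :
  exists (B : completeNormedModType K) (cls : E -> B),
    [/\ forall a f g, sn_set S f -> sn_set S g ->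
          cls (a *: f + g) = a *: cls f + cls g,
        forall f g, sn_set S f -> sn_set S g ->
          (cls f = cls g <-> sn_norm S (f - g) = 0),
        forall b, exists2 f, sn_set S f & cls f = b &
        forall f, sn_set S f -> `|cls f| = sn_norm S f].
Proof.
exists (sn_quot S : completeNormedModType K), (@sn_cls _ _ S); split.
- by move=> a f g; exact: sn_cls_lin.
- by move=> f g; exact: sn_cls_eq.
- by move=> b; exists (val b); [exact: sn_quot_set|exact: sn_clsK].
- exact: sn_norm_cls.
Qed.

(** * Superposition of block decompositions *)

(** What the scalars and the l^q sequences have in common, so that completeness is proved once.
    [value_norm_sum] is a countable triangle inequality whose hypothesis concerns only moduli of
    coordinates: no convergence in the value space is involved, and the norm may be infinite. *)
Record regular_values {R : realType} {s : scalar_kind} (V : value_space R s) :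
    Prop := RegularValues {
  coord_lin : forall (j : value_index V) a (u v : value V),
    coord j (a *: u + v) = a * coord j u + coord j v ;
  coord_surj : forall c : value_index V -> scalar_field R s,
    exists v : value V, forall j, coord j v = c j ;
  coord_inj : forall u v : value V, (forall j, coord j u = coord j v) -> u = v ;
  value_norm_ge0 : forall v : value V, (0 <= value_norm v)%E ;
  coord_le_norm : forall (j : value_index V) (v : value V),
    ((modulus (coord j v))%:E <= value_norm v)%E ;
  value_norm_sum : forall (v : value V) (u : nat -> value V) (th : nat -> R),
    (forall m, 0 <= th m) ->
    (forall j : value_index V, ((modulus (coord j v))%:E <=
      \esum_(m in [set: nat]) (th m * modulus (coord j (u m)))%:E)%E) ->
    (value_norm v <= \esum_(m in [set: nat]) ((th m)%:E * value_norm (u m)))%E ;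
  measurable_value_norm : forall (d : measure_display) (X : measurableType d)
    (b : X -> value V), value_measurable b ->
    measurable_fun setT (fun x => value_norm (b x))
}.

Section regular_instances.
Context {R : realType} {s : scalar_kind}.

Lemma regular_scalar_values : regular_values (scalar_values R s).
Proof.
split=> //=.
- by move=> c; exists (c tt); case.
- by move=> u v /(_ tt).
- by move=> v; rewrite lee_fin modulus_ge0.
- move=> v u th th0 /(_ tt) /le_trans; apply; apply: le_esum => m _.
  by rewrite EFinM.
- move=> d X b mb; have [mR mI] := mb tt.
  by apply/measurable_EFinP; exact: measurable_modulus.
Qed.

Lemma regular_ell_values (q : R) : 1 <= q -> regular_values (ell_values R s q).
Proof.
move=> q1; have q0 : 0 < q by rewrite (lt_le_trans _ q1).
have normE (v : int -> scalar_field R s) :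
  ell_norm q v = lp_norm q (fun j => (modulus (v j))%:E) by [].
split=> //=.
- by move=> c; exists c.
- by move=> u v uv; apply/funext.
- by move=> v; exact: poweR_ge0.
- move=> j v; rewrite normE.
  apply: (@lp_norm_ge_term _ _ q (fun j => (modulus (v j))%:E)) => //.
  by move=> i; rewrite lee_fin modulus_ge0.
- move=> v u th th0 h; rewrite normE.
  apply: (@le_trans _ _ (lp_norm q (fun j => \esum_(m in [set: nat])
      (th m * modulus (u m j))%:E))%E).
    by apply: le_lp_norm => // j; rewrite lee_fin modulus_ge0.
  apply: le_trans (minkowski_esum q1 _) _ => [m j|].
    by rewrite lee_fin mulr_ge0// modulus_ge0.
  apply: le_esum => m _; rewrite normE -lp_normZ//.
  by move=> j; rewrite lee_fin modulus_ge0.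
- move=> d X b mb; rewrite /ell_norm.
  apply: (measurableT_comp (measurable_poweR _)).
  apply: (measurable_esum (e := @pickle int)
    (f := fun j x => (modulus (b x j) `^ q)%:E)).
  + exact: pcan_inj pickleK.
  + by move=> j x; rewrite lee_fin powR_ge0.
  + move=> j; apply/measurable_EFinP.
    apply: (@measurableT_comp _ _ _ _ _ _ (@powR R ^~ q)) => //.
    by have [mR mI] := mb j; exact: measurable_modulus.
Qed.

End regular_instances.

Section regular_facts.
Context {R : realType} {s : scalar_kind} {V : value_space R s}.
Hypothesis gV : regular_values V.

Lemma value_coord0 (j : value_index V) : coord j 0 = 0.
Proof.
have := coord_lin gV j (-1) 0 0.
by rewrite scaler0 addr0 mulN1r addNr.
Qed.

(** Homogeneity of the norm is not among the properties in [regular_values]; zero coefficients in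
    [value_norm_sum] replace it. *)
Lemma value_norm0 : value_norm (0 : value V) = 0%E.
Proof.
apply/eqP; rewrite eq_le value_norm_ge0// andbT.
have := @value_norm_sum _ _ _ gV 0 (fun=> 0) (fun=> 0) (fun=> lexx _).
rewrite esum1 => [h|i _]; last by rewrite mul0e.
rewrite h// => j; rewrite value_coord0 modulus0.
by apply: esum_ge0 => m _; rewrite mul0r.
Qed.

Lemma value_coordD (j : value_index V) u v : coord j (u + v) = coord j u + coord j v.
Proof. by have := coord_lin gV j 1 u v; rewrite scale1r mul1r. Qed.

Lemma value_coordZ (j : value_index V) a u : coord j (a *: u) = a * coord j u.
Proof. by have := coord_lin gV j a u 0; rewrite addr0 value_coord0 addr0. Qed.

Lemma value_coord_sum (j : value_index V) (u : nat -> value V) M :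
  coord j (\sum_(m < M) u m) = \sum_(m < M) coord j (u m).
Proof.
elim: M => [|M IH]; first by rewrite !big_ord0 value_coord0.
by rewrite !big_ord_recr/= value_coordD IH.
Qed.

Context {d : measure_display} {X : measurableType d}.

Lemma value_measurable0 : value_measurable (fun _ : X => 0 : value V).
Proof.
move=> j; under eq_fun do rewrite value_coord0.
under [in X in _ /\ X]eq_fun do rewrite value_coord0.
by split; exact: measurable_cst.
Qed.

Lemma measurable_scalar_mul (a : scalar_field R s) (c : X -> scalar_field R s) :
  measurable_fun setT (fun x => sRe (c x)) /\ measurable_fun setT (fun x => sIm (c x)) ->
  measurable_fun setT (fun x => sRe (a * c x)) /\
  measurable_fun setT (fun x => sIm (a * c x)).
Proof.
move=> [mR mI]; split.
  under eq_fun do rewrite sReM.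
  by apply: measurable_funB; apply: measurable_funM.
under eq_fun do rewrite sImM.
by apply: measurable_funD; apply: measurable_funM.
Qed.

Lemma value_measurable_lin a (f g : X -> value V) : value_measurable f ->
  value_measurable g -> value_measurable (fun x => a *: f x + g x).
Proof.
move=> mf mg j.
have [fR fI] := measurable_scalar_mul a (mf j); have [gR gI] := mg j; split.
  under eq_fun do rewrite (coord_lin gV) sReD; exact: measurable_funD.
under eq_fun do rewrite (coord_lin gV) sImD; exact: measurable_funD.
Qed.

End regular_facts.

(** * Superposition of blocks and the norm of the block space *)

Section block_superposition.
Context {R : realType} {s : scalar_kind} {d : measure_display}.
Context {X : measurableType d}.
Variable mu : {measure set X -> \bar R}.
Variables (I : int -> choiceType) (Q : forall k : int, I k -> set X).
Variables (V : value_space R s) (w : X -> R) (p t : R) (r : \bar R).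
Local Notation T := {k : int & I k}.
Local Notation K := (scalar_field R s).
Hypothesis gV : regular_values V.
Hypothesis p1 : 1 < conjugate p%:E.
Hypothesis r1 : 1 <= @conjugate R r.
Hypothesis mw : measurable_fun setT w.
Hypothesis mQ : forall k (tau : I k), measurable (Q tau).
Variable e : T -> nat.
Hypothesis ie : injective e.
Variables (D : nat -> set X) (C : nat -> R).
Hypothesis mD : forall n, measurable (D n).
Hypothesis C0 : forall n, 0 <= C n.
Hypothesis coverD : {ae mu, forall x, exists n, D n x}.
Local Notation block := (@Defs.block R s d X mu V w p t).
Local Notation decomp := (@block_decomposition R s d X mu I Q V w p t).
Hypothesis local_L1 : forall n (lam : T -> K) (b : T -> X -> value V),
  (forall i, block (Q (tagged i)) (b i)) ->
  (\int[mu]_(x in D n)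
     (\esum_(i in [set: T]) ((modulus (lam i))%:E * value_norm (b i x))) <=
   (C n)%:E * ell_norm (conjugate r) lam)%E.

Let r0 : 0 < @conjugate R r. Proof. exact: lt_le_trans r1. Qed.
Let p0 : 0 < @conjugate R p%:E. Proof. exact: lt_trans p1. Qed.

Lemma measurable_dual_weight : measurable_fun setT (dual_weight p w).
Proof. exact: (@measurableT_comp _ _ _ _ _ _ (@powR R ^~ _)). Qed.

Lemma ell_norm_lp (T' : choiceType) (q : R) (v : T' -> K) :
  ell_norm q v = lp_norm q (fun i => (modulus (v i))%:E).
Proof. by []. Qed.

Lemma ell_norm_ge0 (T' : choiceType) (q : R) (v : T' -> K) : (0 <= ell_norm q v)%E.
Proof. exact: poweR_ge0. Qed.

Lemma ell_normZ (T' : choiceType) (q : R) (a : K) (v : T' -> K) : 0 < q ->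
  ell_norm q (fun i => a * v i) = ((modulus a)%:E * ell_norm q v)%E.
Proof.
move=> q0; rewrite !ell_norm_lp -lp_normZ ?modulus_ge0//.
  by congr lp_norm; apply/funext => i; rewrite modulusM EFinM.
by move=> i; rewrite lee_fin modulus_ge0.
Qed.

Lemma measurable_block_norm E b : block E b ->
  measurable_fun setT (fun x => value_norm (b x)).
Proof. by move=> [mb _ _]; exact: measurable_value_norm. Qed.

Lemma block0 E : block E (fun=> 0).
Proof.
split=> //.
rewrite integral0_eq ?poweR0r ?invr_eq0 ?gt_eqF ?poweR_ge0// => x _.
by rewrite (value_norm0 gV) poweR0r ?mul0e// gt_eqF.
Qed.

(* Jensen's inequality makes the set of blocks countably convex. *)
Lemma block_convex E (th : nat -> R) (b : nat -> X -> value V) (B : X -> value V) :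
  measurable E -> (forall m, 0 <= th m) ->
  (\esum_(m in [set: nat]) (th m)%:E <= 1)%E ->
  (forall m, block E (b m)) -> value_measurable B -> (forall x, ~ E x -> B x = 0) ->
  (forall x, (value_norm (B x) <=
     \esum_(m in [set: nat]) ((th m)%:E * value_norm (b m x)))%E) ->
  block E B.
Proof.
move=> mE th0 th1 bb mB B0 Bb; split=> //.
set c := (X in (_ <= X)%E); have c0 : (0 <= c)%E by exact: poweR_ge0.
set q := conjugate p%:E.
pose J (f : X -> value V) :=
  (\int[mu]_(x in E) (value_norm (f x) `^ q * (dual_weight p w x)%:E))%E.
have J0 f : (0 <= J f)%E.
  by apply: integral_ge0 => x _; rewrite mule_ge0 ?poweR_ge0 ?lee_fin ?powR_ge0.
have JP f : (J f `^ q^-1 <= c)%E <-> (J f <= c `^ q)%E.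
  split=> h.
    have := le_poweR (ltW p0) (poweR_ge0 _ _) h.
    by rewrite -poweRrM mulVf ?gt_eqF// poweRe1.
  have qi0 : 0 <= q^-1 by rewrite invr_ge0 ltW.
  by have := le_poweR qi0 (J0 f) h; rewrite -poweRrM mulfV ?gt_eqF// poweRe1.
have mJ (f : X -> value V) : value_measurable f -> measurable_fun E
    (fun x => value_norm (f x) `^ q * (dual_weight p w x)%:E)%E.
  move=> mf; apply: measurable_funTS; apply: emeasurable_funM.
    apply: (measurableT_comp (measurable_poweR _)).
    exact: (measurable_value_norm gV mf).
  by apply/measurable_EFinP; exact: measurable_dual_weight.
apply/JP; apply: (@le_trans _ _ (\int[mu]_(x in E)
    (\esum_(m in [set: nat]) ((th m)%:E *
       (value_norm (b m x) `^ q * (dual_weight p w x)%:E))))%E).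
  apply: (ge0_le_integral mu mE).
  - by move=> x _; rewrite mule_ge0 ?poweR_ge0 ?lee_fin ?powR_ge0.
  - exact: mJ mB.
  - apply: (measurable_esum (e := id)
      (f := fun m x => ((th m)%:E * (value_norm (b m x) `^ q *
         (dual_weight p w x)%:E))%E)) => //.
      by move=> m x; rewrite !mule_ge0 ?poweR_ge0 ?lee_fin ?powR_ge0.
    move=> m; apply: measurable_funeM; apply: mJ; by have [] := bb m.
  - move=> x _; under eq_esum do rewrite muleA muleC.
    rewrite esumZl ?powR_ge0//; last first.
      by move=> m; rewrite mule_ge0 ?poweR_ge0 ?lee_fin.
    rewrite muleC lee_wpmul2l ?lee_fin ?powR_ge0//.
    apply: le_trans (jensen_esum (ltW p1) th0 _ th1).
      apply: le_poweR (Bb x); first exact: ltW.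
      exact: value_norm_ge0.
    by move=> m; exact: value_norm_ge0.
rewrite (integral_esum (e := id)
      (f := fun m x => ((th m)%:E * (value_norm (b m x) `^ q *
         (dual_weight p w x)%:E))%E)) //; last first.
- move=> m; apply: measurable_funeM; apply: mJ; by have [] := bb m.
- by move=> m x; rewrite !mule_ge0 ?poweR_ge0 ?lee_fin ?powR_ge0.
apply: (@le_trans _ _ (\esum_(m in [set: nat]) ((th m)%:E * c `^ q)))%E.
  apply: le_esum => m _; rewrite ge0_integralZl//.
  - by rewrite lee_wpmul2l ?lee_fin//; apply/JP; have [] := bb m.
  - by apply: mJ; have [] := bb m.
  - by move=> x _; rewrite mule_ge0 ?poweR_ge0 ?lee_fin ?powR_ge0.
  - by rewrite lee_fin.
have [->|cy] := eqVneq (c `^ q)%E +oo%E; first by rewrite leey.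
have cf : (c `^ q)%E \is a fin_num by rewrite ge0_fin_numE ?poweR_ge0// ltey.
rewrite -(fineK cf); under eq_esum do rewrite muleC.
rewrite esumZl ?fine_ge0 ?poweR_ge0// -[leRHS]mule1.
by rewrite lee_wpmul2l// lee_fin fine_ge0 ?poweR_ge0.
Qed.

Lemma measurable_superposed (lam : T -> K) (b : T -> X -> value V) :
  (forall i, block (Q (tagged i)) (b i)) ->
  measurable_fun setT (fun x =>
    \esum_(i in [set: T]) ((modulus (lam i))%:E * value_norm (b i x)))%E.
Proof.
move=> bb; apply: (measurable_esum (e := e)
  (f := fun i x => ((modulus (lam i))%:E * value_norm (b i x))%E) ie).
  by move=> i x; rewrite mule_ge0 ?lee_fin ?modulus_ge0 ?value_norm_ge0.
move=> i; apply: measurable_funeM; exact: measurable_block_norm (bb i).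
Qed.

(** Summing [local_L1] over [m] gives a finite integral on each [D n], hence finiteness almost
    everywhere there; countably many [D n] cover almost every point. *)
Lemma ae_superposed_finite (lam : nat -> T -> K) (b : nat -> T -> X -> value V) :
  (forall m i, block (Q (tagged i)) (b m i)) ->
  (\esum_(m in [set: nat]) ell_norm (conjugate r) (lam m) < +oo)%E ->
  {ae mu, forall x, (\esum_(m in [set: nat]) \esum_(i in [set: T])
      ((modulus (lam m i))%:E * value_norm (b m i x)) < +oo)%E}.
Proof.
move=> bb lfin.
pose F x := (\esum_(m in [set: nat]) \esum_(i in [set: T])
  ((modulus (lam m i))%:E * value_norm (b m i x)))%E.
have G0 m x : (0 <= \esum_(i in [set: T])
    ((modulus (lam m i))%:E * value_norm (b m i x)))%E.
  apply: esum_ge0 => i _.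
  by rewrite mule_ge0 ?lee_fin ?modulus_ge0 ?value_norm_ge0.
have mF : measurable_fun setT F.
  apply: (measurable_esum (e := id)
    (f := fun m x => (\esum_(i in [set: T])
      ((modulus (lam m i))%:E * value_norm (b m i x)))%E)) => // m.
  exact: measurable_superposed (bb m).
have F0 x : (0 <= F x)%E by apply: esum_ge0.
have aeD n : {ae mu, forall x, D n x -> (F x < +oo)%E}.
  have : mu.-integrable (D n) F.
    apply/integrableP; split; first exact: measurable_funTS.
    under eq_integral do rewrite gee0_abs//.
    rewrite (integral_esum (e := id) (f := fun m x => (\esum_(i in [set: T])
      ((modulus (lam m i))%:E * value_norm (b m i x)))%E)) //; last first.
      by move=> m; apply: measurable_funTS; exact: measurable_superposed (bb m).
    apply: (@le_lt_trans _ _ ((C n)%:E *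
        \esum_(m in [set: nat]) ell_norm (conjugate r) (lam m))%E).
      rewrite -esumZl//; last by move=> m; exact: ell_norm_ge0.
      by apply: le_esum => m _; exact: local_L1.
    by apply: lte_mul_pinfty; rewrite ?lee_fin.
  move=> /(integrable_ae (mD n)); apply: filterS => x h Dx.
  by rewrite -ge0_fin_numE// h.
have := ae_foralln aeD; apply: filterS2 coverD => x [n Dx] /(_ n); exact.
Qed.

(** On the cube [i] the new coefficient [L i] is the sum over m of |lam m i|, finite since each term
    is at most the norm of [lam m], and the new block is the sum of (lam m i / L i) b m i. Almost
    everywhere the double series converges absolutely, so it may be summed over the cubes last. *)
Lemma block_superposition (f_ : nat -> X -> value V) (lam : nat -> T -> K)
    (f : X -> value V) :
  (forall m, decomp (f_ m) (lam m)) ->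
  (\esum_(m in [set: nat]) ell_norm (conjugate r) (lam m) < +oo)%E ->
  {ae mu, forall x, forall j : value_index V,
     sums_to (fun m => coord j (f_ m x)) (coord j (f x))} ->
  exists2 L : T -> K, decomp f L &
    (ell_norm (conjugate r) L <=
     \esum_(m in [set: nat]) ell_norm (conjugate r) (lam m))%E.
Proof.
move=> hf lfin fE.
have hb m : {b : T -> X -> value V | (forall i, block (Q (tagged i)) (b i)) /\
    {ae mu, forall x, forall j : value_index V,
      sums_to (fun i => lam m i * coord j (b i x)) (coord j (f_ m x))}}.
  by apply: cid; have [b ? ?] := hf m; exists b.
pose b m := sval (hb m).
have bb m i : block (Q (tagged i)) (b m i) by rewrite /b; case: (hb m) => ? [].
have bE m : {ae mu, forall x, forall j : value_index V,
      sums_to (fun i => lam m i * coord j (b m i x)) (coord j (f_ m x))}.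
  by rewrite /b; case: (hb m) => ? [].
have lamS m i : ((modulus (lam m i))%:E <= ell_norm (conjugate r) (lam m))%E.
  apply: (@lp_norm_ge_term _ _ _ (fun i => (modulus (lam m i))%:E)) => // j.
  by rewrite lee_fin modulus_ge0.
have Lfin i : (\esum_(m in [set: nat]) (modulus (lam m i))%:E)%E \is a fin_num.
  rewrite ge0_fin_numE; last by apply: esum_ge0 => m _; rewrite lee_fin modulus_ge0.
  by apply: le_lt_trans lfin; apply: le_esum => m _.
pose L i := fine (\esum_(m in [set: nat]) (modulus (lam m i))%:E)%E.
have LE i : (\esum_(m in [set: nat]) (modulus (lam m i))%:E)%E = (L i)%:E.
  by rewrite fineK.
have L0 i : 0 <= L i.
  by rewrite fine_ge0//; apply: esum_ge0 => m _; rewrite lee_fin modulus_ge0.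
have lamL m i : modulus (lam m i) <= L i.
  rewrite -lee_fin -LE.
  apply: (@esum_ge_term _ _ (fun m => (modulus (lam m i))%:E)) => j.
  by rewrite lee_fin modulus_ge0.
have Lz m i : L i = 0 -> lam m i = 0.
  move=> Li; apply: modulus0_eq0; apply/eqP; rewrite eq_le modulus_ge0 andbT.
  by rewrite -Li.
pose c i m : K := scalar_emb (L i)^-1 * lam m i.
have cE i m : modulus (c i m) = (L i)^-1 * modulus (lam m i).
  by rewrite modulusM modulus_emb ger0_norm// invr_ge0.
have [mk mkE] : {mk : (value_index V -> K) -> value V |
    forall g j, coord j (mk g) = g j}.
  apply: cid; exists (fun g => sval (cid (coord_surj gV g))) => g.
  by case: cid.
(* Where a coordinate series diverges, its total sum is a default value; the bound
   [modulus_scalar_sum] is trivial there, so the convexity of blocks can still be applied at every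
   point. *)
pose B i x := mk (fun j => scalar_sum (fun m => c i m * coord j (b m i x))).
have th0 i m : 0 <= modulus (c i m) by exact: modulus_ge0.
have th1 i : (\esum_(m in [set: nat]) (modulus (c i m))%:E <= 1)%E.
  under eq_esum do rewrite cE EFinM.
  rewrite esumZl ?invr_ge0//; last by move=> m; rewrite lee_fin modulus_ge0.
  rewrite LE -EFinM lee_fin; have [->|Li] := eqVneq (L i) 0.
    by rewrite mulr0.
  by rewrite mulVf.
have mB i : value_measurable (B i).
  move=> j; have mc m : measurable_fun setT (fun x => sRe (coord j (b m i x))) /\
      measurable_fun setT (fun x => sIm (coord j (b m i x))).
    by have [mb _ _] := bb m i; exact: mb.
  have [mR mI] := @measurable_scalar_sum R s d X nat id
    (fun x m => c i m * coord j (b m i x)) (@inj_id _)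
    (fun m => measurable_scalar_mul (c i m) (mc m)).
  split; [apply: eq_measurable_fun mR|apply: eq_measurable_fun mI];
    by move=> x _; rewrite mkE.
have BB i : block (Q (tagged i)) (B i).
  apply: (@block_convex _ (fun m => modulus (c i m)) (fun m => b m i)) => //.
  - move=> x nQ; apply: (coord_inj gV) => j; rewrite mkE (value_coord0 gV).
    have z : (fun m => c i m * coord j (b m i x)) = fun=> 0.
      apply/funext => m; have [_ -> //] := bb m i.
      by rewrite (value_coord0 gV) mulr0.
    rewrite z; apply: (@sums_to_unique _ _ nat (fun=> 0)); last exact: sums_to_0.
    by apply: scalar_sumP; rewrite esum1 ?ltry// => m _; rewrite modulus0.
  - move=> x; apply: (value_norm_sum gV) => // j; rewrite mkE.
    apply: le_trans (modulus_scalar_sum _) _.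
    by apply: le_esum => m _; rewrite modulusM.
exists (fun i => scalar_emb (L i)).
  exists B => //.
  have Afin := ae_superposed_finite bb lfin.
  have := ae_foralln bE; apply: filterS3 Afin fE => x xfin fx bx j.
  apply: (@sums_to_fubini _ _ nat T (fun m i => lam m i * coord j (b m i x))
    (fun m => coord j (f_ m x))) => //.
  - apply: le_lt_trans xfin; apply: le_esum => m _; apply: le_esum => i _.
    rewrite modulusM EFinM lee_wpmul2l ?lee_fin ?modulus_ge0//.
    exact: coord_le_norm.
  - move=> i; have [Li|Li] := eqVneq (L i) 0.
      rewrite Li scalar_emb0 mul0r.
      apply: (@eq_sums_to _ _ _ (fun=> 0)) => [m|]; last exact: sums_to_0.
      by rewrite (Lz m i Li) mul0r.
    rewrite mkE.
    have h : sums_to (fun m => c i m * coord j (b m i x))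
        (scalar_sum (fun m => c i m * coord j (b m i x))).
      apply: scalar_sumP.
      (* The series over [m] for a single cube is dominated by the whole double series divided by
         [L i]. *)
      apply: (@le_lt_trans _ _ ((L i)^-1%:E * \esum_(m in [set: nat])
          \esum_(i in [set: T]) ((modulus (lam m i))%:E * value_norm (b m i x)))%E).
        have t0 m i' : (0 <= (modulus (lam m i'))%:E * value_norm (b m i' x))%E.
          by rewrite mule_ge0 ?lee_fin ?modulus_ge0 ?value_norm_ge0.
        rewrite -esumZl ?invr_ge0//; last by move=> m; exact: esum_ge0.
        apply: le_esum => m _; rewrite modulusM cE -mulrA EFinM.
        rewrite lee_wpmul2l ?lee_fin ?invr_ge0//.
        apply: le_trans (esum_ge_term i (t0 m)).
        rewrite EFinM lee_wpmul2l ?lee_fin ?modulus_ge0//; exact: coord_le_norm.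
      by apply: lte_mul_pinfty; rewrite ?lee_fin ?invr_ge0.
    have := sums_toZ (scalar_emb (L i)) h; apply: eq_sums_to => m.
    rewrite mulrA /c mulrA -scalar_embM mulfV// scalar_emb1 mul1r//.
pose u (m : nat) (i : T) := (modulus (lam m i))%:E.
have u0 m i : (0 <= u m i)%E by rewrite lee_fin modulus_ge0.
have LN : ell_norm (conjugate r) (fun i => scalar_emb (L i) : K) =
    lp_norm (conjugate r) (fun i => \esum_(m in [set: nat]) u m i)%E.
  rewrite ell_norm_lp; congr lp_norm; apply/funext => i.
  by rewrite modulus_emb ger0_norm// /u LE.
rewrite LN.
exact: minkowski_esum r1 u0.
Qed.

Local Notation H := (@block_space R s d X mu I Q V w p t r).
Local Notation N := (@block_norm R s d X mu I Q V w p t r).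
Local Notation ell := (@ell_norm R s T (conjugate r)).

Lemma ell_norm0 : ell (fun=> 0) = 0%E.
Proof.
have := @ell_normZ T (conjugate r) 0 (fun=> 0) r0.
by rewrite mul0r modulus0 mul0e.
Qed.

Lemma decomp0 : decomp (fun=> 0) (fun=> 0).
Proof.
exists (fun _ _ => 0); first by move=> i; exact: block0.
apply: aeW => x j; rewrite (value_coord0 gV).
apply: (@eq_sums_to _ _ _ (fun=> 0)); last exact: sums_to_0.
by move=> i; rewrite mul0r.
Qed.

Lemma decompZ a f lam : decomp f lam ->
  decomp (fun x => a *: f x) (fun i => a * lam i).
Proof.
move=> [b bb bE]; exists b => //; apply: filterS bE => x fx j.
rewrite (value_coordZ gV); have := sums_toZ a (fx j); apply: eq_sums_to => i.
by rewrite mulrA.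
Qed.

Lemma decomp_ae f g lam : {ae mu, forall x, f x = g x} -> decomp f lam ->
  decomp g lam.
Proof.
move=> fg [b bb bE]; exists b => //; apply: filterS2 fg bE => x fgx fx j.
by rewrite -fgx.
Qed.

Lemma block_norm_ge0 f : (0 <= N f)%E.
Proof. by apply: le_ereal_inf_tmp => _ [lam _ <-]; exact: ell_norm_ge0. Qed.

Lemma block_norm_le f lam : decomp f lam -> (N f <= ell lam)%E.
Proof. by move=> fl; apply: ereal_inf_lbound; exists lam. Qed.

Lemma block_norm_fin f : H f -> N f \is a fin_num.
Proof.
move=> [_ [lam fl lfin]]; rewrite ge0_fin_numE ?block_norm_ge0//.
exact: le_lt_trans (block_norm_le fl) lfin.
Qed.

Lemma block_norm_approx f eps : H f -> 0 < eps ->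
  exists2 lam, decomp f lam & (ell lam < N f + eps%:E)%E.
Proof.
move=> Hf eps0; have := lb_ereal_inf_adherent eps0 (block_norm_fin Hf).
by move=> [_ [lam fl <-] h]; exists lam.
Qed.

Lemma block_space0 : H (fun=> 0).
Proof.
split; first exact: value_measurable0.
by exists (fun=> 0); [exact: decomp0|rewrite ell_norm0 ltry].
Qed.

Lemma block_spaceZ a f : H f -> H (fun x => a *: f x).
Proof.
move=> [mf [lam fl lfin]]; split.
  have := value_measurable_lin gV a mf (value_measurable0 gV).
  by under eq_fun do rewrite addr0.
exists (fun i => a * lam i); first exact: decompZ.
by rewrite ell_normZ// lte_mul_pinfty ?lee_fin ?modulus_ge0.
Qed.

Lemma block_normZ_le a f : H f -> (N (fun x => a *: f x) <= (modulus a)%:E * N f)%E.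
Proof.
move=> Hf; apply/lee_addgt0Pr => eps eps0.
(* Adding 1 avoids a division by zero when [a = 0]. *)
have m1 : 0 < modulus a + 1 by rewrite ltr_wpDl// modulus_ge0.
have [lam fl le] := block_norm_approx Hf (divr_gt0 eps0 m1).
apply: le_trans (block_norm_le (decompZ a fl)) _; rewrite ell_normZ//.
apply: (@le_trans _ _ ((modulus a)%:E * (N f + (eps / (modulus a + 1))%:E))%E).
  by rewrite lee_wpmul2l ?lee_fin ?modulus_ge0// ltW.
rewrite ge0_muleDr ?block_norm_ge0//; last by rewrite lee_fin divr_ge0// ltW.
rewrite leeD2l// -EFinM lee_fin mulrCA ler_piMr//; first exact: ltW.
by rewrite ler_pdivrMr// mul1r lerDl.
Qed.

Lemma block_normZ a f : H f -> N (fun x => a *: f x) = ((modulus a)%:E * N f)%E.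
Proof.
move=> Hf; apply/eqP; rewrite eq_le block_normZ_le//=.
have [->|a0] := eqVneq a 0; first by rewrite modulus0 mul0e block_norm_ge0.
have := block_normZ_le a^-1 (block_spaceZ a Hf).
under eq_fun do rewrite scalerA mulVf// scale1r.
rewrite modulusV lee_pdivlMl// lt_neqAle modulus_ge0 andbT eq_sym.
by apply: contra_neq a0; exact: modulus0_eq0.
Qed.

(** The superposition of the sequence f, g, 0, 0, ... *)
Lemma decompD f g lf lg : decomp f lf -> decomp g lg ->
  (ell lf < +oo)%E -> (ell lg < +oo)%E ->
  exists2 L, decomp (fun x => f x + g x) L & (ell L <= ell lf + ell lg)%E.
Proof.
move=> fl gl fy gy.
pose f_ (m : nat) := if m == 0%N then f else if m == 1%N then g else fun=> 0.
pose lam (m : nat) := if m == 0%N then lf else if m == 1%N then lg else fun=> 0.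
have hs : (\esum_(m in [set: nat]) ell (lam m) = ell lf + ell lg)%E.
  rewrite -(esum_delta 0%N (ell_norm_ge0 (conjugate r) lf)).
  rewrite -(esum_delta 1%N (ell_norm_ge0 (conjugate r) lg)) -esumD.
  - apply: eq_esum => m _; rewrite /lam; case: m => [|[|m]]/=.
    + by rewrite adde0.
    + by rewrite add0e.
    + by rewrite ell_norm0 adde0.
  - by move=> m _; case: ifP => // _; exact: ell_norm_ge0.
  - by move=> m _; case: ifP => // _; exact: ell_norm_ge0.
rewrite -hs; apply: (block_superposition (f_ := f_)).
- by move=> m; rewrite /f_ /lam; case: m => [|[|m]]//=; exact: decomp0.
- by rewrite hs; exact: lte_add_pinfty.
- apply: aeW => x j; rewrite (value_coordD gV).
  have := sums_toD (sums_to_delta 0%N (coord j (f x)))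
    (sums_to_delta 1%N (coord j (g x))).
  apply: eq_sums_to => m; rewrite /f_; case: m => [|[|m]]/=.
  + by rewrite addr0.
  + by rewrite add0r.
  + by rewrite (value_coord0 gV) addr0.
Qed.

Lemma block_spaceD f g : H f -> H g -> H (fun x => f x + g x).
Proof.
move=> [mf [lf fl fy]] [mg [lg gl gy]]; split.
  have := value_measurable_lin gV 1 mf mg.
  by under eq_fun do rewrite scale1r.
have [L fgL LE] := decompD fl gl fy gy; exists L => //.
by apply: le_lt_trans LE _; exact: lte_add_pinfty.
Qed.

Lemma block_normD f g : H f -> H g -> (N (fun x => f x + g x)%R <= N f + N g)%E.
Proof.
move=> Hf Hg; apply/lee_addgt0Pr => eps eps0.
have e2 : 0 < eps / 2 by rewrite divr_gt0.
have [lf fl lfe] := block_norm_approx Hf e2.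
have [lg gl lge] := block_norm_approx Hg e2.
have fin h : H h -> (N h + (eps / 2)%:E < +oo)%E.
  move=> Hh; apply: lte_add_pinfty; rewrite ?ltry//.
  by have := block_norm_fin Hh; rewrite ge0_fin_numE ?block_norm_ge0.
have [L fgL LE] := decompD fl gl (lt_trans lfe (fin _ Hf)) (lt_trans lge (fin _ Hg)).
apply: le_trans (block_norm_le fgL) _; apply: le_trans LE _.
apply: le_trans (leeD (ltW lfe) (ltW lge)) _.
by rewrite addeACA -EFinD -splitr.
Qed.

Lemma geometric_tail M :
  (\esum_(m in [set: nat]) (if (m < M)%N then 0 else (2^-1 ^+ m)%:E) <=
    (2 * 2^-1 ^+ M : R)%:E)%E.
Proof.
have t0 (m : nat) : (0 <= (if (m < M)%N then 0 else (2^-1 ^+ m : R)%:E))%E.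
  by case: ifP; rewrite // lee_fin exprn_ge0// invr_ge0.
rewrite -nneseries_esumT//; apply: lime_le; first exact: is_cvg_nneseries.
(* The bound for the terms not yet added is included in the claim, so that the induction on [n]
   closes. *)
apply: nearW => n; suff : (\sum_(0 <= m < n)
    (if (m < M)%N then 0 else (2^-1 ^+ m : R)%:E) +
    (2 * 2^-1 ^+ maxn n M)%:E <= (2 * 2^-1 ^+ M)%:E)%E.
  by apply: le_trans; rewrite leeDl// lee_fin mulr_ge0// exprn_ge0// invr_ge0.
elim: n => [|n IH]; first by rewrite big_nil add0e max0n.
rewrite big_nat_recr//=; apply: le_trans IH; rewrite -addeA leeD2l//.
have [nM|Mn] := ltnP n M.
  by rewrite add0e (maxn_idPr _) ?(maxn_idPr _)// ltnW.
rewrite (maxn_idPl _) ?(maxn_idPl _)//; last exact: leqW.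
rewrite -EFinD lee_fin exprS; lra.
Qed.

Lemma sums_to_tail (c : nat -> K) S M : sums_to c S ->
  sums_to (fun m => if (m < M)%N then 0 else c m) (S - \sum_(m < M) c m).
Proof.
move=> cS; elim: M => [|M IH]; first by rewrite big_ord0 subr0.
have := sums_toD IH (sums_toZ (-1) (sums_to_delta M (c M))).
rewrite big_ord_recr/= opprD addrA mulN1r; apply: eq_sums_to => m.
rewrite [in RHS]ltnS [in RHS]leq_eqVlt; have [->|mM] := eqVneq m M.
  by rewrite ltnn mulN1r subrr.
by rewrite mulr0 addr0.
Qed.

(** The same [f] has, for every m, a decomposition with coefficient norm below 2^-m. All of them
    together form a double series that is finite almost everywhere, yet it dominates the constant
    series with terms |f(x)_j|, which diverges unless the coordinate vanishes. *)
Lemma block_norm_eq0 f : H f -> N f = 0%E -> {ae mu, forall x, f x = 0}.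
Proof.
move=> Hf f0.
have e0 m : 0 < 2^-1 ^+ m :> R by rewrite exprn_gt0// invr_gt0.
have hl m : {lam | decomp f lam & (ell lam < (2^-1 ^+ m)%:E)%E}.
  apply: cid2; have [lam fl] := block_norm_approx Hf (e0 m).
  by rewrite f0 add0e => h; exists lam.
pose lam m := s2val (hl m).
have hb m : {b : T -> X -> value V | (forall i, block (Q (tagged i)) (b i)) &
    {ae mu, forall x, forall j : value_index V,
      sums_to (fun i => lam m i * coord j (b i x)) (coord j (f x))}}.
  by apply: cid2; exact: (s2valP (hl m)).
pose b m := s2val (hb m).
have lfin : (\esum_(m in [set: nat]) ell (lam m) < +oo)%E.
  apply: (@le_lt_trans _ _ (2 * 2^-1 ^+ 0 : R)%:E); last by rewrite ltry.
  apply: le_trans (geometric_tail 0); apply: le_esum => m _ /=.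
  exact: ltW (s2valP' (hl m)).
have := ae_superposed_finite (fun m => s2valP (hb m)) lfin.
have := ae_foralln (fun m => s2valP' (hb m)).
apply: filterS2 => x fx xfin; apply: (coord_inj gV) => j.
rewrite (value_coord0 gV); apply: modulus0_eq0; apply/eqP.
rewrite eq_le modulus_ge0 andbT leNgt; apply/negP => c0.
move: xfin; apply/negP; rewrite -leNgt.
apply: (@le_trans _ _ (\esum_(m in [set: nat]) (modulus (coord j (f x)))%:E)%E).
  rewrite leye_eq; apply/eqP/eq_infty => y.
  have [k yk] : exists k : nat, y <= k%:R * modulus (coord j (f x)).
    exists (Num.truncn `|y / modulus (coord j (f x))|).+1.
    rewrite -ler_pdivrMr//; apply: le_trans (ler_norm _) (ltW _).
    exact: truncnS_gt.
  rewrite -nneseries_esumT; last by move=> m; rewrite lee_fin ltW.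
  apply: le_trans (nneseries_lim_ge k _); last by move=> m _ _; rewrite lee_fin ltW.
  by rewrite big_mkord sumEFin lee_fin sumr_const card_ord -mulr_natl.
apply: le_esum => m _; apply: le_trans (sums_to_modulus (fx m j)) _.
apply: le_esum => i _; rewrite modulusM EFinM.
by rewrite lee_wpmul2l ?lee_fin ?modulus_ge0//; exact: coord_le_norm.
Qed.

Lemma block_norm_ae0 f : {ae mu, forall x, f x = 0} -> N f = 0%E.
Proof.
move=> f0; apply/eqP; rewrite eq_le block_norm_ge0 andbT -ell_norm0.
apply: block_norm_le; apply: decomp_ae decomp0.
by apply: filterS f0 => x ->.
Qed.

(** The limit is the pointwise sum of the series. For the tail from M on, the superposition is
    applied to the sequence whose first M terms are replaced by 0. *)
Lemma block_space_series (u : nat -> X -> value V) : (forall m, H (u m)) ->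
  (forall m, N (u m) <= (2^-1 ^+ m)%:E)%E ->
  exists2 f, H f & forall M,
    (N (fun x => f x - \sum_(m < M) u m x)%R <= (4 * 2^-1 ^+ M)%:E)%E.
Proof.
move=> Hu Nu.
have e0 m : 0 < 2^-1 ^+ m :> R by rewrite exprn_gt0// invr_gt0.
have hl m : {lam | decomp (u m) lam & (ell lam <= (2 * 2^-1 ^+ m)%:E)%E}.
  apply: cid2; have [lam fl le] := block_norm_approx (Hu m) (e0 m).
  exists lam => //; apply: le_trans (ltW le) _.
  by rewrite mulr_natl mulr2n EFinD leeD2r.
pose lam m := s2val (hl m).
have hb m : {b : T -> X -> value V | (forall i, block (Q (tagged i)) (b i)) &
    {ae mu, forall x, forall j : value_index V,
      sums_to (fun i => lam m i * coord j (b i x)) (coord j (u m x))}}.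
  by apply: cid2; exact: (s2valP (hl m)).
pose b m := s2val (hb m).
pose lamM M m : T -> K := if (m < M)%N then fun=> 0 else lam m.
(* Each [u m] is decomposed with coefficient norm at most 2 times 2^-m, and the geometric tail
   contributes another factor 2: this is the 4 in [sn_series]. *)
have lamME M : (\esum_(m in [set: nat]) ell (lamM M m) <= (4 * 2^-1 ^+ M)%:E)%E.
  have -> : 4 * 2^-1 ^+ M = 2 * (2 * 2^-1 ^+ M) :> R by rewrite mulrA -natrM.
  rewrite EFinM.
  apply: le_trans (lee_wpmul2l _ (geometric_tail M)); last by rewrite lee_fin.
  rewrite -esumZl//; last first.
    by move=> m; case: ifP => // _; rewrite lee_fin ltW.
  apply: le_esum => m _; rewrite /lamM; case: ifP => _.
    by rewrite ell_norm0 mule0.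
  by rewrite -EFinM; exact: (s2valP' (hl m)).
have lfin : (\esum_(m in [set: nat]) ell (lam m) < +oo)%E.
  apply: le_lt_trans (lamME 0) _; exact: ltry.
have [mk mkE] : {mk : (value_index V -> K) -> value V |
    forall g j, coord j (mk g) = g j}.
  apply: cid; exists (fun g => sval (cid (coord_surj gV g))) => g.
  by case: cid.
pose f x := mk (fun j => scalar_sum (fun m => coord j (u m x))).
have mf : value_measurable f.
  move=> j; have mu_ m := (Hu m).1 j.
  have [mR mI] := @measurable_scalar_sum R s d X nat id
    (fun x m => coord j (u m x)) (@inj_id _) mu_.
  split; [apply: eq_measurable_fun mR|apply: eq_measurable_fun mI];
    by move=> x _; rewrite mkE.
have fE : {ae mu, forall x, forall j : value_index V,
    sums_to (fun m => coord j (u m x)) (coord j (f x))}.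
  have := ae_superposed_finite (fun m => s2valP (hb m)) lfin.
  have := ae_foralln (fun m => s2valP' (hb m)).
  apply: filterS2 => x ux xfin j; rewrite mkE; apply: scalar_sumP.
  apply: le_lt_trans xfin; apply: le_esum => m _.
  apply: le_trans (sums_to_modulus (ux m j)) _.
  apply: le_esum => i _; rewrite modulusM EFinM.
  by rewrite lee_wpmul2l ?lee_fin ?modulus_ge0//; exact: coord_le_norm.
have tailE M : exists2 L, decomp (fun x => f x - \sum_(m < M) u m x) L &
    (ell L <= (4 * 2^-1 ^+ M)%:E)%E.
  pose uM m : X -> value V := if (m < M)%N then fun=> 0 else u m.
  have [|||L fL Ll] := @block_superposition uM (lamM M)
      (fun x => f x - \sum_(m < M) u m x).
  - move=> m; rewrite /uM /lamM; case: ifP => _; first exact: decomp0.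
    exact: (s2valP (hl m)).
  - by apply: le_lt_trans (lamME M) _; exact: ltry.
  - apply: filterS fE => x fx j.
    have -> : coord j (f x - \sum_(m < M) u m x) =
        coord j (f x) - \sum_(m < M) coord j (u m x).
      rewrite (value_coordD gV) -scaleN1r (value_coordZ gV) mulN1r.
      by rewrite (value_coord_sum gV j (fun m => u m x)).
    have := sums_to_tail M (fx j); apply: eq_sums_to => m.
    by rewrite /uM; case: ifP => // _; rewrite (value_coord0 gV).
  - by exists L => //; exact: le_trans (lamME M).
exists f.
  split => //; have [L fL Ll] := tailE 0%N; exists L.
    by move: fL; under eq_fun do rewrite big_ord0 subr0.
  exact: le_lt_trans Ll (ltry _).
by move=> M; have [L fL Ll] := tailE M; exact: le_trans (block_norm_le fL) Ll.
Qed.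

Lemma block_space_banach : banach_space_mod_ae mu H N.
Proof.
pose E : lmodType K := X -> value V.
(* Norms are finite on [H], so [fine] loses nothing there; the embedding puts the value in the
   scalar field. *)
pose nrm (f : E) : K := scalar_emb (fine (N f)).
have nrmP (f : E) x : H f -> (N f <= x%:E)%E <-> nrm f <= scalar_emb x.
  by move=> Hf; rewrite /nrm ler_emb -lee_fin fineK// block_norm_fin.
have lin a (f g : E) : H f -> H g -> H (a *: f + g).
  by move=> Hf Hg; apply: (block_spaceD (f := fun x => a *: f x)) => //;
    exact: block_spaceZ.
have nD (f g : E) : H f -> H g -> nrm (f + g) <= nrm f + nrm g.
  move=> Hf Hg; rewrite /nrm -scalar_embD ler_emb -lee_fin EFinD.
  rewrite !fineK ?block_norm_fin//; first exact: block_normD.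
  exact: block_spaceD.
have nZ a (f : E) : H f -> nrm (a *: f) = `|a| * nrm f.
  move=> Hf; rewrite /nrm [N _](block_normZ a Hf) norm_modulus -scalar_embM.
  by rewrite fineM// block_norm_fin.
(* A positive scalar, even a complex one, is a positive real, and the reals are Archimedean. *)
have arch (eps : K) : 0 < eps -> exists M, 5 * 2^-1 ^+ M < eps.
  move=> /scalar_gt0[x x0 ->].
  have [M hM] : exists M, 5 * 2^-1 ^+ M < x.
    have [M] : exists M : nat, 5 / x < M%:R.
      by exists (Num.truncn (5 / x)).+1; exact: truncnS_gt.
    rewrite ltr_pdivrMr// => h; exists M.
    rewrite exprVn ltr_pdivrMr ?exprn_gt0// (lt_le_trans h)// mulrC.
    by rewrite ler_pM2l// -natrX ler_nat ltnW// ltn_expl.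
  exists M; rewrite -(scalar_embn 5) -(scalar_embn 2) -scalar_embV -scalar_embX.
  by rewrite -scalar_embM lt_neqAle ler_emb ltW// andbT (inj_eq scalar_emb_inj) lt_eqF.
have ser (u : nat -> E) : (forall m, H (u m)) ->
    (forall m, nrm (u m) <= 2^-1 ^+ m) ->
    exists2 f, H f & forall M, nrm (f - \sum_(m < M) u m) <= 4 * 2^-1 ^+ M.
  move=> Hu Nu; have [m|f Hf fM] := @block_space_series u Hu _.
    by apply/nrmP => //; rewrite scalar_embX scalar_embV (scalar_embn 2).
  exists f => // M.
  have Hs : H (\sum_(m < M) u m : E).
    elim: (M) => [|k IH]; first by rewrite big_ord0; exact: block_space0.
    by rewrite big_ord_recr/=; exact: block_spaceD.
  have Hd : H (f - \sum_(m < M) u m : E).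
    by rewrite -scaleN1r addrC; exact: lin.
  have sE : (f - \sum_(m < M) u m : E) = fun x => f x - \sum_(m < M) u m x.
    rewrite (_ : (\sum_(m < M) u m : E) = fun x => \sum_(m < M) u m x)//.
    exact: fct_sumE.
  have := fM M; rewrite -sE => /(nrmP _ _ Hd).
  by rewrite scalar_embM scalar_embX scalar_embV !scalar_embn.
pose S := Build_seminormed_subspace lin block_space0 nD nZ arch ser.
have [B [cls [c1 c2 c3 c4]]] := seminormed_subspace_complete S.
exists B, cls; split.
- by move=> a f g Hf Hg; split; [exact: (lin a f g)|exact: c1].
- move=> f g Hf Hg; have Hd : H (f - g : E).
    by rewrite -scaleN1r addrC; exact: (lin _ g f).
  apply: (iff_trans (c2 f g Hf Hg)); split.
    rewrite /= /nrm -scalar_emb0 => /scalar_emb_inj h.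
    have : {ae mu, forall x, (f - g : E) x = 0}.
      by apply: block_norm_eq0 => //; rewrite -(fineK (block_norm_fin Hd)) h.
    by apply: filterS => x /eqP; rewrite subr_eq0 => /eqP.
  move=> fg; rewrite /= /nrm block_norm_ae0 ?scalar_emb0//.
  by apply: filterS fg => x fgx; rewrite /= !fctE fgx subrr.
- exact: c3.
- by move=> f Hf; rewrite c4// /nrm /= sRe_emb fineK// block_norm_fin.
Qed.

End block_superposition.

(** * Dyadic cubes and weights *)

(** Every [A j] meets some [F N] in measure greater than some 1/(M+1). For fixed N and M only
    finitely many [A j] do so, because these intersections are disjoint inside a set of finite
    measure. *)
Lemma disjoint_positive_countable {R : realType} {d : measure_display}
    {X : measurableType d} (mu : {measure set X -> \bar R}) (J : choiceType)
    (A : J -> set X) (F : nat -> set X) :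
  (forall j, measurable (A j)) -> (forall j, (0 < mu (A j))%E) ->
  (forall i j x, A i x -> A j x -> i = j) ->
  (forall N, measurable (F N)) -> (forall N, (mu (F N) < +oo)%E) ->
  (forall x, exists N, F N x) -> countable [set: J].
Proof.
move=> mA A0 disj mF Ffin cover.
pose S N M := [set j | ((M.+1%:R^-1)%:E < mu (A j `&` F N))%E].
have mAF j N : measurable (A j `&` F N) by exact: measurableI.
have hS : [set: J] `<=` \bigcup_N \bigcup_M S N M.
  move=> j _; have [N AN] : exists N, (0 < mu (A j `&` F N))%E.
    apply: contrapT => h; have := A0 j; rewrite lt_neqAle => /andP[/eqP + _]; apply.
    have -> : A j = \bigcup_N (A j `&` F N).
      by rewrite -setI_bigcupr setIidl// => x _; have [N] := cover x; exists N.
    apply/esym/negligibleP; first exact: bigcup_measurable.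
    apply: negligible_bigcup => N; apply/negligibleP => //.
    apply/eqP; rewrite eq_le measure_ge0 andbT leNgt; apply/negP => AN.
    by apply: h; exists N.
  exists N => //.
  have fin : mu (A j `&` F N) \is a fin_num.
    rewrite ge0_fin_numE//; apply: le_lt_trans (Ffin N).
    by apply: le_measure; rewrite ?inE//; exact: subIsetr.
  exists (Num.truncn (fine (mu (A j `&` F N)))^-1) => //=.
  rewrite /S/= -[X in (_ < X)%E](fineK fin) lte_fin invf_plt ?posrE//.
    exact: truncnS_gt.
  by rewrite fine_gt0// AN/= -ge0_fin_numE.
apply: (sub_countable (subset_card_le hS)).
apply: bigcup_countable => // N _; apply: bigcup_countable => // M _.
apply: finite_set_countable; apply: contrapT => inf.
have Ffn : mu (F N) \is a fin_num by rewrite ge0_fin_numE.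
(* Since k exceeds mu(F N) (M+1), k disjoint pieces of measure greater than 1/(M+1) do not fit into
   [F N]. *)
pose k := (Num.truncn (fine (mu (F N)) * M.+1%:R)).+1.
have [B + kB] := infinite_set_fset k inf.
set D := (X in X `<=` _) => BS; have finD : finite_set D by exact: finite_fset.
have : (mu (\bigcup_(j in D) (A j `&` F N)) <= mu (F N))%E.
  apply: le_measure; rewrite ?inE//.
    by apply: fin_bigcup_measurable.
  by move=> x [j _ []].
rewrite leNgt => /negP; apply.
rewrite measure_fin_bigcup//; last first.
  by move=> i j _ _ [x [[Ai _] [Aj _]]]; exact: disj Ai Aj.
apply: (@lt_le_trans _ _ (\sum_(j \in D) (M.+1%:R^-1 : R)%:E)%E); last first.
  by apply: lee_fsum => // j jB; apply: ltW; exact: BS.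
rewrite fsbig_finite//= /D set_fsetK sumEFin big_const_seq count_predT iter_addr addr0.
rewrite -(fineK Ffn) lte_fin -[_ *+ size _]mulr_natl ltr_pdivlMr//.
apply: lt_le_trans (truncnS_gt _) _.
by rewrite ler_nat.
Qed.

(** * Measurability, disjointness and countability of the cubes *)

Section dyadic.
Context {R : realType} {d : measure_display} {X : measurableType d}.
Variables (rho : X -> X -> R) (mu : {measure set X -> \bar R}) (n : R).
Variables (I : int -> choiceType) (Q : forall k : int, I k -> set X).
Variables (kappa0 : R).
Hypotheses (ht : homogeneous_type rho mu n) (dy : dyadic_system rho mu Q kappa0).
Local Notation T := {k : int & I k}.

Lemma qball_center x r : 0 < r -> qball rho x r x.
Proof.
move=> r0; rewrite /qball/=; have [_ h _ _] := homogeneous_quasidistance ht.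
by rewrite (h x x).2.
Qed.

Lemma half_expz_gt0 (k : int) : 0 < 2^-1 ^ k :> R.
Proof. by rewrite exprz_gt0// invr_gt0. Qed.

Lemma measurable_qopen U : qopen rho U -> measurable U.
Proof.
move=> oU; rewrite (homogeneous_borel ht); exact: sub_sigma_algebra.
Qed.

Lemma measurable_cube k (tau : I k) : measurable (Q tau).
Proof. exact/measurable_qopen/(dyadic_open dy). Qed.

Lemma cube_gt0 k (tau : I k) : (0 < mu (Q tau))%E.
Proof.
have [x xQ] := dyadic_inner_ball dy tau.
have r0 : 0 < 2^-1 * 2^-1 ^ k :> R by rewrite mulr_gt0 ?half_expz_gt0.
apply: lt_le_trans (homogeneous_ball_pos ht x r0) _.
apply: le_measure; rewrite ?inE//; first exact: homogeneous_measurable_ball ht _ _.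
exact: measurable_cube.
Qed.

Lemma measurable_level k : measurable (\bigcup_(tau : I k) Q tau).
Proof.
apply: measurable_qopen => x [tau _ tx]; have [r r0 h] := dyadic_open dy tx.
by exists r => // y /h; exists tau.
Qed.

Lemma cube_meets_level k (tau : I k) l : exists (sigma : I l) x, Q tau x /\ Q sigma x.
Proof.
apply: contrapT => h.
have := cube_gt0 tau; rewrite ltNge => /negP; apply.
rewrite -(dyadic_cover dy l); apply: le_measure; rewrite ?inE.
- exact: measurable_cube.
- exact/measurableC/measurable_level.
- by move=> x Qx [sigma _ sx]; apply: h; exists sigma, x.
Qed.

Lemma cube_nested k l (tau : I k) (sigma : I l) x : l <= k ->
  Q tau x -> Q sigma x -> Q tau `<=` Q sigma.
Proof.
move=> lk tx sx; have [//|d0] := dyadic_nested dy tau sigma lk.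
by have : (Q tau `&` Q sigma) x by []; rewrite d0.
Qed.

(** Nestedness only compares the cubes as sets, while the conclusion identifies indices. A cube of
    the next generation meeting the first cube lies in both, and its ancestor index is unique. *)
Lemma cube_disjoint k (tau sigma : I k) x : Q tau x -> Q sigma x -> tau = sigma.
Proof.
move=> tx sx; have ts := cube_nested (lexx k) tx sx.
have [xi [y [ty xy]]] := cube_meets_level tau (k + 1).
have k1 : k < k + 1 by rewrite ltrDl.
have xt := cube_nested (ltW k1) xy ty.
have [z [_ zu]] := dyadic_ancestor dy xi k1.
by rewrite -(zu tau xt) -(zu sigma (subset_trans xt ts)).
Qed.

Lemma level_countable k : countable [set: I k].
Proof.
case: (pselect (exists x : X, True)) => [[x0 _]|noX].
  apply: (disjoint_positive_countable (mu := mu) (A := fun tau : I k => Q tau)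
    (F := fun N => qball rho x0 N.+1%:R)).
  - by move=> tau; exact: measurable_cube.
  - by move=> tau; exact: cube_gt0.
  - by move=> tau sigma x; exact: cube_disjoint.
  - by move=> N; exact: homogeneous_measurable_ball ht _ _.
  - by move=> N; exact: homogeneous_ball_fin ht _ _ _.
  - by move=> x; exists (Num.truncn (rho x0 x)); exact: truncnS_gt.
have -> : [set: I k] = set0; last exact: countable0.
apply/seteqP; split => // tau _; apply: noX.
by have [x _] := dyadic_inner_ball dy tau; exists x.
Qed.

(** This supplies the enumeration [e] behind every exchange of a sum over cubes with an integral. *)
Lemma cubes_countable : exists e : T -> nat, injective e.
Proof.
have : countable [set: T].
  apply: (sub_countable (subset_card_le (B := \bigcup_(k : int)
    ((fun tau : I k => existT _ k tau : T) @` setT)) _)).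
    by move=> [k tau] _; exists k => //; exists tau.
  apply: bigcup_countable => // k _.
  exact: card_le_trans (card_image_le _ _) (level_countable k).
by move=> /countable_injP[e ie]; exists e => i j; apply: ie; rewrite inE.
Qed.

End dyadic.

(** * The A_p condition for an everywhere positive weight *)

Section positive_weight.
Context {R : realType} {d : measure_display} {X : measurableType d}.
Variables (mu : {measure set X -> \bar R}) (v : X -> R) (p : R).
Hypotheses (mv : measurable_fun setT v) (v0 : forall x, 0 < v x) (p1 : 1 < p).

Definition weight_measure (E : set X) : \bar R := (\int[mu]_(x in E) (v x)%:E)%E.

Lemma conjugateE : conjugate p%:E = p / (p - 1).
Proof.
rewrite /conjugate /hoelder_conjugate/=.
rewrite eqe gt_eqF ?(lt_trans _ p1)//= -EFinB inver subr_eq0 gt_eqF//.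
Qed.

Lemma dual_weight_gt0 x : 0 < dual_weight p v x.
Proof. exact: powR_gt0. Qed.

Lemma measurable_weight E : measurable_fun E (fun x => (v x)%:E).
Proof. by apply/measurable_EFinP; exact: measurable_funTS. Qed.

Lemma measurable_dual E : measurable_fun E (fun x => (dual_weight p v x)%:E).
Proof.
apply/measurable_EFinP; apply: measurable_funTS; exact: measurable_dual_weight.
Qed.

(* A substitute for Young's inequality: one of the two terms dominates alone. *)
Lemma weight_dichotomy (a : \bar R) (c : R) x : (0 <= a)%E -> 0 < c ->
  (a <= c%:E * (a `^ conjugate p%:E * (dual_weight p v x)%:E) +
        (c `^ (1 - p) * v x)%:E)%E.
Proof.
have pm : 0 < p - 1 by rewrite subr_gt0.
have pi0 : 0 < (p - 1)^-1 by rewrite invr_gt0.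
have q0 : 0 < p / (p - 1) by rewrite divr_gt0// (lt_trans _ p1).
rewrite conjugateE; case: a => [a| |//]; last first.
  move=> _ c0; rewrite /= gt_eqF// gt0_mulye ?lte_fin ?dual_weight_gt0//.
  by rewrite gt0_muley ?lte_fin// leey.
rewrite lee_fin => a0 c0; rewrite poweR_EFin -!EFinM -EFinD lee_fin.
have d0 := dual_weight_gt0 x; have cv : 0 <= c `^ (1 - p) * v x.
  by rewrite mulr_ge0 ?powR_ge0// ltW.
have [h|h] := leP a (c `^ (1 - p) * v x).
  by rewrite (le_trans h)// lerDr mulr_ge0 ?mulr_ge0 ?powR_ge0// ltW.
have ap : 0 < a by exact: le_lt_trans h.
apply: (@le_trans _ _ (c * (a `^ (p / (p - 1)) * dual_weight p v x))); last first.
  by rewrite lerDl.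
have -> : p / (p - 1) = 1 + (p - 1)^-1.
  by field; rewrite gt_eqF.
rewrite powRD; last by rewrite [a == 0]gt_eqF ?implybT.
rewrite powRr1//.
(* In the remaining case the weight term is smaller than [a]. Raised to the power 1/(p-1), this says
   that c a^(1/(p-1)) v^(-1/(p-1)) is at least 1, and the first term is [a] times that quantity. *)
have key : c^-1 * v x `^ (p - 1)^-1 <= a `^ (p - 1)^-1.
  have -> : c^-1 * v x `^ (p - 1)^-1 = (c `^ (1 - p) * v x) `^ (p - 1)^-1.
    rewrite powRM ?powR_ge0 ?(ltW (v0 x))// -powRrM.
    by rewrite -(opprB p) mulNr divff ?gt_eqF// powRN powRr1 ?ltW.
  by apply: ge0_ler_powR; rewrite ?nnegrE ?(ltW pi0) ?(ltW h) ?(ltW ap).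
have -> : c * (a * a `^ (p - 1)^-1 * dual_weight p v x) =
    a * (c * dual_weight p v x * a `^ (p - 1)^-1) by ring.
rewrite ler_peMr//; apply: le_trans (ler_wpM2l _ key); last first.
  by rewrite mulr_ge0// ltW.
rewrite /dual_weight powRN mulrACA mulfV ?gt_eqF// mul1r mulVf//.
by rewrite gt_eqF// powR_gt0.
Qed.

Lemma weight_measure_ge0 E : (0 <= weight_measure E)%E.
Proof. by apply: integral_ge0 => x _; rewrite lee_fin ltW. Qed.

Lemma le_weight_measure A B : measurable A -> measurable B -> A `<=` B ->
  (weight_measure A <= weight_measure B)%E.
Proof.
move=> mA mB AB; apply: ge0_subset_integral => //; first exact: measurable_weight.
by move=> x _; rewrite lee_fin ltW.
Qed.

Lemma weight_measure_gt0 E : measurable E -> (0 < mu E)%E -> (0 < weight_measure E)%E.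
Proof.
move=> mE E0; rewrite lt_neqAle weight_measure_ge0 andbT; apply/negP => /eqP/esym h.
have := (ae_eq_integral_abs mu mE (measurable_weight (E := E))).1.
have -> : (\int[mu]_(x in E) `|(v x)%:E| = 0)%E.
  by rewrite -h; apply: eq_integral => x _; rewrite gee0_abs// lee_fin ltW.
move=> /(_ erefl) [N [mN N0 EN]].
move: E0; apply/negP; rewrite -leNgt -N0; apply: le_measure; rewrite ?inE//.
move=> x Ex; apply: EN => /= /(_ Ex) [] vx.
by have := v0 x; rewrite vx ltxx.
Qed.

Lemma weight_measure_setD A B : measurable A -> measurable B -> A `<=` B ->
  (weight_measure B = weight_measure A + weight_measure (B `\` A))%E.
Proof.
move=> mA mB AB; have mD : measurable (B `\` A) by exact: measurableD.
rewrite {1}/weight_measure -{1}(setDUK AB) ge0_integral_setU//.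
- exact: measurable_weight.
- by move=> x _; rewrite lee_fin ltW.
- apply/disj_setPS => x [Ax [_ nAx]]; exact: nAx.
Qed.

(* [mu E ^ p <= w(E) w'(B) ^ (p - 1)], up to the factor [2 ^ p] lost in the
   dichotomy, combined with the [A_p] bound on [w(B) w'(B) ^ (p - 1)]. *)
Lemma Ap_lower_bound (B E : set X) (M m u e : R) :
  measurable B -> measurable E -> E `<=` B -> 0 < M -> 0 < m -> 0 < u -> 0 <= e ->
  mu B = m%:E -> weight_measure B = u%:E -> mu E = e%:E ->
  (average mu B v * average mu B (dual_weight p v) `^ (p - 1) <= M%:E)%E ->
  (((e / (2 * m)) `^ p / M * u)%:E <= weight_measure E)%E.
Proof.
move=> mB mE EB M0 m0 u0 e0 muB nuB muE.
have pm : 0 < p - 1 by rewrite subr_gt0.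
have pi0 : 0 < (p - 1)^-1 by rewrite invr_gt0.
have pp : 0 < p by rewrite (lt_trans _ p1).
rewrite le_eqVlt in e0; case/predU1P: e0 => [<-|e0].
  by move=> _; rewrite mul0r powR0 ?gt_eqF// !mul0r weight_measure_ge0.
rewrite /average -/(weight_measure B) nuB muB inver gt_eqF//.
set D := (\int[mu]_(x in B) _)%E; have D0 : (0 <= D)%E.
  by apply: integral_ge0 => x _; rewrite lee_fin ltW// dual_weight_gt0.
(* An infinite integral of the dual weight would make the A_p product infinite, against the bound
   [M]. *)
case: (eqVneq D +oo%E) => [->|Dy].
  rewrite gt0_mulye ?lte_fin ?invr_gt0// poweRyr ?gt_eqF//.
  by rewrite -EFinM gt0_muley ?lte_fin ?divr_gt0.
have [dl DE] : exists dl, D = dl%:E.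
  by exists (fine D); rewrite fineK// ge0_fin_numE// ltey.
have dl0 : 0 <= dl by rewrite -lee_fin -DE.
rewrite DE -!EFinM ?poweR_EFin -?EFinM lee_fin => hM.
(* The A_p bound solved for the integral of the dual weight over [B]. *)
pose D2 := m * (M * m / u) `^ (p - 1)^-1.
have D20 : 0 < D2 by rewrite mulr_gt0// powR_gt0// divr_gt0// mulr_gt0.
have dlD2 : dl <= D2.
  rewrite -ler_pdivrMl// mulrC.
  have h1 : (dl / m) `^ (p - 1) <= M * m / u.
    rewrite ler_pdivlMr// -ler_pdivrMr// (le_trans _ hM)//.
    by rewrite le_eqVlt; apply/orP; left; apply/eqP; ring.
  have dm0 : 0 <= dl / m by rewrite divr_ge0// ltW.
  have -> : dl / m = ((dl / m) `^ (p - 1)) `^ (p - 1)^-1.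
    by rewrite -powRrM mulfV ?gt_eqF// powRr1.
  apply: ge0_ler_powR; rewrite ?nnegrE ?powR_ge0 ?(ltW pi0)//.
  by rewrite divr_ge0 ?mulr_ge0// ltW.
(* The dichotomy is integrated over [E] for the constant function 1. This [c] makes the dual-weight
   term at most c D2 = e/2, which is absorbed by the left-hand side [e]. *)
pose c := e / (2 * D2); have c0 : 0 < c by rewrite divr_gt0// mulr_gt0.
have hE : (e%:E <= c%:E * D + (c `^ (1 - p))%:E * weight_measure E)%E.
  apply: (@le_trans _ _ (\int[mu]_(x in E) (c%:E * (dual_weight p v x)%:E +
      (c `^ (1 - p))%:E * (v x)%:E))%E).
    rewrite -muE -[leLHS]mul1e -(integral_cst mu mE); apply: (ge0_le_integral mu mE).
    - by [].
    - exact: measurable_cst.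
    - by apply: emeasurable_funD; apply: measurable_funeM;
        [exact: measurable_dual|exact: measurable_weight].
    - move=> x _; have := @weight_dichotomy 1%E c x lee01 c0.
      by rewrite poweR1r mul1e -!EFinM.
  rewrite ge0_integralD//=.
  - rewrite !ge0_integralZl//=.
    + rewrite leeD2r// lee_wpmul2l ?lee_fin ?(ltW c0)//.
      apply: ge0_subset_integral => //; first exact: measurable_dual.
      by move=> x _; rewrite lee_fin ltW// dual_weight_gt0.
    + exact: measurable_weight.
    + by move=> x _; rewrite lee_fin ltW.
    + by rewrite lee_fin powR_ge0.
    + exact: measurable_dual.
    + by move=> x _; rewrite lee_fin ltW// dual_weight_gt0.
    + by rewrite lee_fin ltW.
  - by move=> x _; rewrite -EFinM lee_fin mulr_ge0// ltW// dual_weight_gt0.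
  - by apply: measurable_funeM; exact: measurable_dual.
  - by move=> x _; rewrite -EFinM lee_fin mulr_ge0 ?powR_ge0// ltW.
  - by apply: measurable_funeM; exact: measurable_weight.
have e2 : ((e / 2)%:E <= (c `^ (1 - p))%:E * weight_measure E)%E.
  have h1 : (c%:E * D <= (e / 2)%:E)%E.
    rewrite DE -EFinM lee_fin (le_trans (ler_wpM2l (ltW c0) dlD2))//.
    by rewrite /c le_eqVlt; apply/orP; left; apply/eqP; field; rewrite gt_eqF.
  have := le_trans hE (leeD2r _ h1).
  rewrite -leeBlDl// -EFinB; apply: le_trans; rewrite lee_fin; lra.
have cp0 : 0 < c `^ (1 - p) by rewrite powR_gt0.
rewrite -lee_pdivrMl// in e2; apply: le_trans e2.
rewrite -EFinM lee_fin.
have -> : (c `^ (1 - p))^-1 = c `^ (p - 1) by rewrite -powRN opprB.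
have powV (x y : R) : 0 <= x -> x^-1 `^ y = (x `^ y)^-1.
  by move=> x0; rewrite -powR_inv1// -powRrM mulN1r powRN.
have D2E : D2 `^ (p - 1) = m `^ (p - 1) * (M * m / u).
  have h0 : 0 <= M * m / u by rewrite divr_ge0 ?mulr_ge0// ltW.
  by rewrite powRM ?powR_ge0 ?(ltW m0)// -powRrM mulVf ?gt_eqF// powRr1.
have -> : c = e / 2 * D2^-1 by rewrite /c; field; rewrite gt_eqF.
have -> : e / (2 * m) = e / 2 * m^-1 by field; rewrite gt_eqF.
have e20 : 0 <= e / 2 by rewrite divr_ge0// ltW.
rewrite [(e / 2 * D2^-1) `^ _]powRM ?invr_ge0 ?(ltW D20)//.
rewrite [(e / 2 * m^-1) `^ _]powRM ?invr_ge0 ?(ltW m0)//.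
rewrite !powV ?(ltW D20) ?(ltW m0)// D2E.
rewrite -!(@mulr_powRB1 _ _ p)// ?(ltW m0)//.
rewrite le_eqVlt; apply/orP; left; apply/eqP; field.
by rewrite !gt_eqF// powR_gt0.
Qed.

End positive_weight.

(** * Power inequalities for the weights of cubes *)

Section numeric.
Context {R : realType}.
Implicit Types beta c W p t r : R.

Lemma powRX beta (e : R) j : 0 < beta -> (beta ^+ j) `^ e = (beta `^ e) ^+ j.
Proof.
by move=> b0; rewrite -powR_mulrn ?(ltW b0)// powRAC powR_mulrn ?powR_ge0.
Qed.

Lemma powR_antitone (a b e : R) : 0 < a -> a <= b -> e <= 0 -> b `^ e <= a `^ e.
Proof.
move=> a0 ab e0; have b0 : 0 < b by exact: lt_le_trans ab.
rewrite -[e]opprK !(powRN _ (- e)) lef_pV2 ?posrE ?powR_gt0//.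
by apply: ge0_ler_powR; rewrite ?nnegrE ?oppr_ge0 ?(ltW a0) ?(ltW b0).
Qed.

(** For a cube j generations inside the base cube of weight [W], where cube and intersection have
    the same weight [c]: the left side is c^(r/t-1) c, and the decay is applied to the first factor,
    whose exponent is positive as t < r. *)
Lemma powR_fine beta c W p t r j : 0 < beta -> 0 < c -> 0 < W -> 0 < t -> t < r ->
  c <= beta ^+ j * W ->
  (c `^ p^-1 * c `^ (t^-1 - p^-1)) `^ r <=
  W `^ (r / t - 1) * ((beta `^ (r / t - 1)) ^+ j * c).
Proof.
move=> b0 c0 W0 t0 tr cW; have r0 : 0 < r by exact: lt_trans tr.
have e1 : 0 < r / t - 1 by rewrite subr_gt0 ltr_pdivlMr// mul1r.
have -> : (c `^ p^-1 * c `^ (t^-1 - p^-1)) `^ r = c `^ (r / t - 1) * c.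
  rewrite -powRD; last by rewrite [c == 0]gt_eqF ?implybT.
  rewrite -powRrM [RHS]mulrC mulr_powRB1 ?(ltW c0) ?divr_gt0//.
  by congr powR; ring.
have bj : 0 <= beta ^+ j by rewrite exprn_ge0// ltW.
rewrite mulrA ler_wpM2r ?(ltW c0)// -powRX// [leRHS]mulrC -powRM ?(ltW W0)//.
by apply: (ge0_ler_powR (ltW e1) _ _ cW); rewrite nnegrE ?mulr_ge0 ?(ltW c0) ?(ltW W0).
Qed.

(** For an ancestor of weight [c], whose intersection with the base cube has weight [W]: a negative
    power of [c] is small because [c] is at least beta^(-j) W. *)
Lemma powR_coarse beta c W p t r j : 0 < beta -> 0 < c -> 0 < W ->
  0 < - ((t^-1 - p^-1) * r) -> W <= beta ^+ j * c ->
  (W `^ p^-1 * c `^ (t^-1 - p^-1)) `^ r <=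
  W `^ (r / t - 1) * ((beta `^ (- ((t^-1 - p^-1) * r))) ^+ j * W).
Proof.
move=> b0 c0 W0 e2 Wc; have bj : 0 < beta ^+ j by rewrite exprn_gt0.
rewrite powRM ?powR_ge0// -!powRrM.
have [sg sgE] : exists sg, (t^-1 - p^-1) * r = - sg.
  by exists (- ((t^-1 - p^-1) * r)); rewrite opprK.
rewrite sgE opprK in e2 *.
have h2 : c `^ (- sg) <= W `^ (- sg) * (beta `^ sg) ^+ j.
  rewrite !powRN ler_pdivlMl ?powR_gt0// ler_pdivrMr ?powR_gt0// -powRX//.
  rewrite -powRM ?(ltW c0) ?(ltW bj)//.
  apply: ge0_ler_powR; rewrite ?nnegrE ?(ltW e2) ?(ltW W0)//.
  by rewrite mulr_ge0// ltW.
apply: le_trans (ler_wpM2l (powR_ge0 _ _) h2) _.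
rewrite le_eqVlt; apply/orP; left; apply/eqP.
rewrite [LHS]mulrA -powRD; last by rewrite [W == 0]gt_eqF ?implybT.
have -> : p^-1 * r + - sg = (r / t - 1) + 1 by rewrite -sgE; ring.
rewrite powRD; last by rewrite [W == 0]gt_eqF ?implybT.
by rewrite powRr1 ?(ltW W0)//; ring.
Qed.

(** Either y is at most x^(1/(r-1)), and the product is at most the first term, or the reverse holds
    and it is at most the second. *)
Lemma crude_young (x y r : R) : 1 < r -> 0 <= x -> 0 <= y ->
  x * y <= x `^ (r / (r - 1)) + y `^ r.
Proof.
move=> r1 x0 y0; have r0 : 0 < r by exact: lt_trans r1.
have rm : 0 < r - 1 by rewrite subr_gt0.
have q0 : 0 < r / (r - 1) by rewrite divr_gt0.
have [h|h] := leP y (x `^ (r - 1)^-1).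
  apply: (@le_trans _ _ (x `^ (r / (r - 1)))); last by rewrite lerDl powR_ge0.
  rewrite -(mulr_powRB1 x0 q0) ler_wpM2l//.
  by rewrite (_ : r / (r - 1) - 1 = (r - 1)^-1)//; field; rewrite gt_eqF.
apply: (@le_trans _ _ (y `^ r)); last by rewrite lerDr powR_ge0.
rewrite -(mulr_powRB1 y0 r0) mulrC ler_wpM2l//.
have -> : x = (x `^ (r - 1)^-1) `^ (r - 1).
  by rewrite -powRrM mulVf ?gt_eqF// powRr1.
apply: ge0_ler_powR; rewrite ?nnegrE ?powR_ge0 ?(ltW rm)//.
exact: ltW.
Qed.

(** The [c] that balances the two terms of [weight_dichotomy] for a block, with [A] the weight of
    the intersection, [B] that of the cube and [B]^s the size allowed to the block. *)
Lemma block_constant (A B s p : R) : 0 < A -> 0 < B -> 1 < p ->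
  let q := p / (p - 1) in let c := A `^ p^-1 * B `^ (- (s * (q - 1))) in
  c * (B `^ s) `^ q = A `^ p^-1 * B `^ s /\
  c `^ (1 - p) * A = A `^ p^-1 * B `^ s.
Proof.
move=> A0 B0 p1 q c; have p0 : 0 < p by exact: lt_trans p1.
have pm : p - 1 != 0 by rewrite subr_eq0 gt_eqF.
split.
  rewrite /c -powRrM -mulrA -powRD; last by rewrite [B == 0]gt_eqF ?implybT.
  by congr (_ * powR _ _); ring.
rewrite /c powRM ?powR_ge0// -!powRrM mulrAC.
rewrite -{2}(powRr1 (ltW A0)) -powRD; last by rewrite [A == 0]gt_eqF ?implybT.
congr (powR _ _ * powR _ _); rewrite /q; field => //.
by rewrite gt_eqF.
Qed.

End numeric.

(** * Decay of the weights of cubes and local integrability of block series *)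

Section dyadic_weight.
Context {R : realType} {d : measure_display} {X : measurableType d}.
Variables (rho : X -> X -> R) (mu : {measure set X -> \bar R}) (n : R).
Variables (I : int -> choiceType) (Q : forall k : int, I k -> set X).
Variables (kappa0 alpha0 : R) (v : X -> R) (p M : R).
Hypotheses (ht : homogeneous_type rho mu n) (dy : dyadic_system rho mu Q kappa0).
Hypotheses (rd : reverse_doubling mu Q alpha0).
Hypotheses (mv : measurable_fun setT v) (v0 : forall x, 0 < v x) (p1 : 1 < p).
Hypothesis vfin : forall x (r : R), 0 < r ->
  (weight_measure mu v (qball rho x r) < +oo)%E.
Hypothesis M0 : 0 < M.
Hypothesis vAp : forall x (r : R), 0 < r -> (average mu (qball rho x r) v *
  average mu (qball rho x r) (dual_weight p v) `^ (p - 1) <= M%:E)%E.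
Local Notation T := {k : int & I k}.
Local Notation nu := (weight_measure mu v).
Let mQ := @measurable_cube _ _ _ _ _ _ _ _ _ ht dy.

Lemma cube_in_ball : exists2 C : R, 0 < C & forall k (tau : I k), exists x r,
  [/\ 0 < r, Q tau `<=` qball rho x r &
      (mu (qball rho x r) <= C%:E * mu (Q tau))%E].
Proof.
have [C0 C00 hC] := homogeneous_dimension ht.
(* Dilated by [lambda], the inner ball of radius g/2 has radius (kappa0 + 1) g, strictly more than
   the bound kappa0 g on the diameter, so it contains the cube. *)
have k0 := dyadic_kappa0_gt0 dy; pose lambda := 2 * (kappa0 + 1).
have l0 : 0 < lambda by rewrite mulr_gt0// addr_gt0.
have l1 : 1 <= lambda by rewrite /lambda; lra.
exists (C0 * lambda `^ n); first by rewrite mulr_gt0// powR_gt0.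
move=> k tau; have [x xQ] := dyadic_inner_ball dy tau.
have g0 : 0 < 2^-1 ^ k :> R := half_expz_gt0 k.
set g := 2^-1 ^ k in g0 xQ *.
have r0 : 0 < 2^-1 * g by rewrite mulr_gt0.
exists x, (lambda * (2^-1 * g)); split.
- by rewrite mulr_gt0.
- move=> y Qy; rewrite /qball/=; have Qx : Q tau x.
    by apply: xQ; exact: (qball_center ht).
  apply: (@le_lt_trans _ _ (kappa0 * g)).
    rewrite -lee_fin; apply: le_trans (dyadic_diam dy tau).
    by apply: ereal_sup_ubound; exists x, y.
  rewrite (_ : lambda * _ = kappa0 * g + g) ?ltrDl//.
  by rewrite /lambda; field.
- apply: le_trans (hC x _ _ r0 l1) _.
  rewrite lee_wpmul2l ?lee_fin ?mulr_ge0 ?powR_ge0 ?(ltW C00)//.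
  apply: le_measure; rewrite ?inE//.
  exact: (homogeneous_measurable_ball ht).
Qed.

Lemma cube_mu_fin k (tau : I k) : mu (Q tau) \is a fin_num.
Proof.
have [C C0 /(_ k tau) [x [r [r0 Qr _]]]] := cube_in_ball.
rewrite ge0_fin_numE//; apply: le_lt_trans (homogeneous_ball_fin ht x r0).
apply: le_measure; rewrite ?inE//.
exact: (homogeneous_measurable_ball ht).
Qed.

Lemma weight_measure_cube_fin k (tau : I k) : nu (Q tau) \is a fin_num.
Proof.
have [C C0 /(_ k tau) [x [r [r0 Qr _]]]] := cube_in_ball.
rewrite ge0_fin_numE ?weight_measure_ge0//; apply: le_lt_trans (vfin x r0).
apply: le_weight_measure => //.
exact: (homogeneous_measurable_ball ht).
Qed.

Lemma weight_measure_cube_gt0 k (tau : I k) : (0 < nu (Q tau))%E.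
Proof.
by apply: weight_measure_gt0 => //; exact: (cube_gt0 ht dy).
Qed.

(** By reverse doubling the child leaves free at least the fraction 1 - alpha0 of the measure of its
    parent. The A_p lower bound, in a ball comparable to the parent, turns this into a fixed
    fraction of the weight. *)
Lemma cube_weight_decay : exists2 beta : R, 0 < beta < 1 &
  forall k (tau : I k) (tau' : I (k - 1)), Q tau `<=` Q tau' ->
    (nu (Q tau) <= beta%:E * nu (Q tau'))%E.
Proof.
have [C C0 hC] := cube_in_ball.
have [/andP[a0 a1] hrd] := rd.
have pp : 0 < p by rewrite (lt_trans _ p1).
(* [C] compares the ball with the parent; the 2 and [M] come from [Ap_lower_bound]. *)
pose delta := ((1 - alpha0) / (2 * C)) `^ p / M.
have b0 : 0 < (1 - alpha0) / (2 * C) by rewrite divr_gt0 ?mulr_gt0// subr_gt0.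
have delta0 : 0 < delta by rewrite divr_gt0// powR_gt0.
(* The maximum with 1/2 ensures positivity without an upper bound on [delta]. *)
exists (Num.max (1 - delta) 2^-1).
  rewrite lt_max invr_gt0 ltr0n orbT/= gt_max; apply/andP; split; lra.
move=> k S P SP; have [x [r [r0 PB hB]]] := hC _ P.
set B := qball rho x r in PB hB.
have mB : measurable B by exact: (homogeneous_measurable_ball ht).
have mS := mQ S; have mP := mQ P; have mPS : measurable (Q P `\` Q S).
  exact: measurableD.
have [m mE] : exists m, mu B = m%:E.
  exists (fine (mu B)); rewrite fineK// ge0_fin_numE//.
  exact: (homogeneous_ball_fin ht).
have m0 : 0 < m.
  by rewrite -lte_fin -mE; exact: (homogeneous_ball_pos ht).
have [u uE] : exists u, nu B = u%:E.
  by exists (fine (nu B)); rewrite fineK// ge0_fin_numE ?weight_measure_ge0// vfin.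
have u0 : 0 < u.
  by rewrite -lte_fin -uE; apply: weight_measure_gt0 => //; rewrite mE lte_fin.
have [a aE] : exists a, mu (Q P) = a%:E.
  by exists (fine (mu (Q P))); rewrite fineK// cube_mu_fin.
have [b bE] : exists b, mu (Q S) = b%:E.
  by exists (fine (mu (Q S))); rewrite fineK// cube_mu_fin.
have ba : b <= alpha0 * a.
  by rewrite -lee_fin EFinM -aE -bE; exact: hrd.
have bge : 0 <= b by rewrite -lee_fin -bE.
have eE : mu (Q P `\` Q S) = (a - b)%:E.
  have mPfin : (mu (Q P) < +oo)%E by rewrite aE ltry.
  have -> : mu (Q P `\` Q S) = (mu (Q P) - mu (Q P `&` Q S))%E.
    exact: measureD.
  by rewrite (setIidr SP) aE bE.
have mCa : m <= C * a by rewrite -lee_fin EFinM -aE -mE.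
have ap : 0 < a.
  by rewrite -(pmulr_rgt0 _ C0); exact: lt_le_trans mCa.
have e0 : 0 <= a - b by rewrite subr_ge0 (le_trans ba)// ler_piMl// ltW.
have PSB : Q P `\` Q S `<=` B by move=> y [/PB].
have h := Ap_lower_bound mv v0 p1 mB mPS PSB M0 m0 u0 e0 mE uE eE (vAp x r0).
have hd : ((delta * u)%:E <= nu (Q P `\` Q S))%E.
  apply: le_trans h; rewrite lee_fin ler_wpM2r ?(ltW u0)//.
  rewrite ler_wpM2r ?invr_ge0 ?(ltW M0)//.
  apply: ge0_ler_powR; rewrite ?nnegrE ?(ltW pp) ?(ltW b0)//.
    by rewrite divr_ge0 ?mulr_ge0 ?(ltW m0).
  rewrite ler_pdivrMr ?mulr_gt0// mulrAC ler_pdivlMr ?mulr_gt0//.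
  have h1 : (1 - alpha0) * (2 * m) <= (1 - alpha0) * (2 * (C * a)).
    by rewrite ler_pM2l ?subr_gt0// ler_pM2l.
  apply: le_trans h1 _.
  have -> : (1 - alpha0) * (2 * (C * a)) = ((1 - alpha0) * a) * (2 * C) by ring.
  rewrite ler_pM2r ?mulr_gt0//; lra.
have [s sE] : exists s, nu (Q S) = s%:E.
  by exists (fine (nu (Q S))); rewrite fineK// weight_measure_cube_fin.
have [t tE] : exists t, nu (Q P) = t%:E.
  by exists (fine (nu (Q P))); rewrite fineK// weight_measure_cube_fin.
have tu : t <= u.
  by rewrite -lee_fin -tE -uE; apply: le_weight_measure.
have t0 : 0 <= t by rewrite -lee_fin -tE weight_measure_ge0.
have := @weight_measure_setD _ _ _ mu _ mv v0 _ _ mS mP SP.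
rewrite sE tE => hts; rewrite -EFinM lee_fin.
have : ((delta * u)%:E <= (t - s)%:E)%E.
  by apply: le_trans hd _; rewrite EFinB hts addeAC subee// add0e.
rewrite lee_fin => hs.
have dt : delta * t <= delta * u by rewrite ler_pM2l.
apply: (@le_trans _ _ ((1 - delta) * t)); first lra.
by rewrite ler_wpM2r// le_max lexx.
Qed.

(** Containment is expressed by a common point, which suffices by nestedness and is passed on to the
    parent in the induction. *)
Lemma cube_weight_decay_iter : exists2 beta : R, 0 < beta < 1 &
  forall (j : nat) k l (tau : I k) (sigma : I l) x, k = l + j%:Z ->
    Q tau x -> Q sigma x -> (nu (Q tau) <= (beta ^+ j)%:E * nu (Q sigma))%E.
Proof.
have [beta /andP[b0 b1] hb] := cube_weight_decay; exists beta; first exact/andP.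
elim=> [|j IH] k l tau sigma x kl tx sx.
  rewrite expr0 mul1e; apply: le_weight_measure => //.
  by apply: (cube_nested dy _ tx sx); rewrite kl addr0.
have k1 : k - 1 < k by rewrite ltrBlDr ltrDl.
have [tau' [tt' _]] := dyadic_ancestor dy tau k1.
have kl1 : k - 1 = l + j%:Z by rewrite kl intS -addrA [1 + _]addrC addrK.
have := IH _ _ tau' sigma x kl1 (tt' _ tx) sx.
move=> /(lee_wpmul2l (x := beta%:E)); rewrite lee_fin (ltW b0) => /(_ isT).
rewrite muleA -EFinM -exprS; apply: le_trans; exact: hb.
Qed.

Variables (k0 : int) (tau0 : I k0) (t : R).
Local Notation P := (Q tau0).

Definition cube_weight (i : T) : R := fine (nu (Q (tagged i))).
Definition cap_weight (i : T) : R := fine (nu (Q (tagged i) `&` P)).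
(* The bound of the integral over [P] of a block supported in the cube [i]. *)
Definition cap_bound (i : T) : R :=
  cap_weight i `^ p^-1 * cube_weight i `^ (t^-1 - p^-1).

Let pp : 0 < p. Proof. exact: lt_trans p1. Qed.

Let mcap (i : T) : measurable (Q (tagged i) `&` P).
Proof. exact: measurableI. Qed.

Lemma cube_weightE i : nu (Q (tagged i)) = (cube_weight i)%:E.
Proof. by rewrite fineK// weight_measure_cube_fin. Qed.

Lemma cap_weightE i : nu (Q (tagged i) `&` P) = (cap_weight i)%:E.
Proof.
rewrite fineK// ge0_fin_numE ?weight_measure_ge0//.
apply: (@le_lt_trans _ _ (nu P)).
  by apply: le_weight_measure => //; exact: subIsetr.
by rewrite -ge0_fin_numE ?weight_measure_ge0// weight_measure_cube_fin.
Qed.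

Lemma cube_weight_gt0 i : 0 < cube_weight i.
Proof. by rewrite -lte_fin -cube_weightE weight_measure_cube_gt0. Qed.

Lemma cap_weight_ge0 i : 0 <= cap_weight i.
Proof. by rewrite -lee_fin -cap_weightE weight_measure_ge0. Qed.

Lemma cap_bound_ge0 i : 0 <= cap_bound i.
Proof. by rewrite mulr_ge0 ?powR_ge0. Qed.

Lemma cap_weight_le i : cap_weight i <= cube_weight i.
Proof.
rewrite -lee_fin -cap_weightE -cube_weightE.
by apply: le_weight_measure => //; exact: subIsetl.
Qed.

Let i0 : T := existT _ k0 tau0.

Lemma cap_weight_le_base i : cap_weight i <= cube_weight i0.
Proof.
rewrite -lee_fin -cap_weightE -(cube_weightE i0).
by apply: le_weight_measure => //; exact: subIsetr.
Qed.

Lemma cap_weight0 i : ~ (exists x, Q (tagged i) x /\ P x) -> cap_weight i = 0.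
Proof.
move=> h; rewrite /cap_weight (_ : _ `&` _ = set0) ?/nu ?integral_set0//.
by apply/seteqP; split => // x [qx px]; apply: h; exists x.
Qed.

Lemma cap_weight_fine i x : Q (tagged i) x -> P x -> k0 <= tag i ->
  cap_weight i = cube_weight i.
Proof.
move=> qx px ki; rewrite /cap_weight setIidl//.
exact: (cube_nested dy ki qx px).
Qed.

Lemma cap_weight_coarse i x : Q (tagged i) x -> P x -> tag i <= k0 ->
  cap_weight i = cube_weight i0.
Proof.
move=> qx px ki; rewrite /cap_weight setIidr//.
exact: (cube_nested dy ki px qx).
Qed.

Lemma cap_weight_gt0 i x : Q (tagged i) x -> P x -> 0 < cap_weight i.
Proof.
move=> qx px; have /orP[ki|ki] := le_total k0 (tag i).
  by rewrite (cap_weight_fine qx px ki) cube_weight_gt0.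
by rewrite (cap_weight_coarse qx px ki) cube_weight_gt0.
Qed.

(** [theta] is the larger of the two rates given by [powR_fine] and [powR_coarse]. The factor
    [cap_weight i] is retained because it can be summed over a generation. *)
Lemma cap_bound_pow r : p < t < r -> exists theta C : R,
  [/\ 0 <= theta < 1, 0 <= C & forall i,
      cap_bound i `^ r <= C * (theta ^+ `|tag i - k0|%N * cap_weight i)].
Proof.
move=> /andP[pt tr]; have t0 : 0 < t by exact: lt_trans pt.
have r0 : 0 < r by exact: lt_trans tr.
have [beta /andP[b0 b1] hb] := cube_weight_decay_iter.
set s := t^-1 - p^-1; pose W := cube_weight i0.
have W0 : 0 < W by exact: cube_weight_gt0.
have s0 : s < 0 by rewrite subr_lt0 ltf_pV2.
have e1 : 0 < r / t - 1 by rewrite subr_gt0 ltr_pdivlMr// mul1r.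
have e2 : 0 < - (s * r) by rewrite oppr_gt0 nmulr_rlt0.
pose th1 := beta `^ (r / t - 1); pose th2 := beta `^ (- (s * r)).
have th_lt1 (e : R) : 0 < e -> beta `^ e < 1.
  move=> he; have <- : 1 `^ e = 1 :> R by rewrite powR1.
  by apply: gt0_ltr_powR; rewrite ?nnegrE ?(ltW b0).
exists (Num.max th1 th2), (W `^ (r / t - 1)).
split; first by rewrite le_max powR_ge0/= gt_max !th_lt1.
  exact: powR_ge0.
move=> i; have wi0 := cube_weight_gt0 i.
case: (pselect (exists x, Q (tagged i) x /\ P x)) => [[x [qx px]]|h]; last first.
  rewrite /cap_bound (cap_weight0 h) powR0 ?invr_eq0 ?gt_eqF// mul0r powR0 ?gt_eqF//.
  by rewrite !mulr0.
have thX (th : R) (j : nat) : 0 <= th -> th <= Num.max th1 th2 ->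
    th ^+ j <= Num.max th1 th2 ^+ j.
  move=> th0 thm; apply: lerXn2r => //; rewrite nnegrE//.
  exact: le_trans thm.
set j := `|tag i - k0|%N.
have /orP[ki|ki] := le_total k0 (tag i).
- have kE : tag i = k0 + j%:Z by rewrite gez0_abs ?subr_ge0// addrCA subrr addr0.
  have := hb j _ _ _ _ x kE qx px.
  rewrite cube_weightE (cube_weightE i0) -EFinM lee_fin => hw.
  rewrite /cap_bound (cap_weight_fine qx px ki).
  apply: le_trans (powR_fine p b0 wi0 W0 t0 tr hw) _.
  apply: (ler_wpM2l (powR_ge0 _ _)); apply: (ler_wpM2r (ltW wi0)).
  by apply: thX; rewrite ?powR_ge0// le_max lexx.
- have jE : j = `|k0 - tag i|%N by rewrite distnC.
  have kE : k0 = tag i + j%:Z.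
    by rewrite jE gez0_abs ?subr_ge0// addrCA subrr addr0.
  have := hb j _ _ _ _ x kE px qx.
  rewrite (cube_weightE i0) cube_weightE -EFinM lee_fin => hw.
  rewrite /cap_bound (cap_weight_coarse qx px ki).
  apply: le_trans (powR_coarse b0 wi0 W0 e2 hw) _.
  apply: (ler_wpM2l (powR_ge0 _ _)); apply: (ler_wpM2r (ltW W0)).
  by apply: thX; rewrite ?powR_ge0// le_max lexx orbT.
Qed.

(** The endpoint r = oo, where a supremum replaces the sum. The exponent 1/t - 1/p is nonpositive,
    so replacing the weight of the cube by that of its intersection with [P] only increases the
    bound. *)
Lemma cap_bound_bounded : p <= t -> exists2 C : R, 0 < C & forall i, cap_bound i <= C.
Proof.
move=> pt; have t0 : 0 < t by exact: lt_le_trans pt.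
exists (cube_weight i0 `^ t^-1); first by rewrite powR_gt0 ?cube_weight_gt0.
move=> i; case: (pselect (exists x, Q (tagged i) x /\ P x)) => [[x [qx px]]|h]; last first.
  by rewrite /cap_bound (cap_weight0 h) powR0 ?invr_eq0 ?gt_eqF// mul0r powR_ge0.
have wi0 := cube_weight_gt0 i; have ci0 := cap_weight_gt0 qx px.
apply: (@le_trans _ _ (cap_weight i `^ t^-1)); last first.
  apply: ge0_ler_powR; rewrite ?nnegrE ?invr_ge0 ?(ltW t0) ?(ltW ci0)//.
    by rewrite ltW ?cube_weight_gt0.
  exact: cap_weight_le_base.
have -> : cap_weight i `^ t^-1 = cap_weight i `^ p^-1 * cap_weight i `^ (t^-1 - p^-1).
  rewrite -powRD; last by rewrite [cap_weight i == 0]gt_eqF ?implybT.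
  by congr powR; ring.
apply: (ler_wpM2l (powR_ge0 _ _)).
apply: powR_antitone ci0 (cap_weight_le i) _.
by rewrite subr_le0 lef_pV2.
Qed.

Lemma geometric_esum_injective (theta : R) (S : set T) (g : T -> nat) :
  0 <= theta < 1 -> set_inj S g ->
  (\esum_(i in S) (theta ^+ g i)%:E <= ((1 - theta)^-1)%:E)%E.
Proof.
move=> /andP[th0 th1] gi.
rewrite -(@esum_image R T nat S g (fun m => (theta ^+ m)%:E))//.
apply: (@le_trans _ _ (\esum_(m in [set: nat]) (theta ^+ m)%:E)%E).
  rewrite esum_mkcond; apply: le_esum => m _.
  by case: ifP => // _; rewrite lee_fin exprn_ge0.
have t0 (m : nat) : (0 <= (theta ^+ m)%:E)%E by rewrite lee_fin exprn_ge0.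
have d0 : 0 < 1 - theta by rewrite subr_gt0.
rewrite -nneseries_esumT//; apply: lime_le; first exact: is_cvg_nneseries.
apply: nearW => m.
suff : \sum_(0 <= j < m) theta ^+ j + theta ^+ m / (1 - theta) = (1 - theta)^-1.
  move=> <-; rewrite sumEFin lee_fin lerDl.
  by rewrite divr_ge0 ?exprn_ge0// ltW.
elim: m => [|m IH]; first by rewrite big_nil add0r expr0 mul1r.
rewrite -[RHS]IH big_nat_recr//= -addrA; congr (_ + _).
by rewrite exprS; field; rewrite gt_eqF.
Qed.

(** The sum is moved under the integral over [P]: a point lies in at most one cube of each
    generation, so the integrand is the weight times at most two geometric series, whence 2/(1 -
    theta). *)
Lemma cap_weight_sum (theta : R) (e : T -> nat) : injective e -> 0 <= theta < 1 ->
  (\esum_(i in [set: T]) (theta ^+ `|tag i - k0|%N * cap_weight i)%:E <=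
   (2 / (1 - theta) * cube_weight i0)%:E)%E.
Proof.
move=> ie th; have /andP[th0 th1] := th.
have d0 : 0 < 1 - theta by rewrite subr_gt0.
pose F (i : T) (x : X) : \bar R :=
  ((theta ^+ `|tag i - k0|%N)%:E * ((fun x => (v x)%:E) \_ (Q (tagged i))) x)%E.
have F0 i x : (0 <= F i x)%E.
  rewrite mule_ge0 ?lee_fin ?exprn_ge0// patchE; case: ifP => // _.
  by rewrite lee_fin ltW.
have mF0 (i : T) : measurable_fun P ((fun x => (v x)%:E) \_ (Q (tagged i))).
  apply/measurable_restrict => //; exact: measurable_weight.
have mF i : measurable_fun P (F i) by apply: measurable_funeM.
have FE i : (\int[mu]_(x in P) F i x =
    (theta ^+ `|tag i - k0|%N * cap_weight i)%:E)%E.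
  rewrite ge0_integralZl//.
  - by rewrite -integral_mkcondr setIC EFinM -cap_weightE.
  - by move=> x _; rewrite patchE; case: ifP => // _; rewrite lee_fin ltW.
  - by rewrite lee_fin exprn_ge0.
under eq_esum do rewrite -FE.
rewrite -(integral_esum (e := e))//.
apply: (@le_trans _ _ (\int[mu]_(x in P) ((2 / (1 - theta))%:E * (v x)%:E))%E); last first.
  rewrite ge0_integralZl//.
  - by rewrite [leRHS]EFinM -(cube_weightE i0).
  - exact: measurable_weight.
  - by move=> x _; rewrite lee_fin ltW.
  - by rewrite lee_fin divr_ge0// ltW.
apply: ge0_le_integral => //.
- by move=> x _; apply: esum_ge0.
- exact: (measurable_esum (e := e)).
- by apply: measurable_funeM; exact: measurable_weight.
move=> x Px.
pose S := [set i : T | Q (tagged i) x].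
have -> : (\esum_(i in [set: T]) F i x = (v x)%:E *
    \esum_(i in S) (theta ^+ `|tag i - k0|%N)%:E)%E.
  rewrite [in RHS]esum_mkcond -esumZl; last 2 first.
  - exact: ltW.
  - by move=> i; case: ifP => // _; rewrite lee_fin exprn_ge0.
  apply: eq_esum => i _; rewrite /F patchE.
  have -> : (i \in S) = (x \in Q (tagged i)) by apply/idP/idP; rewrite !inE.
  by case: ifP => _; rewrite ?mule0// muleC.
rewrite muleC lee_wpmul2r ?lee_fin ?(ltW (v0 x))//.
(* On either side of the generation [k0] the distance to [k0] determines the generation, hence the
   cube through [x]. *)
rewrite (esumID [set i : T | k0 <= tag i]); last first.
  by move=> i _; rewrite lee_fin exprn_ge0.
have -> : 2 / (1 - theta) = (1 - theta)^-1 + (1 - theta)^-1 by ring.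
have tagI i j : S i -> S j -> tag i = tag j -> i = j.
  case: i j => [k s1] [l s2] /= h1 h2 kl; case: _ / kl s2 h1 h2 => s2 h1 h2.
  by have -> : s1 = s2 by exact: (cube_disjoint ht dy h1 h2).
rewrite EFinD leeD//; apply: geometric_esum_injective => //.
  move=> i j; rewrite !inE => -[Si ki] [Sj kj] /(congr1 (fun m : nat => m%:Z)).
  rewrite !gez0_abs ?subr_ge0// => /addIr; exact: tagI.
move=> i j; rewrite !inE => -[Si /= /negP ki] [Sj /= /negP kj].
rewrite -!ltNge in ki kj.
rewrite distnC [RHS]distnC => /(congr1 (fun m : nat => m%:Z)).
rewrite !gez0_abs ?subr_ge0 ?ltW// => /addrI /oppr_inj; exact: tagI.
Qed.

(** The duality of l^r and l^{r'}: the numbers [cap_bound i] form an l^r family, or a bounded one if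
    r = oo. *)
Lemma cap_bound_linear (r : \bar R) (e : T -> nat) : injective e ->
  (exists2 r0, r = r0%:E & p < t < r0) \/ (p <= t /\ r = +oo%E) ->
  exists2 C : R, 0 < C & forall lam : T -> R, (forall i, 0 <= lam i) ->
    (\esum_(i in [set: T]) (lam i * cap_bound i)%:E <=
     C%:E * lp_norm (conjugate r) (fun i => (lam i)%:E))%E.
Proof.
move=> ie [[r0 -> ptr]|[pt ->]]; last first.
  have [C C0 hC] := cap_bound_bounded pt; exists C => // lam lam0.
  rewrite /conjugate hoelder_conjugatey /lp_norm/= invr1 poweRe1; last first.
    by apply: esum_ge0 => i _; rewrite lee_fin powR_ge0.
  rewrite -esumZl ?(ltW C0)//; last by move=> i; rewrite lee_fin powR_ge0.
  apply: le_esum => i _; rewrite -EFinM lee_fin powRr1// mulrC.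
  exact: ler_wpM2r.
have [theta [C0 [th C00 hC]]] := cap_bound_pow ptr.
have /andP[pt tr] := ptr.
have r1 : 1 < r0 by rewrite (lt_trans p1)// (lt_trans pt).
have /andP[th0 th1] := th.
pose C1 := C0 * (2 / (1 - theta) * cube_weight i0).
have hS : (\esum_(i in [set: T]) (cap_bound i `^ r0)%:E <= C1%:E)%E.
  rewrite EFinM; apply: le_trans (lee_wpmul2l _ (cap_weight_sum ie th)); last first.
    by rewrite lee_fin.
  rewrite -esumZl//; last first.
    by move=> i; rewrite lee_fin mulr_ge0 ?exprn_ge0 ?cap_weight_ge0.
  by apply: le_esum => i _; rewrite -EFinM lee_fin.
have C10 : 0 <= C1.
  by rewrite /C1 !mulr_ge0 ?invr_ge0 ?subr_ge0 ?(ltW th1) ?(ltW (cube_weight_gt0 _)).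
(* For coefficients of norm one, 1 bounds the sum of their conjugate powers and [C1] that of the
   r0-th powers of the [cap_bound i]. The strict positivity settles the case of an infinite norm. *)
exists (1 + C1); first by rewrite ltr_pwDl.
move=> lam lam0; set S := lp_norm _ _.
rewrite (conjugateE r1) in S *.
have q0 : 0 < r0 / (r0 - 1) by rewrite divr_gt0 ?subr_gt0// (lt_trans _ r1).
have S0 : (0 <= S)%E by exact: lp_norm_ge0.
have u0 i : (0 <= (lam i)%:E)%E by rewrite lee_fin.
have lamS i : ((lam i)%:E <= S)%E by exact: (lp_norm_ge_term i q0 u0).
have [->|Sy] := eqVneq S +oo%E.
  by rewrite gt0_muley ?leey// lte_fin ltr_pwDl.
have [s sE] : exists s, S = s%:E by exists (fine S); rewrite fineK// ge0_fin_numE// ltey.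
have s0 : 0 <= s by rewrite -lee_fin -sE.
rewrite le_eqVlt in s0; case/predU1P: s0 => [s0|s0].
  rewrite esum1 ?mule_ge0 ?lee_fin ?addr_ge0// => i _.
  have -> : lam i = 0.
    by apply/eqP; rewrite eq_le lam0 andbT -lee_fin (le_trans (lamS i))// sE -s0.
  by rewrite mul0r.
(* The crude Young inequality is not homogeneous, so the coefficients are normalized before it is
   used. *)
pose x i := s^-1 * lam i.
have x0 i : 0 <= x i by rewrite mulr_ge0 ?invr_ge0 ?(ltW s0).
have hx : (\esum_(i in [set: T]) (x i `^ (r0 / (r0 - 1)))%:E <= 1)%E.
  have sV : (0 <= s^-1 `^ (r0 / (r0 - 1))) by exact: powR_ge0.
  under eq_esum do rewrite /x powRM ?invr_ge0 ?(ltW s0)// EFinM.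
  rewrite esumZl//; last by move=> i; rewrite lee_fin powR_ge0.
  have /(lp_normP _ q0 S0) h : (S <= S)%E by [].
  apply: le_trans (lee_wpmul2l _ h) _; first by rewrite lee_fin.
  rewrite sE poweR_EFin -EFinM -powRM ?invr_ge0 ?(ltW s0)//.
  by rewrite mulVf ?gt_eqF// powR1.
apply: (@le_trans _ _ (s%:E * \esum_(i in [set: T])
    ((x i `^ (r0 / (r0 - 1)))%:E + (cap_bound i `^ r0)%:E))%E).
  rewrite -esumZl ?(ltW s0)//; last first.
    by move=> i; rewrite -EFinD lee_fin addr_ge0 ?powR_ge0.
  apply: le_esum => i _; rewrite -EFinD -EFinM lee_fin.
  have -> : lam i * cap_bound i = s * (x i * cap_bound i).
    by rewrite /x; field; rewrite gt_eqF.
  by apply: (ler_wpM2l (ltW s0)); exact: crude_young r1 (x0 i) (cap_bound_ge0 i).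
rewrite esumD; [|by move=> i _; rewrite lee_fin powR_ge0..].
rewrite sE muleC; apply: lee_wpmul2r; first by rewrite lee_fin ltW.
by rewrite EFinD; apply: leeD.
Qed.

Context {sk : scalar_kind} {V : value_space R sk}.
Hypothesis gV : regular_values V.

(** The dichotomy with the constant of [block_constant] is integrated over the intersection with
    [P]. The size condition of the block bounds one term, the weight of the intersection gives the
    other, and each is at most [cap_bound i]. *)
Lemma block_cap_integral (i : T) (b : X -> value V) :
  block mu v p t (Q (tagged i)) b ->
  (\int[mu]_(x in P) value_norm (b x) <= (2 * cap_bound i)%:E)%E.
Proof.
move=> [mb b0 bb]; have mn := measurable_value_norm gV mb.
have -> : (\int[mu]_(x in P) value_norm (b x) =
    \int[mu]_(x in Q (tagged i) `&` P) value_norm (b x))%E.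
  rewrite setIC integral_mkcondr; apply: eq_integral => x _; rewrite patchE.
  by case: ifPn => //; rewrite notin_setE => nQ; rewrite b0// value_norm0.
case: (pselect (exists x, Q (tagged i) x /\ P x)) => [[x [qx px]]|h]; last first.
  rewrite (_ : _ `&` _ = set0); last first.
    by apply/seteqP; split => // x [qx px]; apply: h; exists x.
  by rewrite integral_set0 lee_fin mulr_ge0// cap_bound_ge0.
have A0 := cap_weight_gt0 qx px; have B0 := cube_weight_gt0 i.
set s := t^-1 - p^-1 in bb *; set q := conjugate p%:E in bb *.
have qE : q = p / (p - 1) := conjugateE p1.
have q0 : 0 < q by rewrite qE divr_gt0// subr_gt0.
pose c := cap_weight i `^ p^-1 * cube_weight i `^ (- (s * (q - 1))).
have c0 : 0 < c by rewrite mulr_gt0 ?powR_gt0.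
have [c1 c2] := block_constant s A0 B0 p1.
rewrite -qE -/c in c1 c2.
set J := (fun x => value_norm (b x) `^ q * (dual_weight p v x)%:E)%E in bb.
have J0 x' : (0 <= J x')%E.
  by rewrite mule_ge0 ?poweR_ge0 ?lee_fin ?powR_ge0.
have mJ E : measurable_fun E J.
  apply: measurable_funTS; apply: emeasurable_funM; last exact: measurable_dual.
  exact: (measurableT_comp (measurable_poweR _) mn).
have hJ : (\int[mu]_(x in Q (tagged i)) J x <= ((cube_weight i `^ s) `^ q)%:E)%E.
  have Ji : (0 <= \int[mu]_(x in Q (tagged i)) J x)%E by exact: integral_ge0.
  have := le_poweR (ltW q0) (poweR_ge0 _ _) bb.
  rewrite -poweRrM mulVf ?gt_eqF// poweRe1//.
  by rewrite -/(weight_measure mu v (Q (tagged i))) cube_weightE.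
apply: (@le_trans _ _ (\int[mu]_(x in Q (tagged i) `&` P)
    (c%:E * J x + (c `^ (1 - p))%:E * (v x)%:E))%E).
  apply: ge0_le_integral => //.
  - by move=> y _; exact: value_norm_ge0.
  - exact: measurable_funTS.
  - by apply: emeasurable_funD; apply: measurable_funeM;
      [exact: mJ|exact: measurable_weight].
  - move=> y _; have := weight_dichotomy v0 p1 y (value_norm_ge0 gV (b y)) c0.
    by rewrite [X in (_ <= _ + X)%E]EFinM.
have cc0 : 0 <= c `^ (1 - p) by exact: powR_ge0.
rewrite ge0_integralD//=; last 4 first.
- by move=> y _; rewrite mule_ge0 ?lee_fin ?(ltW c0).
- by apply: measurable_funeM; exact: mJ.
- by move=> y _; rewrite mule_ge0 ?lee_fin ?(ltW (v0 y)).
- by apply: measurable_funeM; exact: measurable_weight.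
have v0' y : (0 <= (v y)%:E)%E by rewrite lee_fin ltW.
rewrite (ge0_integralZl mu (mcap i) (mJ _))//; last by rewrite lee_fin ltW.
rewrite (ge0_integralZl mu (mcap i) (measurable_weight mv (E := _)))//.
rewrite -/(weight_measure mu v (Q (tagged i) `&` P)) cap_weightE -EFinM c2.
rewrite mulr_natl mulr2n EFinD leeD2r//.
apply: (@le_trans _ _ (c%:E * ((cube_weight i `^ s) `^ q)%:E)%E); last first.
  by rewrite -EFinM c1.
rewrite lee_wpmul2l ?lee_fin ?(ltW c0)//; apply: le_trans hJ.
by apply: ge0_subset_integral => //; exact: mJ.
Qed.

Lemma cube_local_L1 (r : \bar R) (e : T -> nat) : injective e ->
  (exists2 r0, r = r0%:E & p < t < r0) \/ (p <= t /\ r = +oo%E) ->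
  exists2 C : R, 0 < C & forall (lam : T -> scalar_field R sk) (b : T -> X -> value V),
    (forall i, block mu v p t (Q (tagged i)) (b i)) ->
    (\int[mu]_(x in P)
       (\esum_(i in [set: T]) ((modulus (lam i))%:E * value_norm (b i x))) <=
     C%:E * ell_norm (conjugate r) lam)%E.
Proof.
move=> ie hr; have [C C0 hC] := cap_bound_linear ie hr.
exists (2 * C); first by rewrite mulr_gt0.
move=> lam b bb.
have n0 i x : (0 <= value_norm (b i x))%E by exact: value_norm_ge0.
have mn i : measurable_fun P (fun x => value_norm (b i x)).
  by have [mb _ _] := bb i; apply: measurable_funTS; exact: measurable_value_norm.
rewrite (integral_esum (e := e)
  (f := fun i x => ((modulus (lam i))%:E * value_norm (b i x))%E))//; last 2 first.
- by move=> i x; rewrite mule_ge0 ?lee_fin ?modulus_ge0.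
- by move=> i; exact: measurable_funeM.
apply: (@le_trans _ _ (2%:E * \esum_(i in [set: T])
    (modulus (lam i) * cap_bound i)%:E)%E); last first.
  rewrite EFinM -muleA lee_wpmul2l ?lee_fin//.
  by apply: hC => i; exact: modulus_ge0.
rewrite -esumZl//; last by move=> i; rewrite lee_fin mulr_ge0 ?modulus_ge0 ?cap_bound_ge0.
apply: le_esum => i _; rewrite ge0_integralZl ?lee_fin ?modulus_ge0//.
rewrite -EFinM mulrCA EFinM lee_wpmul2l ?lee_fin ?modulus_ge0//.
exact: block_cap_integral.
Qed.

End dyadic_weight.

(** * Passage to an everywhere positive weight *)

Section positive_version.
Context {R : realType} {d : measure_display} {X : measurableType d}.
Variables (rho : X -> X -> R) (mu : {measure set X -> \bar R}) (n p : R) (w : X -> R).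
Hypotheses (ht : homogeneous_type rho mu n) (p1 : 1 < p).
Hypotheses (ww : weight rho mu w) (wA : (Ap_const rho mu p w < +oo)%E).

(* A weight is positive only almost everywhere, and a real power of a negative
   number is a junk value. *)
Definition positive_version (x : X) : R := if 0 < w x then w x else 1.
Local Notation v := positive_version.

Let mw : measurable_fun setT w. Proof. by have [] := ww. Qed.

Lemma measurable_positive_version : measurable_fun setT v.
Proof.
apply: measurable_fun_ifT => //; exact: measurable_fun_ltr.
Qed.

Lemma positive_version_gt0 x : 0 < v x.
Proof. by rewrite /v; case: ifP. Qed.

Lemma positive_version_ae : {ae mu, forall x, w x = v x}.
Proof. by have [_ h _] := ww; apply: filterS h => x; rewrite /v => ->. Qed.

Lemma ae_integral_positive (F G : X -> \bar R) (E : set X) : measurable E ->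
  measurable_fun setT F -> measurable_fun setT G ->
  (forall x, w x = v x -> F x = G x) ->
  (\int[mu]_(x in E) F x = \int[mu]_(x in E) G x)%E.
Proof.
move=> mE mF mG FG; apply: ae_eq_integral => //; try exact: measurable_funTS.
by apply: filterS positive_version_ae => x /FG + _.
Qed.

Lemma measurable_EFin_weight (u : X -> R) : measurable_fun setT u ->
  measurable_fun setT (fun x => (u x)%:E).
Proof. by move=> mu_; apply/measurable_EFinP. Qed.

Lemma integral_positive_version (E : set X) : measurable E ->
  (\int[mu]_(x in E) (w x)%:E = weight_measure mu v E)%E.
Proof.
move=> mE; apply: ae_integral_positive => // [||x ->//].
  exact: measurable_EFin_weight.
exact/measurable_EFin_weight/measurable_positive_version.
Qed.

Lemma positive_version_fin x (r : R) : 0 < r ->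
  (weight_measure mu v (qball rho x r) < +oo)%E.
Proof.
move=> r0; have [_ _ /(_ x r r0) h] := ww.
rewrite -integral_positive_version; last exact: homogeneous_measurable_ball ht _ _.
exact: integrable_lty (homogeneous_measurable_ball ht x r) _ h.
Qed.

Lemma positive_version_Ap : exists2 M : R, 0 < M & forall x (r : R), 0 < r ->
  (average mu (qball rho x r) v *
   average mu (qball rho x r) (dual_weight p v) `^ (p - 1) <= M%:E)%E.
Proof.
have [M M0 hM] : exists2 M : R, 0 < M & (Ap_const rho mu p w <= M%:E)%E.
  case: (Ap_const rho mu p w) wA => [a| |]// _.
    (* The maximum makes the bound positive, as required of a number by which [delta] is divided. *)
    exists (Num.max a 1); first by rewrite lt_max ltr01 orbT.
    by rewrite lee_fin le_max lexx.
  by exists 1; rewrite ?leNye.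
exists M => // x r r0; apply: le_trans hM.
have mB := homogeneous_measurable_ball ht x r.
have avE (u u' : X -> R) : (\int[mu]_(y in qball rho x r) (u y)%:E =
    \int[mu]_(y in qball rho x r) (u' y)%:E)%E ->
    average mu (qball rho x r) u = average mu (qball rho x r) u'.
  by rewrite /average => ->.
rewrite -(avE w v (integral_positive_version mB)).
rewrite -(avE (dual_weight p w) (dual_weight p v)).
  by apply: ereal_sup_ubound; exists x, r; split; [exact: r0|reflexivity].
apply: (ae_integral_positive mB).
- exact/measurable_EFin_weight/measurable_dual_weight.
- exact/measurable_EFin_weight/measurable_dual_weight/measurable_positive_version.
- by move=> y wy; rewrite /dual_weight wy.
Qed.

(** Both sides of the size condition are integrals, unchanged when the weight is modified on a null
    set. The estimates for [v] thus apply to blocks for [w]. *)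
Lemma block_positive_version {s : scalar_kind} (V : value_space R s) (t : R)
    (E : set X) (b : X -> value V) : regular_values V -> measurable E ->
  block mu w p t E b -> block mu v p t E b.
Proof.
move=> gV mE [mb b0 bb]; split => //.
rewrite -/(weight_measure mu v E) -(integral_positive_version mE).
have mF (u : X -> R) : measurable_fun setT u -> measurable_fun setT
    (fun x => value_norm (b x) `^ conjugate p%:E * (dual_weight p u x)%:E)%E.
  move=> mu_; apply: emeasurable_funM.
    apply: (measurableT_comp (measurable_poweR _)).
    exact: (measurable_value_norm gV mb).
  by apply: measurable_EFin_weight; exact: measurable_dual_weight.
rewrite -(ae_integral_positive mE (mF _ mw) (mF _ measurable_positive_version))//.
by move=> x wx; rewrite /dual_weight wx.
Qed.

End positive_version.

Lemma block_space_complete (R : realType) (s : scalar_kind) (d : measure_display)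
    (X : measurableType d) (rho : X -> X -> R) (mu : {measure set X -> \bar R})
    (n : R) (I : int -> choiceType) (Q : forall k : int, I k -> set X)
    (kappa0 alpha0 p t : R) (r : \bar R) (w : X -> R) (V : value_space R s) :
  homogeneous_type rho mu n -> dyadic_system rho mu Q kappa0 ->
  reverse_doubling mu Q alpha0 -> 1 < p -> Ap_weight rho mu p w ->
  (exists2 r0, r = r0%:E & p < t < r0) \/ (p <= t /\ r = +oo%E) ->
  regular_values V ->
  banach_space_mod_ae mu (block_space mu Q (V := V) w p t r)
    (block_norm mu Q (V := V) w p t r).
Proof.
move=> ht dy rd p1 [ww wA] hr gV.
have [mw _ _] := ww.
have mQ := @measurable_cube _ _ _ _ _ _ _ _ _ ht dy.
have [e ie] := cubes_countable ht dy.
have [M M0 vA] := positive_version_Ap ht ww wA.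
have cp : 1 < conjugate p%:E.
  by rewrite conjugateE// ltr_pdivlMr ?subr_gt0// mul1r ltrBlDr ltrDl.
have cr : 1 <= @conjugate R r.
  case: hr => [[r0 -> /andP[pt tr]]|[_ ->]]; last first.
    by rewrite /conjugate hoelder_conjugatey.
  have r1 : 1 < r0 by rewrite (lt_trans p1)// (lt_trans pt).
  by rewrite conjugateE// ler_pdivlMr ?subr_gt0// mul1r lerBlDr lerDl.
pose T := {k : int & I k}.
pose L1 (D : set X) (C : R) := forall (lam : T -> scalar_field R s)
  (b : T -> X -> value V), (forall i : T, block mu w p t (Q _ (tagged i)) (b i)) ->
  (\int[mu]_(x in D)
     (\esum_(i in [set: T]) ((modulus (lam i))%:E * value_norm (b i x))) <=
   C%:E * ell_norm (conjugate r) lam)%E.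
(* The cube numbered [m] with its constant, or the empty set with constant 0 if no cube has that
   number. *)
have hDC m : {DC : set X * R | [/\ measurable DC.1, 0 <= DC.2, L1 DC.1 DC.2 &
    forall i : T, e i = m -> DC.1 = Q _ (tagged i)]}.
  apply: cid; case: (pselect (exists i, e i = m)) => [[i ei]|h].
    have [C C0 hC] := cube_local_L1 ht dy rd (measurable_positive_version ww)
      (positive_version_gt0 w) p1 (positive_version_fin ht ww) M0 vA (tagged i)
      gV ie hr.
    exists (Q _ (tagged i), C); split => //=; first exact: ltW.
      move=> lam b bb; apply: hC => j; apply: (block_positive_version ww) => //.
    by move=> j ej; rewrite -(ie _ _ (etrans ei (esym ej))).
  exists (set0, 0); split => //=.
    by move=> lam b bb; rewrite integral_set0 mul0e.
  by move=> i ei; exfalso; apply: h; exists i.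
pose D m := (sval (hDC m)).1; pose C m := (sval (hDC m)).2.
apply: (block_space_banach gV cp cr mw mQ ie (D := D) (C := C)).
- by move=> m; rewrite /D; case: (hDC m) => ? [].
- by move=> m; rewrite /C; case: (hDC m) => ? [].
(* The cubes of generation 0 alone cover almost every point. *)
- exists (~` \bigcup_(tau : I 0) Q _ tau); split.
  + exact/measurableC/(measurable_level ht dy).
  + exact: (dyadic_cover dy).
  + move=> x /= nx [tau _ tx]; apply: nx; exists (e (existT _ 0 tau)).
    rewrite /D; case: (hDC _) => ? /= [_ _ _ /(_ (existT _ 0 tau) erefl) ->].
    exact: tx.
- by move=> m; rewrite /D /C; case: (hDC m) => ? [].
Qed.

Theorem theorem3p10 (R : realType) (s : scalar_kind) (d : measure_display)
    (X : measurableType d) (rho : X -> X -> R) (mu : {measure set X -> \bar R})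
    (n : R) (I : int -> choiceType) (Q : forall k : int, I k -> set X)
    (kappa0 alpha0 : R) (q p t : R) (r : \bar R) (w : X -> R) :
  homogeneous_type rho mu n ->
  mu [set: X] = +oo%E ->
  dyadic_system rho mu Q kappa0 ->
  reverse_doubling mu Q alpha0 ->
  1 < q ->
  1 < p ->
  Ap_weight rho mu p w ->
  (exists2 r0 : R, r = r0%:E &
     p < t < Num.min r0
               (ln (beta_const rho mu alpha0 p w)^-1 / ln 2 * r0 / n)) \/
  (p <= t /\ r = +oo%E) ->
  banach_space_mod_ae mu
    (block_space mu Q (V := ell_values R s (conjugate q%:E)) w p t r)
    (block_norm mu Q (V := ell_values R s (conjugate q%:E)) w p t r) /\
  banach_space_mod_ae mu
    (block_space mu Q (V := scalar_values R s) w p t r)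
    (block_norm mu Q (V := scalar_values R s) w p t r).
Proof.
move=> ht _ dy rd q1 p1 wA hr.
have hr' : (exists2 r0, r = r0%:E & p < t < r0) \/ (p <= t /\ r = +oo%E).
  case: hr => [[r0 rE /andP[pt]]|]; last by right.
  by rewrite lt_min => /andP[tr _]; left; exists r0 => //; rewrite pt tr.
(* Minkowski's inequality for the l^{q'} values requires an exponent at least 1. *)
have cq : 1 <= conjugate q%:E.
  by rewrite conjugateE// ler_pdivlMr ?subr_gt0// mul1r lerBlDr lerDl.
split; apply: block_space_complete ht dy rd p1 wA hr' _.
  exact: regular_ell_values.
exact: regular_scalar_values.
Qed.
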